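(* Let $G$ be a countable sofic group acting continuously on a compact metrizable space $X$, and let $\Sigma=\{\sigma_i:G\to\mathrm{Sym}(d_i)\}_{i=1}^\infty$ be a sofic approximation sequence for $G$. Let $M_G(X)$ be the set of $G$-invariant Borel probability measures on $X$. Then $$h_\Sigma(X,G)=\sup_{\mu\in M_G(X)}h_{\Sigma,\mu}(X,G).$$ In particular, if $h_\Sigma(X,G)\ne-\infty$ then $M_G(X)$ is nonempty.
   Context: **Sofic approximations.** $\mathrm{Sym}(d)$ is the permutation group of $\{1,\dots,d\}$. A sofic approximation sequence for a countable discrete group $G$ is a sequence of maps (not necessarily homomorphisms) $\sigma_i:G\to\mathrm{Sym}(d_i)$, $s\mapsto\sigma_{i,s}$, with $\lim_i d_i=\infty$, $\lim_i \frac1{d_i}|\{k:\sigma_{i,st}(k)=\sigma_{i,s}\sigma_{i,t}(k)\}|=1$ for all $s,t\in G$, and $\lim_i\frac1{d_i}|\{k:\sigma_{i,s}(k)\ne\sigma_{i,t}(k)\}|=1$ for all distinct $s,t\in G$. $G$ is sofic if maps with the last two properties exist. For a map $\sigma:G\to\mathrm{Sym}(d)$, $s\in G$ and $f\in\mathbb C^d\cong C(\{1,\dots,d\})$ put $\sigma_s(f)=f\circ\sigma_s^{-1}$. $\zeta$ is the uniform probability measure on $\{1,\dots,d\}$, viewed as the functional $\zeta(f)=\frac1d\sum_k f(k)$; on $\mathbb C^d$, $\|f\|_2=(\frac1d\sum_k|f(k)|^2)^{1/2}$. For a pseudometric space $(Y,\rho)$ and $\varepsilon\ge0$, $N_\varepsilon(Y,\rho)$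 is the maximal cardinality of a finite $\varepsilon$-separated subset of $Y$ (pairwise distances $>\varepsilon$). Conventions: $\log 0=-\infty$, $\sup\emptyset=-\infty$. For a function $f$ on $X$, $\alpha_s(f)(x)=f(s^{-1}x)$. For a sequence $\mathcal S=\{p_n\}_{n\in\mathbb N}$ of functions put $\rho_{\mathcal S}(\varphi,\psi)=\sum_{n=1}^\infty 2^{-n}\|\varphi(p_n)-\psi(p_n)\|_2$. **Topological entropy.** $C_{\mathbb R}(X)$ denotes the real-valued continuous functions with the supremum norm. A sequence in $C(X)$ is dynamically generating if its image is not contained in any proper $G$-invariant unital $C^*$-subalgebra of $C(X)$. For a sequence $\mathcal S=\{p_n\}$ in the unit ball of $C_{\mathbb R}(X)$, nonempty finite $F\subseteq G$, $\delta>0$ and $\sigma:G\to\mathrm{Sym}(d)$, $\mathrm{Hom}(\mathcal S,F,\delta,\sigma)$ is the set of unital (algebra) homomorphisms $\varphi:C(X)\to\mathbb C^d$ such that $\sum_{n=1}^\infty2^{-n}\|\varphi\circ\alpha_s(p_n)-\sigma_s\circ\varphi(p_n)\|_2<\delta$ for all $s\in F$. Define $h_\Sigma(\mathcal S)=\sup_{\varepsilon>0}\inf_F\inf_{\delta>0}\limsup_{i\to\infty}\frac1{d_i}\log N_\varepsilon(\mathrm{Hom}(\mathcal S,F,\delta,\sigma_i),\rho_{\mathcal S})$, $F$ ranging over nonempty finite subsets of $G$. $h_\Sigma(X,G)$ is the common value of $h_\Sigma(\mathcal S)$ over all dynamically generating sequences $\mathcal S$ in the unit ball of $C_{\mathbb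 R}(X)$ (this value does not depend on $\mathcal S$). **Measure entropy.** Let $\mu\in M_G(X)$. A sequence in $L^\infty(X,\mu)$ is dynamically generating if its image is not contained in any proper $G$-invariant von Neumann subalgebra of $L^\infty(X,\mu)$. Let $\mathcal S=\{p_n\}$ be a sequence in the unit ball (for the $L^\infty$-norm) of the real space $L^\infty_{\mathbb R}(X,\mu)$. For nonempty finite $F\subseteq G$ and $m\in\mathbb N$, $\mathcal S_{F,m}$ is the set of all products $\alpha_{s_1}(f_1)\cdots\alpha_{s_j}(f_j)$ with $1\le j\le m$, $f_1,\dots,f_j\in\{p_1,\dots,p_m\}$, $s_1,\dots,s_j\in F$. For $\delta>0$ and $\sigma:G\to\mathrm{Sym}(d)$, $\mathrm{UP}_\mu(\mathcal S,F,m,\delta,\sigma)$ is the set of unital positive linear maps $\varphi:L^\infty(X,\mu)\to\mathbb C^d$ such that (i) $\|\varphi(\alpha_{s_1}(f_1)\cdots\alpha_{s_j}(f_j))-\varphi(\alpha_{s_1}(f_1))\cdots\varphi(\alpha_{s_j}(f_j))\|_2<\delta$ for all $1\le j\le m$, $f_1,\dots,f_j\in\{p_1,\dots,p_m\}$, $s_1,\dots,s_j\in F$; (ii) $|\zeta\circ\varphi(f)-\mu(f)|<\delta$ for all $f\in\mathcal S_{F,m}$; (iii) $\|\varphi\circ\alpha_s(f)-\sigma_s\circ\varphi(f)\|_2<\delta$ for all $s\in F$, $f\in\{p_1,\dots,p_m\}$. Define $h_{\Sigma,\mu}(\mathcal S)=\sup_{\varepsilon>0}\inf_F\inf_{m\in\mathbb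 N}\inf_{\delta>0}\limsup_{i\to\infty}\frac1{d_i}\log N_\varepsilon(\mathrm{UP}_\mu(\mathcal S,F,m,\delta,\sigma_i),\rho_{\mathcal S})$. $h_{\Sigma,\mu}(X,G)$ is the common value of $h_{\Sigma,\mu}(\mathcal S)$ over all dynamically generating sequences $\mathcal S$ in the unit ball of $L^\infty_{\mathbb R}(X,\mu)$ (this value does not depend on $\mathcal S$). *)

(* Defs.v *)
From HB Require Import structures.
From mathcomp Require Import all_boot all_order all_algebra all_fingroup.
From mathcomp Require Import complex.
From mathcomp Require Import all_classical all_reals all_analysis.
From mathcomp Require Import measurable_realfun ess_sup_inf.

Set Implicit Arguments.
Unset Strict Implicit.
Unset Printing Implicit Defensive.

Import Order.TTheory GRing.Theory Num.Theory.
Import numFieldNormedType.Exports Normc.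

Local Open Scope classical_set_scope.
Local Open Scope ring_scope.

(* The library puts the norm topology on variables of numeric field types;
   this extends it to the concrete type [R[i]]. *)
HB.instance Definition _ (R : realType) := NormedModule.copy R[i] R[i]^o.

Section Sofic.
Variables (R : realType) (G : groupType).
Variables (d : nat -> nat) (sigma : forall i, G -> 'S_(d i)).

(* In 'S_d the product [s * t] maps [k] to [t (s k)]; the composition is
   therefore written out. *)
Definition asymptotically_multiplicative : Prop := forall s t : G,
  (#|[pred k | sigma i (s * t)%g k == sigma i s (sigma i t k)]|%:R / (d i)%:R : R)
    @[i --> \oo] --> (1 : R).

Definition asymptotically_free : Prop := forall s t : G, s <> t ->
  (#|[pred k | sigma i s k != sigma i t k]|%:R / (d i)%:R : R)
    @[i --> \oo] --> (1 : R).

Definition sofic_approximation : Prop :=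
  [/\ d i @[i --> \oo] --> \oo,
      asymptotically_multiplicative & asymptotically_free].

End Sofic.

Definition sofic (R : realType) (G : groupType) : Prop :=
  exists (d : nat -> nat) (sigma : forall i, G -> 'S_(d i)),
    asymptotically_multiplicative R sigma /\ asymptotically_free R sigma.

Section Cd.
Variables (R : realType) (d : nat).
Implicit Type f : 'I_d -> R[i].

Definition perm_act (s : 'S_d) f : 'I_d -> R[i] := fun k => f (s^-1%g k).

Definition zeta f : R[i] := (d%:R)^-1 * \sum_k f k.

Definition norm2 f : R := Num.sqrt (d%:R^-1 * \sum_k normc (f k) ^+ 2).

End Cd.

Definition separation_number (R : realType) (T : Type)
    (eps : R) (Y : set T) (rho : T -> T -> \bar R) : \bar R :=
  ereal_sup [set n%:R%:E | n in [set n : nat |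
    exists A : set T, [/\ A `<=` Y, (A #= `I_n)%card &
      forall a b, A a -> A b -> a <> b -> (eps%:E < rho a b)%E]]].

(* Sequences are indexed from 0: [p n] stands for p_(n+1), hence the weight
   2^-(n+1), and p_1, ..., p_m are the [p n] with [n < m]. *)
Definition rho_seq (R : realType) (V : Type) (p : nat -> V) (d : nat)
    (phi psi : V -> 'I_d -> R[i]) : \bar R :=
  (\sum_(0 <= n <oo) ((2 ^- n.+1 * norm2 (phi (p n) - psi (p n)))%:E))%E.

Arguments rho_seq {R V} p {d} phi psi.

Record cts_action (G : groupType) (X : topologicalType) := CtsAction {
  act :> G -> X -> X;
  act1 : forall x, act 1%g x = x;
  actM : forall s t x, act (s * t)%g x = act s (act t x);
  act_continuous : forall s, continuous (act s) }.

Section ContinuousAlgebra.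
Variables (R : realType) (X : topologicalType).
Local Notation C := R[i].

Definition cts_pred : {pred X -> C} := mem [set f : X -> C | continuous f].

Section Sub.
Context (f : X -> C) (fP : f \in cts_pred).
Definition cts_Sub_subproof := @isContinuous.Build X C f (set_mem fP).
#[local] HB.instance Definition _ := cts_Sub_subproof.
Definition cts_Sub : continuousType X C := f.
End Sub.

Lemma cts_rect (K : continuousType X C -> Type) :
  (forall f (Pf : f \in cts_pred), K (cts_Sub Pf)) -> forall u, K u.
Proof.
move=> Ksub [f [[cf]]].
have Pf : f \in cts_pred by rewrite inE.
have -> : cf = set_mem Pf by exact: Prop_irrelevance.
exact: Ksub.
Qed.

Lemma cts_valP f (Pf : f \in cts_pred) : cts_Sub Pf = f :> (_ -> _).
Proof. by []. Qed.

HB.instance Definition _ :=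
  isSub.Build _ _ (continuousType X C) cts_rect cts_valP.
HB.instance Definition _ := [Choice of continuousType X C by <:].

Lemma cts_predP (f : X -> C) : f \in cts_pred <-> continuous f.
Proof. by rewrite inE. Qed.

Lemma cts_cst (c : C) : continuous (cst c : X -> C).
Proof. by move=> x; exact: cvg_cst. Qed.

Lemma ctsB (f g : X -> C) : continuous f -> continuous g -> continuous (f - g).
Proof. by move=> cf cg x; exact: (cvgB (cf x) (cg x)). Qed.

Lemma ctsD (f g : X -> C) : continuous f -> continuous g -> continuous (f + g).
Proof. by move=> cf cg x; exact: (cvgD (cf x) (cg x)). Qed.

Lemma ctsM (f g : X -> C) : continuous f -> continuous g -> continuous (f * g).
Proof. by move=> cf cg x; exact: (cvgM (cf x) (cg x)). Qed.

Lemma ctsZ (c : C) (f : X -> C) : continuous f -> continuous (c *: f).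
Proof. by move=> cf; exact: (ctsM (@cts_cst c) cf). Qed.

Lemma cts_subring_closed : subring_closed cts_pred.
Proof.
split=> [|f g /cts_predP cf /cts_predP cg|f g /cts_predP cf /cts_predP cg];
  apply/cts_predP.
- exact: (@cts_cst 1).
- exact: (ctsB cf cg).
- exact: (ctsM cf cg).
Qed.

Lemma cts_submod_closed : subsemimod_closed cts_pred.
Proof.
split; first split.
- by apply/cts_predP; exact: (@cts_cst 0).
- by move=> f g /cts_predP cf /cts_predP cg; apply/cts_predP; exact: (ctsD cf cg).
- by move=> c f /cts_predP cf; apply/cts_predP; exact: (ctsZ cf).
Qed.

HB.instance Definition _ := GRing.SubChoice_isSubComPzRing.Build
  (X -> C) cts_pred (continuousType X C) cts_subring_closed.
HB.instance Definition _ := GRing.SubZmodule_isSubLmodule.Build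
  C (X -> C) cts_pred (continuousType X C) cts_submod_closed.

End ContinuousAlgebra.

Section TopologicalEntropy.
Variables (R : realType) (G : groupType) (X : topologicalType).
Variable a : cts_action G X.
Local Notation C := R[i].
Local Notation CX := (continuousType X C).

Definition alpha_cts (s : G) (f : CX) : CX :=
  mkcts (fun x => continuous_comp (@act_continuous _ _ a s^-1%g x)
                    (@cts_fun _ _ f (a s^-1%g x))).

Definition unital_Cstar_subalgebra (A : set CX) : Prop :=
  [/\ A 1,
      forall (c : C) f g, A f -> A g -> A (c *: f + g),
      forall f g, A f -> A g -> A (f * g),
      forall f g : CX, A f -> (forall x, g x = (f x)^*%C) -> A g &
      forall f : CX, (forall e : R, 0 < e ->
        exists2 g : CX, A g & forall x, normc (f x - g x) < e) -> A f].

Definition dyn_generating_cts (p : nat -> CX) : Prop :=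
  forall A : set CX, unital_Cstar_subalgebra A ->
    (forall s f, A f -> A (alpha_cts s f)) ->
    (forall n, A (p n)) -> A = setT.

Definition unit_ball_cts (p : nat -> CX) : Prop :=
  forall n x, p n x \is Num.real /\ normc (p n x) <= 1.

Definition HomS (p : nat -> CX) (F : set G) (delta : R) (d : nat)
    (sigma : G -> 'S_d) : set (CX -> 'I_d -> C) :=
  [set phi : CX -> 'I_d -> C |
    [/\ linear phi, phi 1 = 1, {morph phi : f g / f * g} &
    forall s, F s ->
      (\sum_(0 <= n <oo)
         (2 ^- n.+1 *
          norm2 (phi (alpha_cts s (p n)) - perm_act (sigma s) (phi (p n))))%:E
       < delta%:E)%E]].

Variables (d : nat -> nat) (sigma : forall i, G -> 'S_(d i)).

Definition top_entropy_seq (p : nat -> CX) : \bar R :=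
  ereal_sup [set ereal_inf [set ereal_inf [set
    limn_esup (fun i => ((d i)%:R^-1)%:E *
      lne (separation_number eps (HomS p F delta (sigma i)) (rho_seq p)))%E
    | delta in [set x : R | 0 < x]]
    | F in [set F : set G | finite_set F /\ F !=set0]]
    | eps in [set x : R | 0 < x]].

(* [top_entropy_seq] takes the same value on all generating sequences; this
   common value is realized as the value attained at a chosen one. *)
Definition top_entropy : \bar R :=
  xget -oo%E [set h | exists p : nat -> CX,
    [/\ unit_ball_cts p, dyn_generating_cts p & h = top_entropy_seq p]].

End TopologicalEntropy.

Section Linfty.
Variables (R : realType) (disp : measure_display) (T : measurableType disp).
Variable mu : probability T R.
Local Notation C := R[i].

Definition Linf_pred : {pred T -> C} := mem [set f : T -> C |
  [/\ measurable_fun setT (fun x => complex.Re (f x)),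
      measurable_fun setT (fun x => complex.Im (f x)) &
      finite_norm mu +oo%E (fun x => normc (f x))]].

(* Elements are functions rather than classes modulo null sets; everything
   below is insensitive to modifications on null sets: weak-* closed sets are
   saturated, and positive maps identify almost everywhere equal functions. *)
Definition Linf := {f : T -> C | f \in Linf_pred}.

HB.instance Definition _ := SubChoice.on Linf.

Definition Linf_fun (f : Linf) : T -> C := val f.
Coercion Linf_fun : Linf >-> Funclass.

Lemma finite_norm_ooP (f : T -> R) : finite_norm mu +oo%E f <->
  exists M : R, \forall x \ae mu, `|f x| <= M.
Proof.
have mu0 : (0 < mu [set: T])%E by rewrite probability_setT lte01.
rewrite /finite_norm unlock /Lnorm mu0; split.
  set e := ess_sup _ _ => ey; exists (fine e).
  have /ess_supP : (e <= (fine e)%:E)%E.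
    by case: (e) ey => [r||] //; rewrite leNye.
  by apply: filterS => x /=; rewrite lee_fin.
move=> [M h]; rewrite (@le_lt_trans _ _ M%:E) ?ltry//; apply/ess_supP.
by apply: filterS h => x /=; rewrite lee_fin.
Qed.

Lemma normc_ge0 (z : C) : 0 <= normc z.
Proof. by case: z => x y; rewrite /normc sqrtr_ge0. Qed.

Lemma Linf_predP (f : T -> C) : f \in Linf_pred <->
  [/\ measurable_fun setT (fun x => complex.Re (f x)),
      measurable_fun setT (fun x => complex.Im (f x)) &
      exists M : R, \forall x \ae mu, normc (f x) <= M].
Proof.
rewrite inE /=; split=> -[mR mI].
- move=> /finite_norm_ooP[M fM]; split => //; exists M.
  by apply: filterS fM => x; rewrite ger0_norm// normc_ge0.
- move=> [M fM]; split => //; apply/finite_norm_ooP; exists M.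
  by apply: filterS fM => x; rewrite ger0_norm// normc_ge0.
Qed.

Lemma Linf_cst (c : C) : (cst c : T -> C) \in Linf_pred.
Proof.
apply/Linf_predP; split; [exact: measurable_cst|exact: measurable_cst|].
by exists (normc c); exact: nearW.
Qed.

Lemma LinfB (f g : T -> C) :
  f \in Linf_pred -> g \in Linf_pred -> (f - g) \in Linf_pred.
Proof.
move=> /Linf_predP[mRf mIf [M fM]] /Linf_predP[mRg mIg [N gN]].
apply/Linf_predP; split.
- rewrite (_ : (fun x => _) = fun x => complex.Re (f x) - complex.Re (g x)).
    exact: measurable_funB.
  by apply/funext => x; rewrite !fctE; case: (f x); case: (g x).
- rewrite (_ : (fun x => _) = fun x => complex.Im (f x) - complex.Im (g x)).
    exact: measurable_funB.
  by apply/funext => x; rewrite !fctE; case: (f x); case: (g x).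
- exists (M + N); move: fM gN; apply: filterS2 => x fM gN.
  by rewrite (le_trans (le_normcD _ _))// lerD// normcN.
Qed.

Lemma LinfM (f g : T -> C) :
  f \in Linf_pred -> g \in Linf_pred -> (f * g) \in Linf_pred.
Proof.
move=> /Linf_predP[mRf mIf [M fM]] /Linf_predP[mRg mIg [N gN]].
apply/Linf_predP; split.
- rewrite (_ : (fun x => _) = fun x => complex.Re (f x) * complex.Re (g x)
      - complex.Im (f x) * complex.Im (g x)).
    by apply: measurable_funB; exact: measurable_funM.
  by apply/funext => x; rewrite !fctE; case: (f x); case: (g x).
- rewrite (_ : (fun x => _) = fun x => complex.Re (f x) * complex.Im (g x)
      + complex.Im (f x) * complex.Re (g x)).
    by apply: measurable_funD; exact: measurable_funM.
  by apply/funext => x; rewrite !fctE; case: (f x); case: (g x).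
- exists (M * N); move: fM gN; apply: filterS2 => x fM gN.
  by rewrite normcM ler_pM ?normc_ge0.
Qed.

Lemma Linf_subring_closed : subring_closed Linf_pred.
Proof.
by split; [exact: (Linf_cst 1)|exact: LinfB|exact: LinfM].
Qed.

Lemma Linf_submod_closed : subsemimod_closed Linf_pred.
Proof.
split; first split.
- exact: (Linf_cst 0).
- move=> f g fL gL; rewrite -[g]opprK; apply: (LinfB fL).
  by rewrite -sub0r; exact: (LinfB (Linf_cst 0) gL).
- by move=> c f fL; exact: (LinfM (Linf_cst c) fL).
Qed.

HB.instance Definition _ := GRing.SubChoice_isSubComPzRing.Build
  (T -> C) Linf_pred Linf Linf_subring_closed.

HB.instance Definition _ := GRing.SubZmodule_isSubLmodule.Build
  C (T -> C) Linf_pred Linf Linf_submod_closed.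

Definition cintegral (f : T -> C) : C :=
  Complex (\int[mu]_x complex.Re (f x)) (\int[mu]_x complex.Im (f x)).

Definition cintegrable (f : T -> C) : Prop :=
  mu.-integrable setT (fun x => (complex.Re (f x))%:E) /\
  mu.-integrable setT (fun x => (complex.Im (f x))%:E).

(* Von Neumann subalgebras of L^infty: unital star-subalgebras closed in the
   weak-* topology of the predual L^1. *)
Definition von_Neumann_subalgebra (A : set Linf) : Prop :=
  [/\ A 1,
      forall (c : C) f g, A f -> A g -> A (c *: f + g),
      forall f g, A f -> A g -> A (f * g),
      forall f g : Linf, A f -> (forall x, g x = (f x)^*%C) -> A g &
      forall f : Linf,
        (forall (n : nat) (g : 'I_n -> T -> C), (forall k, cintegrable (g k)) ->
          forall e : R, 0 < e -> exists2 h : Linf, A h &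
            forall k, normc (cintegral (fun x => (f x - h x) * g k x)) < e) ->
        A f].

Definition unit_ball_Linf (p : nat -> Linf) : Prop :=
  forall n, (\forall x \ae mu, p n x \is Num.real) /\
    (Lnorm mu +oo (fun x => (normc (p n x))%:E) <= 1)%E.

Definition unital_positive (d : nat) (phi : Linf -> 'I_d -> C) : Prop :=
  [/\ linear phi, phi 1 = 1 &
      forall f : Linf, (\forall x \ae mu, 0 <= f x) -> forall k, 0 <= phi f k].

End Linfty.

(* Measurable types of the library are pointed; a space carrying a probability
   measure is nonempty, and the base point plays no role. *)
Definition pointed_copy (X : topologicalType) (X0 : [set: X] !=set0) : Type := X.

HB.instance Definition _ (X : topologicalType) (X0 : [set: X] !=set0) :=
  Choice.copy (pointed_copy X0) X.
HB.instance Definition _ (X : topologicalType) (X0 : [set: X] !=set0) :=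
  isPointed.Build (pointed_copy X0) (projT1 (cid X0)).

Definition borel (X : topologicalType) (X0 : [set: X] !=set0) :=
  g_sigma_algebraType (@open X : set (set (pointed_copy X0))).

HB.instance Definition _ (X : topologicalType) (X0 : [set: X] !=set0) :=
  Measurable.on (borel X0).

Record invariant_measure (R : realType) (G : groupType) (X : topologicalType)
    (a : cts_action G X) := InvariantMeasure {
  im_nonempty : [set: X] !=set0;
  im_measure :> probability (borel im_nonempty) R;
  im_invariant : forall (s : G) (B : set (borel im_nonempty)),
    measurable B -> im_measure (a s @^-1` B) = im_measure B }.

Section MeasureEntropy.
Variables (R : realType) (G : groupType) (X : topologicalType).
Variables (a : cts_action G X) (mu : invariant_measure R a).
Local Notation C := R[i].
Local Notation LX := (Linf mu).

Lemma act_measurable (s : G) :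
  measurable_fun setT (a s : borel (im_nonempty mu) -> borel (im_nonempty mu)).
Proof.
apply: (@measurability _ _ (borel (im_nonempty mu)) (borel (im_nonempty mu))
  setT (a s) (@open X : set (set (pointed_copy (im_nonempty mu))))) => //.
move=> _ [B oB <-]; rewrite setTI; apply: sub_gen_smallest => /=.
by move/continuousP : (@act_continuous _ _ a s); apply.
Qed.

Lemma alpha_Linf_subproof (s : G) (f : LX) :
  (fun x => f (a s^-1%g x)) \in Linf_pred mu.
Proof.
have /Linf_predP[mR mI [M [N [mN N0 fN]]]] := valP f.
have ms := act_measurable s^-1%g; apply/Linf_predP; split.
- exact: (measurableT_comp mR ms).
- exact: (measurableT_comp mI ms).
- exists M; exists (a s^-1%g @^-1` N); split.
  + by rewrite -[X in measurable X]setTI; exact: ms.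
  + by rewrite im_invariant.
  + by move=> x /= h; apply: fN.
Qed.

Definition alpha_Linf (s : G) (f : LX) : LX :=
  exist (fun g => g \in Linf_pred mu) _ (alpha_Linf_subproof s f).

Definition dyn_generating_Linf (p : nat -> LX) : Prop :=
  forall A : set LX, von_Neumann_subalgebra A ->
    (forall s f, A f -> A (alpha_Linf s f)) ->
    (forall n, A (p n)) -> A = setT.

Section UP.
Variables (p : nat -> LX) (F : set G) (m : nat) (delta : R) (d : nat).
Variable sigma : G -> 'S_d.

Definition product_set : set LX :=
  [set f | exists (j : nat) (s : 'I_j -> G) (n : 'I_j -> 'I_m),
    [/\ (1 <= j <= m)%N, forall k, F (s k) &
        f = \prod_(k < j) alpha_Linf (s k) (p (n k))]].

Definition UP : set (LX -> 'I_d -> C) :=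
  [set phi : LX -> 'I_d -> C | [/\ unital_positive phi,
    forall (j : nat) (s : 'I_j -> G) (n : 'I_j -> 'I_m),
      (1 <= j <= m)%N -> (forall k, F (s k)) ->
      norm2 (phi (\prod_(k < j) alpha_Linf (s k) (p (n k)))
             - \prod_(k < j) phi (alpha_Linf (s k) (p (n k)))) < delta,
    forall f, product_set f ->
      normc (zeta (phi f) - cintegral mu f) < delta &
    forall s, F s -> forall n : 'I_m,
      norm2 (phi (alpha_Linf s (p n)) - perm_act (sigma s) (phi (p n)))
        < delta]].

End UP.

Variables (d : nat -> nat) (sigma : forall i, G -> 'S_(d i)).

Definition measure_entropy_seq (p : nat -> LX) : \bar R :=
  ereal_sup [set ereal_inf [set ereal_inf [set ereal_inf [set
    limn_esup (fun i => ((d i)%:R^-1)%:E *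
      lne (separation_number eps (UP p F m delta (sigma i)) (rho_seq p)))%E
    | delta in [set x : R | 0 < x]]
    | m in [set m : nat | (0 < m)%N]]
    | F in [set F : set G | finite_set F /\ F !=set0]]
    | eps in [set x : R | 0 < x]].

(* Same convention as for [top_entropy]. *)
Definition measure_entropy : \bar R :=
  xget -oo%E [set h | exists p : nat -> LX,
    [/\ unit_ball_Linf p, dyn_generating_Linf p & h = measure_entropy_seq p]].

End MeasureEntropy.

Arguments top_entropy R {G X} a {d} sigma.
Arguments measure_entropy {R G X a} mu {d} sigma.

(* Main.v *)
Require Import Defs.
From HB Require Import structures.
From mathcomp Require Import all_boot all_order all_algebra all_fingroup.
From mathcomp Require Import complex.
From mathcomp Require Import all_classical all_reals all_analysis.
From mathcomp Require Import measurable_realfun ess_sup_inf finmap ring lra zify.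

(** Everything is done for real functions and in the norm [mean |.|] of the
    finite coordinate spaces, which for uniformly bounded vectors is equivalent
    to the 2-norm.  A microstate, topological or measure-theoretic, is viewed
    as a state map [U]: for every coordinate [k], [U _ k] is a positive unital
    functional on an algebra of functions.  For homomorphisms on [C(X)] these
    functionals are evaluations at points ([character_evaluation]); for the
    unital positive maps of a measure they are general.

    Both entropies have the form [sup_eps inf_A limsup_i log N_eps(A_i) / d_i]
    where [A] runs through a filter of sets of microstates
    ([top_entropy_growth], [measure_entropy_growth]).  Along such a filter the
    epsilon-delta conditions on microstates become asymptotic ones: the state
    maps tend to be multiplicative on [f] (their [spread] at [f] vanishes),
    equivariant, and, for a measure [mu], to have mean [mu].  These asymptotic
    properties pass from a generating sequence to all functions, because the
    functions having them form a closed invariant algebra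
    ([generated_continuous], [generated_measurable]).  The same argument applied
    to pairs of microstates shows that two microstates close on a generating
    sequence are close on every function ([asymptotic_continuous],
    [asymptotic_measurable]).  To compare two entropies it therefore suffices to
    couple microstates of the two kinds so that they asymptotically agree on
    enough functions ([coupling], [growth_transfer]).

    Coupling requires changing the class of functions on which a state lives.
    Given a partition of unity [h_j] on whose members finitely many functions
    are almost constant, a state [W] is replaced with
    [f |-> sum_j W(h_j) mu(h_j f) / mu(h_j)]; this makes sense for every bounded
    measurable [f], has mean close to [mu] as soon as the means of the [W(h_j)]
    are close to [mu(h_j)], and changes the values at the given functions only
    slightly ([smear_mean], [smear_close], [smear_spread]).

    Topological entropy is at most the supremum of the measure entropies
    ([top_le_measure]).  If the former exceeds [h], an ultrafilter of sets of
    homomorphisms has growth at least [h] ([growth_ultrafilter]).  The empirical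
    measures of the corresponding points converge along it, and by the
    Riesz-Markov theorem and equivariance the limit is an invariant measure
    [mu] ([limit_invariant_measure]).  Smearing the evaluations along partitions
    of unity into continuous functions yields microstates of [mu]; since
    continuous functions are dense in [L^1(mu)], these satisfy all requirements.

    Conversely, the entropy of every [mu] is at most the topological entropy
    ([measure_le_top]).  Microstates of [mu] only control products of translates
    of the generators, so the partition of unity is built from Bernstein
    polynomials in these ([bernstein_partition]).  After smearing, the states
    concentrate on every continuous function, and a state that does so is close
    to the evaluation at a point ([state_point]); these evaluations are
    topological microstates.

    The two entropies are common values over generating sequences, so finally
    such sequences have to exist ([exists_generating_cts],
    [exists_generating_Linf]). *)

Set Implicit Arguments.
Unset Strict Implicit.
Unset Printing Implicit Defensive.

Import Order.TTheory GRing.Theory Num.Theory.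
Import numFieldNormedType.Exports Normc.

Local Open Scope classical_set_scope.
Local Open Scope ring_scope.

(** * Separation numbers and growth along filters *)

Section SeparationNumber.
Context {R : realType}.

Lemma separation_number_ge0 T eps (Y : set T) rho :
  (0 <= separation_number (R := R) eps Y rho)%E.
Proof.
apply: ereal_sup_ubound; exists 0%N => //=; exists set0; split => //.
by rewrite II0 card_eq00.
Qed.

Lemma le_separation_number T T' eps eps' (Y : set T) (Y' : set T')
    (rho : T -> T -> \bar R) (rho' : T' -> T' -> \bar R) (f : T -> T') :
  (forall y, Y y -> Y' (f y)) ->
  (forall y, Y y -> (rho' (f y) (f y) <= eps'%:E)%E) ->
  (forall y z, Y y -> Y z ->
    (rho' (f y) (f z) <= eps'%:E)%E -> (rho y z <= eps%:E)%E) ->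
  (separation_number eps Y rho <= separation_number eps' Y' rho')%E.
Proof.
move=> fY r0 fsep; apply: le_ereal_sup => _ [n [A [AY An Asep]] <-].
exists n => //; exists (f @` A); split.
- by move=> _ [y Ay <-]; apply/fY/AY.
- apply: card_eq_trans An; apply: inj_card_eq => y z /set_mem Ay /set_mem Az yz.
  apply: contrapT => /(Asep _ _ Ay Az); rewrite ltNge => /negP; apply.
  by apply: fsep; [exact: AY|exact: AY|rewrite yz; apply/r0/AY].
- move=> _ _ [y Ay <-] [z Az <-] yz; rewrite ltNge; apply/negP => h.
  have yz' : y <> z by move=> e; apply: yz; rewrite e.
  have := Asep _ _ Ay Az yz'; rewrite ltNge => /negP; apply.
  by apply: fsep => //; exact: AY.
Qed.

Lemma separation_number_sub T eps (A B : set T) (rho : T -> T -> \bar R) :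
  A `<=` B -> (separation_number eps A rho <= separation_number eps B rho)%E.
Proof.
move=> AB; apply: le_ereal_sup => _ [n [S [SA Sn Ssep]] <-]; exists n => //.
by exists S; split => // y /SA /AB.
Qed.

Lemma separation_number_set0 T eps (rho : T -> T -> \bar R) :
  (separation_number eps set0 rho <= 0)%E.
Proof.
apply: ge_ereal_sup => _ [n [S [S0 Sn _]] <-].
suff -> : n = 0%N by [].
apply/card_eq_II; rewrite II0 -(card_eql Sn) (_ : S = set0) ?card_eq00//.
by apply/seteqP; split => // x /S0.
Qed.

Lemma separation_numberU T eps (A B : set T) (rho : T -> T -> \bar R) :
  (separation_number eps (A `|` B) rho <=
   separation_number eps A rho + separation_number eps B rho)%E.
Proof.
apply: ge_ereal_sup => _ [n [S [SAB Sn Ssep]] <-].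
pose S' : set {classic T} := S.
have Sfin : finite_set S' by exists n.
pose N (C : set T) := #|` fset_set (S' `&` C) |.
have part (C : set T) : ((N C)%:R%:E <=
    separation_number eps C rho)%E.
  apply: ereal_sup_ubound; exists (N C) => //.
  have fC : finite_set (S' `&` C) by apply: sub_finite_set Sfin => x [].
  exists (S' `&` C); split; first by move=> x [].
  - have : ([set` fset_set (S' `&` C)] #= `I_(N C))%card by apply/card_eq_fsetP.
    by rewrite fset_setK.
  - by move=> x y [Sx _] [Sy _]; exact: Ssep.
have -> : n = #|` fset_set S' | by apply/esym/card_fset_set.
apply: le_trans (leeD (part A) (part B)).
rewrite -EFinD lee_fin -natrD ler_nat -cardfsUI.
apply: leq_trans (leq_addr _ _); apply: fsubset_leq_card.
have fI C : finite_set (S' `&` C) by apply: sub_finite_set Sfin => x [].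
rewrite -fset_setU//; apply/fsubsetP => x.
rewrite !in_fset_set//; last by rewrite finite_setU; split.
move=> /set_mem Sx; apply/mem_set.
by case: (SAB x Sx) => [Ax|Bx]; [left|right].
Qed.

End SeparationNumber.

Section Growth.
Context {R : realType} (d : nat -> nat).

Definition fiber (Y : nat -> Type) (A : set {i & Y i}) (i : nat) : set (Y i) :=
  [set y | A (existT _ i y)].
Arguments fiber {Y} A i.

Definition rate (Y : nat -> Type) (rho : forall i, Y i -> Y i -> \bar R)
    (eps : R) (A : set {i & Y i}) : \bar R :=
  limn_esup (fun i => ((d i)%:R^-1)%:E *
    lne (separation_number eps (fiber A i) (@rho i)))%E.

(** For the filter generated by the sets of microstates with parameters
    [(F, delta)], the infimum over the filter is the infimum over the
    parameters. *)
Definition growth (Y : nat -> Type) (rho : forall i, Y i -> Y i -> \bar R)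
    (eps : R) (F : set_system {i & Y i}) : \bar R :=
  ereal_inf [set rate rho eps A | A in F].

Hypothesis dy : d i @[i --> \oo] --> \oo.

Lemma limn_esup_le (u v : nat -> \bar R) :
  (\forall i \near \oo, (u i <= v i)%E) -> (limn_esup u <= limn_esup v)%E.
Proof.
move=> uv; apply: le_ereal_inf_tmp => _ [V FV <-].
have FVuv : nbhs \oo (V `&` [set i | (u i <= v i)%E]) by exact: filterI.
apply: le_trans (_ : ereal_sup (u @` (V `&` [set i | (u i <= v i)%E])) <= _)%E.
  by apply: ereal_inf_lbound; exists (V `&` [set i | (u i <= v i)%E]).
apply: ge_ereal_sup => _ [i [Vi uvi] <-]; apply: (le_trans uvi).
by apply: ereal_sup_ubound; exists i.
Qed.

Lemma limn_esup_lt (u : nat -> \bar R) x :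
  (limn_esup u < x)%E -> exists2 y, (y < x)%E & \forall i \near \oo, (u i <= y)%E.
Proof.
move=> /ereal_inf_lt[_ [V FV <-]] h; exists (ereal_sup (u @` V)) => //.
by apply: filterS FV => i Vi; apply: ereal_sup_ubound; exists i.
Qed.

Lemma limn_esup_le_cst (u : nat -> \bar R) y :
  (\forall i \near \oo, (u i <= y)%E) -> (limn_esup u <= y)%E.
Proof.
move=> uy; apply: le_trans (_ : ereal_sup (u @` [set i | (u i <= y)%E]) <= _)%E.
  by apply: ereal_inf_lbound; exists [set i | (u i <= y)%E].
by apply: ge_ereal_sup => _ [i + <-].
Qed.

Lemma d_gt0 : \forall i \near \oo, (0 < d i)%N.
Proof. by have /(_ [set n | (0 < n)%N]) := dy; apply; exists 1%N. Qed.

Lemma le_rate (Y Y' : nat -> Type) (rho : forall i, Y i -> Y i -> \bar R)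
    (rho' : forall i, Y' i -> Y' i -> \bar R) eps eps' A A' :
  (\forall i \near \oo, (separation_number eps (fiber A i) (@rho i) <=
    separation_number eps' (fiber A' i) (@rho' i))%E) ->
  (rate rho eps A <= rate rho' eps' A')%E.
Proof.
move=> h; apply: limn_esup_le; apply: filterS h => i h.
apply: lee_wpmul2l; first by rewrite lee_fin invr_ge0.
have [->|n0] := eqVneq (separation_number eps (fiber A i) (@rho i)) 0%E.
  by rewrite le0_lneNy// leNye.
by rewrite lee_lne// in_itv/= leey andbT separation_number_ge0.
Qed.

(** Bounds on the rate are bounds on the separation numbers themselves; only in
    that form can they be added. *)
Lemma rate_lt (Y : nat -> Type) (rho : forall i, Y i -> Y i -> \bar R)
    eps A (h : R) : (rate rho eps A < h%:E)%E -> exists2 h' : R, h' < h &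
    \forall i \near \oo, (separation_number eps (fiber A i) (@rho i) <=
       (expR (h' * (d i)%:R))%:E)%E.
Proof.
move=> /limn_esup_lt[y yh uy].
have [h' h'h yh'] : exists2 h' : R, h' < h & (y <= h'%:E)%E.
  case: y yh {uy} => [r||] // rh; first by exists r.
  by exists (h - 1); rewrite ?leNye// ltrBlDr ltrDl.
exists h' => //; near=> i; have d0 : (0 < d i)%N by near: i; exact: d_gt0.
have : (((d i)%:R^-1)%:E * lne (separation_number eps (fiber A i) (@rho i))
  <= h'%:E)%E by apply: le_trans yh'; near: i.
set N := separation_number _ _ _; have N0 : (0 <= N)%E.
  exact: separation_number_ge0.
case: N N0 => [r||] //; last first.
  by rewrite /= gt0_muley// lte_fin invr_gt0 ltr0n.
rewrite lee_fin le_eqVlt => /predU1P[<-|r0].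
  by move=> _; rewrite lee_fin expR_ge0.
rewrite lne_EFin// lee_fin mulrC ler_pdivrMr ?ltr0n// => h1.
by rewrite lee_fin -ler_ln ?posrE ?expR_gt0// expRK.
Unshelve. all: by end_near. Qed.

Lemma rate_le (Y : nat -> Type) (rho : forall i, Y i -> Y i -> \bar R)
    eps A (h C : R) : 0 < C ->
    (\forall i \near \oo, (separation_number eps (fiber A i) (@rho i) <=
       (C * expR (h * (d i)%:R))%:E)%E) -> (rate rho eps A <= h%:E)%E.
Proof.
move=> C0 uh; apply/lee_addgt0Pr => e e0; apply: limn_esup_le_cst; near=> i.
have d0 : (0 < d i)%N by near: i; exact: d_gt0.
have : (separation_number eps (fiber A i) (@rho i) <=
       (C * expR (h * (d i)%:R))%:E)%E by near: i.
set N := separation_number _ _ _; have N0 : (0 <= N)%E.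
  exact: separation_number_ge0.
case: N N0 => [r||] //.
rewrite lee_fin le_eqVlt => /predU1P[<- _|r0].
  by rewrite le0_lneNy// gt0_muleNy ?leNye// lte_fin invr_gt0 ltr0n.
rewrite lne_EFin// -EFinD !lee_fin => h1; rewrite [_^-1 * _]mulrC ler_pdivrMr ?ltr0n//.
have : ln r <= ln C + h * (d i)%:R.
  rewrite -[X in _ + X]expRK -lnM ?posrE ?expR_gt0//.
  by rewrite ler_ln ?posrE ?mulr_gt0 ?expR_gt0.
move=> /le_trans; apply; rewrite mulrDl addrC lerD2l mulrC -ler_pdivrMr//.
have : (Num.truncn `|ln C / e| < d i)%N.
  near: i; have /(_ [set n | (Num.truncn `|ln C / e| < n)%N]) := dy; apply.
  by exists (Num.truncn `|ln C / e|).+1.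
move=> h2; apply: (le_trans (ler_norm _)); apply: ltW.
apply: lt_le_trans (_ : (Num.truncn `|ln C / e|).+1%:R <= _); last by rewrite ler_nat.
by rewrite truncnS_gt.
Unshelve. all: by end_near. Qed.

(** The sets of microstates growing at a rate below [h] form an ideal, because
    a union at most doubles the separation numbers; an ultrafilter avoiding
    this ideal therefore exists above every filter of growth more than [h]. *)
Lemma growth_ultrafilter (Y : nat -> Type)
    (rho : forall i, Y i -> Y i -> \bar R) eps (h : R) F : Filter F ->
  (h%:E < growth rho eps F)%E -> exists U, [/\ UltraFilter U, F `<=` U &
    (h%:E <= growth rho eps U)%E].
Proof.
move=> FF hF; pose small A := (rate rho eps A < h%:E)%E.
have smallS A B : A `<=` B -> small B -> small A.
  move=> AB; apply: le_lt_trans; apply: le_rate; near=> i.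
  by apply: separation_number_sub => y; exact: AB.
have smallU A B : small A -> small B -> small (A `|` B).
  move=> /rate_lt[a ah hA] /rate_lt[b bh hB].
  have abh : Num.max a b < h by rewrite gt_max ah.
  apply: (@le_lt_trans _ _ (Num.max a b)%:E); last by rewrite lte_fin.
  apply: (@rate_le _ _ _ _ _ 2) => //; near=> i.
  have -> : fiber (A `|` B) i = fiber A i `|` fiber B i by [].
  apply: (le_trans (separation_numberU _ _ _ _)).
  rewrite mulr_natl mulr2n EFinD; apply: leeD.
    apply: (@le_trans _ _ (expR (a * (d i)%:R))%:E); first by near: i.
    by rewrite lee_fin ler_expR ler_wpM2r// le_max lexx.
  apply: (@le_trans _ _ (expR (b * (d i)%:R))%:E); first by near: i.
  by rewrite lee_fin ler_expR ler_wpM2r// le_max lexx orbT.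
have Fsmall A : F A -> ~ small A.
  move=> FA; apply/negP; rewrite -leNgt; apply: (le_trans (ltW hF)).
  by apply: ereal_inf_lbound; exists A.
(* The sets that contain an element of [F] up to a small set. *)
pose F' A := exists2 B, F B & small (B `&` ~` A).
have FF' : ProperFilter F'.
  split.
    by move=> [B FB]; rewrite setC0 setIT; exact: Fsmall.
  split.
  - exists setT; first exact: filterT.
    rewrite setCT setI0; rewrite /small.
    apply: (@le_lt_trans _ _ (h - 1)%:E); last by rewrite lte_fin ltrBlDr ltrDl.
    apply: (@rate_le _ _ _ _ _ 1) => //; near=> i.
    rewrite (_ : fiber set0 i = set0)//.
    apply: (le_trans (separation_number_set0 _ _)).
    by rewrite lee_fin mul1r expR_ge0.
  - move=> A B [C FC hC] [D FD hD]; exists (C `&` D); first exact: filterI.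
    apply: smallS (smallU _ _ hC hD) => x [[Cx Dx]] /not_andP[nA|nB].
      by left.
    by right.
  - move=> A B AB [C FC hC]; exists C => //; apply: smallS hC => x [Cx nB].
    by split => // /AB.
have [U [UU F'U]] := ultraFilterLemma FF'.
exists U; split => //.
- move=> A FA; apply: F'U; exists A => //; rewrite setICr.
  have [B FB] : F' setT by exact: filterT.
  by rewrite setCT setI0.
- apply: le_ereal_inf_tmp => _ [A UA <-]; rewrite leNgt; apply/negP => sA.
  have : U (~` A) by apply: F'U; exists setT; [exact: filterT|rewrite setTI setCK].
  move=> UnA; have : U set0 by rewrite -(setICr A); exact: filterI.
  exact: filter_not_empty.
Unshelve. all: by end_near. Qed.

End Growth.

(** * Means, vanishing quantities and state maps *)

Section Mean.
Context {R : realType} {d : nat}.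
Implicit Types f g : 'I_d -> R.

Definition mean f : R := d%:R^-1 * \sum_k f k.

Lemma mean_le f g : (forall k, f k <= g k) -> mean f <= mean g.
Proof. by move=> fg; rewrite ler_wpM2l ?invr_ge0// ler_sum. Qed.

Lemma meanD f g : mean (fun k => f k + g k) = mean f + mean g.
Proof. by rewrite /mean big_split/= mulrDr. Qed.

Lemma meanZ c f : mean (fun k => c * f k) = c * mean f.
Proof. by rewrite /mean -mulr_sumr mulrCA. Qed.

Lemma mean_ge0 f : (forall k, 0 <= f k) -> 0 <= mean f.
Proof. by move=> f0; rewrite mulr_ge0 ?invr_ge0// sumr_ge0. Qed.

Lemma mean_norm f : `|mean f| <= mean (fun k => `|f k|).
Proof.
by rewrite normrM ger0_norm ?invr_ge0// ler_wpM2l ?invr_ge0// ler_norm_sum.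
Qed.

Lemma mean_cst_le c : 0 <= c -> mean (fun=> c) <= c.
Proof.
move=> c0; rewrite /mean sumr_const card_ord -[c *+ d]mulr_natl mulrA.
by case: (d) => [|n]; rewrite ?invr0 ?mul0r// mulVf ?mul1r// pnatr_eq0.
Qed.

Lemma mean_cst c : (0 < d)%N -> mean (fun=> c) = c.
Proof.
move=> d0; rewrite /mean sumr_const card_ord -[c *+ d]mulr_natl mulrA.
by rewrite mulVf ?mul1r// pnatr_eq0 -lt0n.
Qed.

Lemma mean_dim0 f : d = 0%N -> mean f = 0.
Proof.
move=> d0; rewrite /mean big1 ?mulr0// => k _.
by suff : (k < 0)%N by []; rewrite -[X in (_ < X)%N]d0 ltn_ord.
Qed.

Lemma mean_perm (s : 'S_d) f : mean (fun k => f (s k)) = mean f.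
Proof. by rewrite /mean [in RHS](reindex_inj (@perm_inj _ s)). Qed.

Lemma mean_sum (I : finType) (F : I -> 'I_d -> R) :
  mean (fun k => \sum_j F j k) = \sum_j mean (F j).
Proof. by rewrite /mean exchange_big/= mulr_sumr. Qed.

End Mean.

(** Everything below is one-sided: [vanishes F h] is only used for quantities
    [h] that are bounded below by 0. *)
Definition vanishes {R : realType} {Z : Type} (F : set_system Z) (h : Z -> R) :=
  forall e, 0 < e -> \forall z \near F, h z <= e.

Section Vanishes.
Context {R : realType} {Z : Type} {F : set_system Z} {FF : Filter F}.
Implicit Types h g : Z -> R.

Lemma vanishes_le h g : vanishes F g -> (\forall z \near F, h z <= g z) ->
  vanishes F h.
Proof. by move=> v hg e e0; apply: filterS2 hg (v e e0) => z; exact: le_trans. Qed.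

Lemma vanishesD h g : vanishes F h -> vanishes F g ->
  vanishes F (fun z => h z + g z).
Proof.
move=> vh vg e e0; have e2 : 0 < e / 2 by rewrite divr_gt0.
by apply: filterS2 (vh _ e2) (vg _ e2) => z hz gz; rewrite [e]splitr lerD.
Qed.

Lemma vanishesZ c h : 0 <= c -> vanishes F h -> vanishes F (fun z => c * h z).
Proof.
rewrite le_eqVlt => /predU1P[<- _ e e0|c0 vh e e0].
  by apply: nearW => z; rewrite mul0r ltW.
apply: filterS (vh (c^-1 * e) _) => [z hz|]; last by rewrite mulr_gt0 ?invr_gt0.
by rewrite mulrC -ler_pdivlMr// mulrC.
Qed.

Lemma vanishes_approx h : (forall e, 0 < e -> exists2 g, vanishes F g &
  \forall z \near F, h z <= g z + e) -> vanishes F h.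
Proof.
move=> happ e e0; have e2 : 0 < e / 2 by rewrite divr_gt0.
have [g vg hg] := happ _ e2; apply: filterS2 hg (vg _ e2) => z hz gz.
by rewrite (le_trans hz)// [leRHS]splitr lerD2r.
Qed.

End Vanishes.

Section StateMaps.
Context {R : realType} {X : Type}.
Implicit Types (f g : X -> R) (V : set (X -> R)).

Definition absf f : X -> R := fun x => `|f x|.

Record function_algebra V : Prop := FunctionAlgebra {
  fa_cst : forall c : R, V (cst c);
  fa_lin : forall (c : R) f g, V f -> V g -> V (c *: f + g);
  fa_mul : forall f g, V f -> V g -> V (f * g);
  fa_abs : forall f, V f -> V (absf f);
  fa_bnd : forall f, V f -> exists M : R, forall x, `|f x| <= M }.

Record state_map V d (U : (X -> R) -> 'I_d -> R) : Prop := StateMap {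
  sm_one : forall k, U (cst 1) k = 1;
  sm_lin : forall (c : R) f g k, V f -> V g ->
    U (c *: f + g) k = c * U f k + U g k;
  sm_mono : forall f g k, V f -> V g -> (forall x, f x <= g x) ->
    U f k <= U g k }.

(** The mean over [k] of the first absolute moment of [f] under the state
    [U _ k]: it is small when most of these states nearly evaluate [f] at a
    point. *)
Definition spread d (U : (X -> R) -> 'I_d -> R) f : R :=
  mean (fun k => U (absf (f - cst (U f k))) k).

Context {V : set (X -> R)} (algV : function_algebra V).

Lemma fa_add f g : V f -> V g -> V (f + g).
Proof. by move=> Vf Vg; rewrite -[f]scale1r; exact: (fa_lin algV). Qed.

Lemma fa_scale (c : R) f : V f -> V (c *: f).
Proof.
by move=> Vf; rewrite -[_ *: _]addr0; apply: (fa_lin algV) => //; exact: (fa_cst algV 0).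
Qed.

Lemma fa_sub f g : V f -> V g -> V (f - g).
Proof. by move=> Vf Vg; apply: fa_add => //; rewrite -scaleN1r; exact: fa_scale. Qed.

Lemma fa_absB f c : V f -> V (absf (f - cst c)).
Proof. by move=> Vf; apply/(fa_abs algV)/fa_sub => //; exact: (fa_cst algV). Qed.

Context {d : nat} {U : (X -> R) -> 'I_d -> R} (sU : state_map V U).

Lemma sm_add f g k : V f -> V g -> U (f + g) k = U f k + U g k.
Proof. by move=> Vf Vg; rewrite -[f]scale1r (sm_lin sU)// mul1r scale1r. Qed.

Lemma sm_zero k : U (cst 0) k = 0.
Proof.
have V0 := fa_cst algV 0.
by have /eqP := sm_add k V0 V0; rewrite [cst 0 + _]addr0 -subr_eq subrr => /eqP.
Qed.

Lemma sm_scale (c : R) f k : V f -> U (c *: f) k = c * U f k.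
Proof.
move=> Vf; rewrite -[X in U X]addr0 (sm_lin sU)//; last exact: (fa_cst algV 0).
by rewrite (sm_zero k) addr0.
Qed.

Lemma sm_sub f g k : V f -> V g -> U (f - g) k = U f k - U g k.
Proof.
move=> Vf Vg; rewrite sm_add//; last by rewrite -scaleN1r; exact: fa_scale.
by rewrite -scaleN1r sm_scale// mulN1r.
Qed.

Lemma sm_cst (c : R) k : U (cst c) k = c.
Proof.
rewrite (_ : cst c = c *: cst 1); last by apply/funext => x; rewrite !fctE [RHS]mulr1.
by rewrite sm_scale ?(sm_one sU) ?mulr1//; exact: (fa_cst algV).
Qed.

Lemma sm_subc f c k : V f -> U (f - cst c) k = U f k - c.
Proof. by move=> Vf; rewrite sm_sub ?sm_cst//; exact: (fa_cst algV). Qed.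

Lemma sm_ge0 f k : V f -> (forall x, 0 <= f x) -> 0 <= U f k.
Proof. by move=> Vf f0; rewrite -(sm_cst 0 k) (sm_mono sU)//; exact: (fa_cst algV). Qed.

Lemma sm_abs f k : V f -> `|U f k| <= U (absf f) k.
Proof.
move=> Vf; have Va := fa_abs algV Vf; rewrite ler_norml; apply/andP; split.
  rewrite lerNl -mulN1r -sm_scale//; apply: (sm_mono sU) => //.
    exact: fa_scale.
  by move=> x; rewrite fctE /absf [leLHS]mulN1r -normrN ler_norm.
by apply: (sm_mono sU) => // x; exact: ler_norm.
Qed.

Lemma sm_abs_ge0 f k : V f -> 0 <= U (absf f) k.
Proof. by move=> Vf; exact: le_trans (sm_abs k Vf). Qed.

Lemma sm_le_cst f c k : V f -> (forall x, f x <= c) -> U f k <= c.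
Proof. by move=> Vf fc; rewrite -(sm_cst c k) (sm_mono sU)//; exact: (fa_cst algV). Qed.

Lemma sm_bnd f M k : V f -> (forall x, `|f x| <= M) -> `|U f k| <= M.
Proof.
move=> Vf fM; apply: le_trans (sm_abs k Vf) _.
by apply: sm_le_cst => //; exact: (fa_abs algV).
Qed.

Lemma mean_sm_sub f g : V f -> V g ->
  mean (fun k => `|U f k - U g k|) <= mean (U (absf (f - g))).
Proof.
move=> Vf Vg; apply: mean_le => k; rewrite -sm_sub//.
by apply: sm_abs; exact: fa_sub.
Qed.

Lemma spread_ge0 f : V f -> 0 <= spread U f.
Proof.
move=> Vf; apply: mean_ge0 => k; apply: sm_abs_ge0.
by apply: fa_sub => //; exact: (fa_cst algV).
Qed.

(** A median-type bound: centering at the mean instead of at any other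
    constant costs a factor 2. *)
Lemma spread_center f (c : 'I_d -> R) : V f ->
  spread U f <= 2 * mean (fun k => U (absf (f - cst (c k))) k).
Proof.
move=> Vf; rewrite -meanZ; apply: mean_le => k.
have Va b : V (absf (f - cst b)) by exact: fa_absB.
have h : `|U f k - c k| <= U (absf (f - cst (c k))) k.
  by rewrite -sm_subc//; apply/sm_abs/fa_sub => //; exact: (fa_cst algV).
rewrite mulr_natl mulr2n; apply: le_trans (lerD h (lexx _)).
rewrite -(sm_cst `|U f k - c k| k) -sm_add//; last exact: (fa_cst algV).
apply: (sm_mono sU) => //; first by apply: fa_add => //; exact: (fa_cst algV).
move=> x; rewrite /absf !fctE.
rewrite (_ : f x - U f k = - (U f k - c k) + (f x - c k)); last by ring.
by rewrite (le_trans (ler_normD _ _))// normrN.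
Qed.

Lemma spread_cst c : spread U (cst c) = 0.
Proof.
rewrite /spread (_ : (fun k => _) = fun=> 0); last first.
  apply/funext => k; rewrite sm_cst -[RHS](sm_zero k); congr (U _ k).
  by apply/funext => x; rewrite /absf !fctE subrr normr0.
by rewrite /mean big1// mulr0.
Qed.

Lemma spread_lin (c : R) f g : V f -> V g ->
  spread U (c *: f + g) <= `|c| * spread U f + spread U g.
Proof.
move=> Vf Vg; rewrite -meanZ -meanD; apply: mean_le => k.
rewrite -(sm_lin sU _ k); [|exact: fa_absB|exact: fa_absB].
apply: (sm_mono sU).
- by apply: fa_absB; exact: (fa_lin algV).
- by apply: (fa_lin algV) => //; exact: fa_absB.
- move=> x; rewrite (sm_lin sU)// /absf !fctE.
  rewrite (_ : c *: f x + g x - (c * U f k + U g k) =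
    c * (f x - U f k) + (g x - U g k)); last by rewrite /GRing.scale/=; ring.
  by rewrite (le_trans (ler_normD _ _))// normrM.
Qed.

(** Centering at the product of the two values reduces the product to
    [fg - ab = f(g - b) + b(f - a)]. *)
Lemma spread_mul f g M N : V f -> V g ->
  (forall x, `|f x| <= M) -> (forall x, `|g x| <= N) ->
  spread U (f * g) <= 2 * (M * spread U g + N * spread U f).
Proof.
move=> Vf Vg fM gN.
apply: le_trans (spread_center (fun k => U f k * U g k) _) _.
  exact: (fa_mul algV).
rewrite ler_pM2l// -!meanZ -meanD; apply: mean_le => k.
have Vag := fa_absB (U g k) Vg; have Vaf := fa_absB (U f k) Vf.
rewrite -(sm_scale N k Vaf) -(sm_lin sU M k Vag); last exact: fa_scale.
apply: (sm_mono sU).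
- by apply: fa_absB; exact: (fa_mul algV).
- by apply: (fa_lin algV) => //; exact: fa_scale.
- move=> x; rewrite /absf !fctE.
  rewrite (_ : f x * g x - U f k * U g k =
    f x * (g x - U g k) + U g k * (f x - U f k)); last by ring.
  apply: (le_trans (ler_normD _ _)); rewrite !normrM.
  apply: lerD; apply: ler_wpM2r => //.
  exact: sm_bnd.
Qed.

(** The state is multiplicative up to the dispersion of one of the factors. *)
Lemma sm_mul f g M : V f -> V g -> (forall x, `|f x| <= M) ->
  mean (fun k => `|U (f * g) k - U f k * U g k|) <= M * spread U g.
Proof.
move=> Vf Vg fM; rewrite -meanZ; apply: mean_le => k.
have Vc : V (g - cst (U g k)) by apply: fa_sub => //; exact: (fa_cst algV).
have -> : U (f * g) k - U f k * U g k = U (f * (g - cst (U g k))) k.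
  rewrite [U f k * _]mulrC -sm_scale// -sm_sub//; last 2 first.
  - exact: (fa_mul algV).
  - exact: fa_scale.
  congr (U _ k); apply/funext => x; rewrite !fctE /GRing.scale/=; ring.
have Vac := fa_abs algV Vc.
apply: le_trans (sm_abs k _) _; first exact: (fa_mul algV).
rewrite -sm_scale//; apply: (sm_mono sU) => //.
- by apply: (fa_abs algV) => //; exact: (fa_mul algV).
- exact: fa_scale.
- by move=> x; rewrite /absf !fctE normrM ler_wpM2r.
Qed.

Lemma spread_close f g : V f -> V g ->
  spread U f <= 2 * spread U g + 2 * mean (U (absf (f - g))).
Proof.
move=> Vf Vg; apply: le_trans (spread_center (U g) Vf) _.
rewrite -mulrDr ler_pM2l// -meanD; apply: mean_le => k.
have Vag := fa_absB (U g k) Vg; have Vfg := fa_abs algV (fa_sub Vf Vg).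
rewrite -sm_add//; apply: (sm_mono sU).
- exact: fa_absB.
- exact: fa_add.
- move=> x; rewrite /absf !fctE.
  rewrite (_ : f x - U g k = (g x - U g k) + (f x - g x)); last by ring.
  exact: ler_normD.
Qed.

End StateMaps.

(** * Asymptotic properties of families of state maps *)

Definition translate {R : realType} {G : groupType} {X : topologicalType}
    (a : cts_action G X) (s : G) (f : X -> R) : X -> R :=
  fun x => f (a s^-1%g x).

Section Asymptotics.
Context {R : realType} {G : groupType} {X : topologicalType}.
Variables (a : cts_action G X) (d : nat -> nat) (sigma : forall i, G -> 'S_(d i)).
Local Notation tr := (translate a).

Lemma translateM s t (f : X -> R) : tr s (tr t f) = tr (s * t)%g f.
Proof.
apply/funext => x; rewrite /translate -(Defs.actM a).
by have -> : ((s * t)^-1 = t^-1 * s^-1 :> G)%g by exact: invMg.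
Qed.

Lemma translate1 (f : X -> R) : tr 1%g f = f.
Proof. by apply/funext => x; rewrite /translate (_ : 1^-1 = 1 :> G)%g ?(Defs.act1 a)//; exact: invg1. Qed.

Definition translate_closed (V : set (X -> R)) := forall s f, V f -> V (tr s f).

Let two_ge0 : 0 <= 2 :> R. Proof. by []. Qed.

Section Families.
Context {Y : nat -> Type} (F : set_system {i & Y i}) {FF : Filter F}.
Let vZ {c h} := @vanishesZ R _ F FF c h.
Let vD {h g} := @vanishesD R _ F FF h g.
Let vle {h g} := @vanishes_le R _ F FF h g.
Context {V : set (X -> R)} (algV : function_algebra V) (trV : translate_closed V).

Section OneFamily.
Variable U : forall i, Y i -> (X -> R) -> 'I_(d i) -> R.
Hypothesis sU : \forall z \near F, state_map V (U (projT2 z)).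

(** Translates are included because equivariance, which would give them, is a
    separate condition. *)
Definition concentrated (f : X -> R) :=
  V f /\ forall s, vanishes F (fun z => spread (U (projT2 z)) (tr s f)).

Lemma concentrated_cst c : concentrated (cst c).
Proof.
split=> [|s]; first exact: (fa_cst algV).
apply: (@vle _ (fun=> 0)).
  by move=> e e0; apply: nearW => z; exact: ltW.
by apply: filterS sU => z sz; rewrite (spread_cst algV sz c).
Qed.

Lemma concentrated_lin c f g :
  concentrated f -> concentrated g -> concentrated (c *: f + g).
Proof.
move=> [Vf cf] [Vg cg]; split=> [|s]; first exact: (fa_lin algV).
apply: (vle (vD (vZ (normr_ge0 c) (cf s)) (cg s))).
apply: filterS sU => z sz.
by apply: (spread_lin algV sz); exact: trV.
Qed.

Lemma concentrated_mul f g :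
  concentrated f -> concentrated g -> concentrated (f * g).
Proof.
move=> [Vf cf] [Vg cg]; split=> [|s]; first exact: (fa_mul algV).
have [M fM] := fa_bnd algV Vf; have [N gN] := fa_bnd algV Vg.
have vM := vZ (normr_ge0 M) (cg s); have vN := vZ (normr_ge0 N) (cf s).
apply: (vle (vZ two_ge0 (vD vM vN))).
apply: filterS sU => z sz.
apply: (spread_mul algV sz (trV s Vf) (trV s Vg)).
- by move=> x; rewrite (le_trans (fM _))// ler_norm.
- by move=> x; rewrite (le_trans (gN _))// ler_norm.
Qed.

Lemma concentrated_act t f : concentrated f -> concentrated (tr t f).
Proof.
move=> [Vf cf]; split=> [|s]; first exact: trV.
by rewrite translateM; exact: cf.
Qed.

Lemma concentrated_lim f : V f ->
  (forall e, 0 < e -> exists2 g, concentrated g & forall s, \forall z \near F,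
    mean (U (projT2 z) (absf (tr s f - tr s g))) <= e) -> concentrated f.
Proof.
move=> Vf fapp; split=> // s; apply: vanishes_approx => e e0.
have [g [Vg cg] /(_ s) fg] := fapp (e / 2) ltac:(by rewrite divr_gt0).
exists (fun z => 2 * spread (U (projT2 z)) (tr s g)).
  exact: vZ.
apply: filterS2 sU fg => z sz fg.
apply: le_trans (spread_close algV sz (trV s Vf) (trV s Vg)) _.
by rewrite lerD2l mulrC -ler_pdivlMr.
Qed.

(** [U _ (tr s f)] should be [U _ f] moved by [sigma s]; comparing at
    [sigma s k] avoids the inverse permutation. *)
Definition defect i (y : Y i) s (f : X -> R) : R :=
  mean (fun k => `|U y (tr s f) (sigma i s k) - U y f k|).

Definition equivariant f := forall s, vanishes F (fun z => defect (projT2 z) s f).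

Lemma equivariant_cst c : equivariant (cst c).
Proof.
move=> s; apply: (@vle _ (fun=> 0)).
  by move=> e e0; apply: nearW => z; exact: ltW.
apply: filterS sU => z sz; rewrite /defect /mean big1 ?mulr0// => k _.
by rewrite (sm_cst algV sz c k) (_ : tr s (cst c) = cst c)// (sm_cst algV sz) subrr normr0.
Qed.

Lemma equivariant_lin c f g : V f -> V g ->
  equivariant f -> equivariant g -> equivariant (c *: f + g).
Proof.
move=> Vf Vg ef eg s.
apply: (vle (vD (vZ (normr_ge0 c) (ef s)) (eg s))).
apply: filterS sU => z sz; rewrite -meanZ -meanD; apply: mean_le => k.
have -> : tr s (c *: f + g) = c *: tr s f + tr s g by [].
rewrite !(sm_lin sz)//; try exact: trV.
rewrite -normrM; apply: le_trans (ler_normD _ _).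
by rewrite le_eqVlt; apply/orP; left; apply/eqP; congr (`|_|); ring.
Qed.

Lemma concentrated_spread f : concentrated f ->
  vanishes F (fun z => spread (U (projT2 z)) f).
Proof. by move=> [_ /(_ 1%g)]; rewrite translate1. Qed.

Lemma mul_defect f g M : V f -> concentrated g -> (forall x, `|f x| <= M) ->
  vanishes F (fun z => mean (fun k => `|U (projT2 z) (f * g) k -
    U (projT2 z) f k * U (projT2 z) g k|)).
Proof.
move=> Vf cg fM.
have fM' x : `|f x| <= `|M| by rewrite (le_trans (fM x))// ler_norm.
apply: (vle (vZ (normr_ge0 M) (concentrated_spread cg))).
by apply: filterS sU => z sz; apply: (sm_mul algV sz) => //; case: cg.
Qed.

(** Equivariance is multiplicative only where the states are: this is why
    [g] has to be concentrated. *)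
Lemma equivariant_mul f g : V f -> concentrated g ->
  equivariant f -> equivariant g -> equivariant (f * g).
Proof.
move=> Vf cg ef eg s; have [Vg _] := cg.
have [M0 fM0] := fa_bnd algV Vf; have [N0 gN0] := fa_bnd algV Vg.
pose M := `|M0|; pose N := `|N0|.
have fM x : `|f x| <= M by rewrite (le_trans (fM0 x))// ler_norm.
have gN x : `|g x| <= N by rewrite (le_trans (gN0 x))// ler_norm.
have v1 := mul_defect (trV s Vf) (concentrated_act s cg) (fun x => fM (a s^-1%g x)).
have v2 := mul_defect Vf cg fM.
have v3 := vZ (normr_ge0 M0) (eg s).
have v4 := vZ (normr_ge0 N0) (ef s).
apply: (vle (vD (vD v1 v2) (vD v3 v4))).
apply: filterS sU => z sz; set u := U (projT2 z).
rewrite -(mean_perm (sigma (projT1 z) s) (fun k => `|u (tr s f * tr s g) k - _|)).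
rewrite -!meanZ -!meanD; apply: mean_le => k; set k' := sigma _ s k.
have hf : `|u (tr s f) k'| <= M.
  by apply: (sm_bnd algV sz _ (trV s Vf)) => x; exact: fM.
have hg : `|u g k| <= N by exact: (sm_bnd algV sz _ Vg).
have -> : tr s (f * g) = tr s f * tr s g by [].
rewrite (_ : u (tr s f * tr s g) k' - u (f * g) k =
  ((u (tr s f * tr s g) k' - u (tr s f) k' * u (tr s g) k')
   - (u (f * g) k - u f k * u g k)) +
  (u (tr s f) k' * (u (tr s g) k' - u g k) + u g k * (u (tr s f) k' - u f k)));
  last by ring.
apply: (le_trans (ler_normD _ _)); apply: lerD.
  by rewrite (le_trans (ler_normD _ _))// normrN.
apply: (le_trans (ler_normD _ _)); rewrite !normrM.
by apply: lerD; apply: ler_wpM2r.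
Qed.

Hypothesis big : projT1 z @[z --> F] --> \oo.
Hypothesis dy : d i @[i --> \oo] --> \oo.
Hypothesis sigmaM : asymptotically_multiplicative R sigma.

Lemma cocycle_defect s t : vanishes F (fun z => mean (fun k =>
  (sigma (projT1 z) (s * t)%g k != sigma (projT1 z) s (sigma (projT1 z) t k))%:R : R)).
Proof.
move=> e e0; have /cvgrPdist_le /(_ _ e0) h := sigmaM s t.
have h2 : \forall i \near \oo, mean (fun k =>
    (sigma i (s * t)%g k != sigma i s (sigma i t k))%:R) <= e.
  have d0 : \forall i \near \oo, (0 < d i)%N.
    by have /(_ [set n | (0 < n)%N]) := dy; apply; exists 1%N.
  apply: filterS2 h d0 => i.
  set S := [pred k | _] => hS d0; apply: le_trans hS.
  apply: le_trans (ler_norm _); rewrite le_eqVlt; apply/orP; left; apply/eqP.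
  have -> : #|S|%:R / (d i)%:R = mean (fun k => (k \in S)%:R) :> R.
    rewrite mulrC -sum1_card natr_sum big_mkcond/=; congr (_ * _).
    by apply: eq_bigr => k _; case: ifP.
  rewrite -[X in _ = X - _](mean_cst 1 d0) /mean -mulrBr -sumrB; congr (_ * _).
  by apply: eq_bigr => k _; rewrite inE; case: eqP => _; rewrite ?subrr ?subr0.
exact: (big h2).
Qed.

Lemma equivariant_act t f : V f -> equivariant f -> equivariant (tr t f).
Proof.
move=> Vf ef s; have [M0 fM0] := fa_bnd algV Vf; pose M := `|M0|.
have fM x : `|f x| <= M by rewrite (le_trans (fM0 x))// ler_norm.
have vc := vZ (ler0n R 2) (vZ (normr_ge0 M0) (cocycle_defect s t)).
apply: (vle (vD (vD (ef (s * t)%g) (ef t)) vc)).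
apply: filterS sU => z sz; set u := U (projT2 z).
rewrite /defect -(mean_perm (sigma (projT1 z) t)) -!meanZ -!meanD.
apply: mean_le => k; rewrite translateM -/u.
set k1 := sigma _ s _; set k2 := sigma _ t k; set k3 := sigma _ (s * t)%g k.
have [->|k13] := eqVneq k3 k1.
  rewrite mulr0 mulr0 addr0 (_ : _ - _ = (u (tr (s * t)%g f) k1 - u f k) -
    (u (tr t f) k2 - u f k)); last by ring.
  by rewrite (le_trans (ler_normD _ _))// normrN.
have h g k' : V g -> (forall x, `|g x| <= M) -> `|u g k'| <= M by exact: (sm_bnd algV sz).
rewrite mulr1 mulr_natl mulr2n; apply: le_trans (ler_normD _ _) _.
rewrite normrN -[leLHS]add0r; apply: lerD; first by rewrite addr_ge0.
by apply: lerD; apply: h; try exact: trV; move=> x; exact: fM.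
Qed.

Lemma equivariant_lim f : V f ->
  (forall e, 0 < e -> exists2 g, V g /\ equivariant g & forall s, \forall z \near F,
    mean (U (projT2 z) (absf (tr s f - tr s g))) <= e) -> equivariant f.
Proof.
move=> Vf fapp s; apply: vanishes_approx => e e0.
have [g [Vg eg] fg] := fapp (e / 2) ltac:(by rewrite divr_gt0).
exists (fun z => defect (projT2 z) s g); first exact: eg.
have := fg 1%g; rewrite !translate1 => fg1.
apply: filterS3 sU (fg s) fg1 => z sz fgs fg1; rewrite [e]splitr.
set u := U (projT2 z).
apply: le_trans (_ : _ <= mean (fun k => `|u (tr s g) (sigma (projT1 z) s k) - u g k|)
  + (mean (fun k => `|u (tr s f) (sigma (projT1 z) s k) - u (tr s g) (sigma (projT1 z) s k)|)
  + mean (fun k => `|u f k - u g k|))) _.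
  rewrite -!meanD; apply: mean_le => k.
  set k' := sigma _ s k.
  rewrite -/u (_ : _ - _ = (u (tr s g) k' - u g k) +
    ((u (tr s f) k' - u (tr s g) k') - (u f k - u g k))); last by ring.
  rewrite (le_trans (ler_normD _ _))// lerD2l.
  by rewrite (le_trans (ler_normD _ _))// normrN.
rewrite lerD2l; apply: lerD.
  rewrite (mean_perm _ (fun k => `|u (tr s f) k - u (tr s g) k|)).
  by apply: le_trans fgs; apply: (mean_sm_sub algV sz); exact: trV.
by apply: le_trans fg1; exact: (mean_sm_sub algV sz).
Qed.

End OneFamily.

Section TwoFamilies.
Variables U U' : forall i, Y i -> (X -> R) -> 'I_(d i) -> R.
Hypothesis sU : \forall z \near F, state_map V (U (projT2 z)).
Hypothesis sU' : \forall z \near F, state_map V (U' (projT2 z)).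

Definition asymptotic f := forall s, vanishes F (fun z =>
  mean (fun k => `|U (projT2 z) (tr s f) k - U' (projT2 z) (tr s f) k|)).

Lemma asymptotic_cst c : asymptotic (cst c).
Proof.
move=> s; apply: (@vle _ (fun=> 0)).
  by move=> e e0; apply: nearW => z; exact: ltW.
apply: filterS2 sU sU' => z sz sz'; rewrite /mean big1 ?mulr0// => k _.
by rewrite (_ : tr s (cst c) = cst c)// (sm_cst algV sz) (sm_cst algV sz') subrr normr0.
Qed.

Lemma asymptotic_lin c f g : V f -> V g ->
  asymptotic f -> asymptotic g -> asymptotic (c *: f + g).
Proof.
move=> Vf Vg ef eg s.
apply: (vle (vD (vZ (normr_ge0 c) (ef s)) (eg s))).
apply: filterS2 sU sU' => z sz sz'; rewrite -meanZ -meanD; apply: mean_le => k.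
have -> : tr s (c *: f + g) = c *: tr s f + tr s g by [].
rewrite (sm_lin sz) ?(sm_lin sz')//; try exact: trV.
rewrite -normrM; apply: le_trans (ler_normD _ _).
by rewrite le_eqVlt; apply/orP; left; apply/eqP; congr (`|_|); ring.
Qed.

Lemma asymptotic_mul f g : V f -> concentrated U g -> concentrated U' g ->
  asymptotic f -> asymptotic g -> asymptotic (f * g).
Proof.
move=> Vf cg cg' ef eg s; have [Vg _] := cg.
have [M0 fM0] := fa_bnd algV Vf; have [N0 gN0] := fa_bnd algV Vg.
pose M := `|M0|; pose N := `|N0|.
have fM x : `|f x| <= M by rewrite (le_trans (fM0 x))// ler_norm.
have gN x : `|g x| <= N by rewrite (le_trans (gN0 x))// ler_norm.
have fMs x : `|tr s f x| <= M by exact: fM.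
have v1 := mul_defect sU (trV s Vf) (concentrated_act s cg) fMs.
have v2 := mul_defect sU' (trV s Vf) (concentrated_act s cg') fMs.
have v3 := vZ (normr_ge0 M0) (eg s).
have v4 := vZ (normr_ge0 N0) (ef s).
apply: (vle (vD (vD v1 v2) (vD v3 v4))).
apply: filterS2 sU sU' => z sz sz'; set u := U (projT2 z); set u' := U' (projT2 z).
rewrite -!meanZ -!meanD; apply: mean_le => k.
have hf : `|u (tr s f) k| <= M by exact: (sm_bnd algV sz _ (trV s Vf)).
have hg : `|u' (tr s g) k| <= N.
  by apply: (sm_bnd algV sz' _ (trV s Vg)) => x; exact: gN.
have -> : tr s (f * g) = tr s f * tr s g by [].
set p := tr s f; set q := tr s g.
rewrite (_ : u (p * q) k - u' (p * q) k =
  ((u (p * q) k - u p k * u q k) - (u' (p * q) k - u' p k * u' q k)) +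
  (u p k * (u q k - u' q k) + u' q k * (u p k - u' p k))); last by ring.
apply: (le_trans (ler_normD _ _)); apply: lerD.
  by rewrite (le_trans (ler_normD _ _))// normrN.
apply: (le_trans (ler_normD _ _)); rewrite !normrM.
by apply: lerD; apply: ler_wpM2r.
Qed.

Lemma asymptotic_act t f : asymptotic f -> asymptotic (tr t f).
Proof. by move=> ef s; rewrite translateM; exact: ef. Qed.

Lemma asymptotic_lim f : V f ->
  (forall e, 0 < e -> exists2 g, V g /\ asymptotic g & forall s, \forall z \near F,
    mean (U (projT2 z) (absf (tr s f - tr s g))) <= e /\
    mean (U' (projT2 z) (absf (tr s f - tr s g))) <= e) -> asymptotic f.
Proof.
move=> Vf fapp s; apply: vanishes_approx => e e0.
have [g [Vg eg] fg] := fapp (e / 2) ltac:(by rewrite divr_gt0).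
eexists; first exact: (eg s).
apply: filterS3 sU sU' (fg s) => z sz sz' [fg1 fg2]; rewrite [e]splitr.
have h1 := le_trans (mean_sm_sub algV sz (trV s Vf) (trV s Vg)) fg1.
have h2 := le_trans (mean_sm_sub algV sz' (trV s Vf) (trV s Vg)) fg2.
apply: le_trans (lerD (lexx _) (lerD h1 h2)).
rewrite -!meanD; apply: mean_le => k; set u := U _; set u' := U' _.
rewrite (_ : u (tr s f) k - u' (tr s f) k = (u (tr s g) k - u' (tr s g) k) +
  ((u (tr s f) k - u (tr s g) k) - (u' (tr s f) k - u' (tr s g) k)));
  last by ring.
rewrite (le_trans (ler_normD _ _))// lerD2l.
by rewrite (le_trans (ler_normD _ _))// normrN.
Qed.

(** Equivariance moves closeness at [f] to closeness at its translates. *)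
Lemma asymptotic_generator f : equivariant U f -> equivariant U' f ->
  vanishes F (fun z => mean (fun k => `|U (projT2 z) f k - U' (projT2 z) f k|)) ->
  asymptotic f.
Proof.
move=> ef ef' vf s.
apply: (vle (vD (vD (ef s) (ef' s)) vf)).
apply: nearW => z; set u := U _; set u' := U' _.
rewrite -(mean_perm (sigma (projT1 z) s) (fun k => `|u (tr s f) k - _|)) -!meanD.
apply: mean_le => k; set k' := sigma _ s k.
rewrite (_ : u (tr s f) k' - u' (tr s f) k' =
  ((u (tr s f) k' - u f k) - (u' (tr s f) k' - u' f k)) + (u f k - u' f k));
  last by ring.
rewrite (le_trans (ler_normD _ _))// lerD2r.
by rewrite (le_trans (ler_normD _ _))// normrN.
Qed.

End TwoFamilies.
End Families.
End Asymptotics.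

(** * Bounded measurable functions *)

Section BoundedMeasurable.
Context {R : realType} {disp : measure_display} {T : measurableType disp}.
Implicit Types f g : T -> R.

Definition bounded_measurable : set (T -> R) :=
  [set f : T -> R | measurable_fun setT f /\ exists M : R, forall x, `|f x| <= M].

Lemma bounded_measurable_algebra : function_algebra bounded_measurable.
Proof.
split.
- by move=> c; split; [exact: measurable_cst|exists `|c|].
- move=> c f g [mf [M fM]] [mg [N gN]]; split.
    by apply: measurable_funD => //; exact: measurable_funM.
  exists (`|c| * M + N) => x; rewrite !fctE (le_trans (ler_normD _ _))//.
  by rewrite lerD// normrM ler_wpM2l.
- move=> f g [mf [M fM]] [mg [N gN]]; split; first exact: measurable_funM.
  by exists (M * N) => x; rewrite !fctE normrM ler_pM.
- move=> f [mf [M fM]]; split; first exact: measurableT_comp.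
  by exists M => x; rewrite /absf normr_id.
- by move=> f [].
Qed.

Context (mu : probability T R).

Lemma bounded_measurable_integrable f : bounded_measurable f ->
  mu.-integrable setT (EFin \o f).
Proof.
move=> [mf [M fM]].
have muT : (mu setT < +oo)%E by rewrite probability_setT ltry.
apply: measurable_bounded_integrable => //.
by exists M; split => [|K MK x _]; rewrite ?num_real//= (le_trans (fM x))// ltW.
Qed.

Definition mean_mu f : R := \int[mu]_x f x.

Lemma mean_mu_cst c : mean_mu (cst c) = c.
Proof. rewrite /mean_mu (@Rintegral_cst _ _ _ mu)// -[RHS]mulr1; congr (_ * _).
by transitivity (fine (1%E : \bar R)) => //; congr fine; exact: probability_setT. Qed.

Lemma mean_mu_lin (c : R) f g : bounded_measurable f -> bounded_measurable g ->
  mean_mu (c *: f + g) = c * mean_mu f + mean_mu g.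
Proof.
move=> bf bg; have bcf := fa_scale bounded_measurable_algebra c bf.
rewrite /mean_mu (RintegralD _ (bounded_measurable_integrable bcf))//;
  last exact: bounded_measurable_integrable.
by rewrite -(RintegralZl _ measurableT (bounded_measurable_integrable bf)).
Qed.

Lemma mean_muD f g : bounded_measurable f -> bounded_measurable g ->
  mean_mu (f + g) = mean_mu f + mean_mu g.
Proof. by move=> bf bg; rewrite -[f]scale1r mean_mu_lin// mul1r scale1r. Qed.

Lemma mean_muZ (c : R) f : bounded_measurable f ->
  mean_mu (c *: f) = c * mean_mu f.
Proof.
move=> bf; rewrite -[X in mean_mu X]addr0 mean_mu_lin//.
  by rewrite [X in _ + X](mean_mu_cst 0) addr0.
exact: (fa_cst bounded_measurable_algebra 0).
Qed.

Lemma mean_mu_le f g : bounded_measurable f -> bounded_measurable g ->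
  (forall x, f x <= g x) -> mean_mu f <= mean_mu g.
Proof.
by move=> bf bg fg; apply: le_Rintegral => //; exact: bounded_measurable_integrable.
Qed.

Lemma mean_mu_ge0 f : (forall x, 0 <= f x) -> 0 <= mean_mu f.
Proof. by move=> f0; exact: Rintegral_ge0. Qed.

Lemma mean_mu_abs f : bounded_measurable f -> `|mean_mu f| <= mean_mu (absf f).
Proof. by move=> bf; apply: le_normr_Rintegral => //; exact: bounded_measurable_integrable. Qed.

Lemma eq_mean_mu_ae f g : bounded_measurable f -> bounded_measurable g ->
  (\forall x \ae mu, f x = g x) -> mean_mu f = mean_mu g.
Proof.
move=> [mf _] [mg _] fg; congr fine; apply: ae_eq_integral => //.
- exact/measurable_EFinP.
- exact/measurable_EFinP.
- by apply: filterS fg => x -> .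
Qed.

Lemma dominated_Rintegral (f_ : nat -> T -> R) f (B : T -> \bar R) :
  (forall n, measurable_fun setT (f_ n)) -> measurable_fun setT f ->
  (\forall x \ae mu, f_ n x @[n --> \oo] --> f x) ->
  mu.-integrable setT B -> (\forall x \ae mu, forall n, (`|f_ n x|%:E <= B x)%E) ->
  mu.-integrable setT (EFin \o f) /\
  (\int[mu]_x f_ n x) @[n --> \oo] --> \int[mu]_x f x.
Proof.
move=> mf_ mf ff iB fB.
have [| | |//| |fi _ cv] := @dominated_convergence _ _ _ mu setT measurableT
  (fun n x => (f_ n x)%:E) (fun x => (f x)%:E) B.
- by move=> n; exact/measurable_EFinP.
- exact/measurable_EFinP.
- by apply: filterS ff => x fx _; apply: cvg_EFin => //; exact: nearW.
- by apply: filterS fB => x fx n _; exact: fx.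
split => //; apply: fine_cvg; rewrite fineK//.
exact: integrable_fin_num.
Qed.

(** The orthogonal projection argument: a minimizing sequence [g_ n] of the
    squared distance from [f] to [P] is Cauchy; its limit [g] exists almost
    everywhere and [f - g] is orthogonal to [P].  Testing the weak
    approximability of [f] against the single integrable function [f - g]
    shows that [f] is orthogonal to [f - g] as well, and so the distance is
    zero. *)
Lemma weak_closure_subspace (P : set (T -> R)) f :
  P `<=` bounded_measurable -> P (cst 0) ->
  (forall (c : R) g h, P g -> P h -> P (c *: g + h)) ->
  bounded_measurable f ->
  (forall r : T -> R, mu.-integrable setT (EFin \o r) -> forall e : R, 0 < e ->
    exists2 h, P h & `|\int[mu]_x ((f x - h x) * r x)| < e) ->
  forall e : R, 0 < e -> exists2 h, P h & mean_mu (absf (f - h)) <= e.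
Proof.
move=> Pb P0 Plin bf fweak.
have A := bounded_measurable_algebra; have bM := fa_mul A; have bB := @fa_sub _ _ _ A.
pose ip g h := mean_mu (g * h).
have ipC g h : ip g h = ip h g by rewrite /ip mulrC.
have ipq (c : R) g h : bounded_measurable g -> bounded_measurable h ->
    ip (c *: g + h) (c *: g + h) = c ^+ 2 * ip g g + (2 * c * ip g h + ip h h).
  move=> bg bh; rewrite /ip -!mean_mu_lin; try exact: bM.
    by congr mean_mu; apply/funext => x; rewrite !fctE /GRing.scale/=; ring.
  by apply: (fa_lin A); exact: bM.
have ipZ (c e : R) g h : bounded_measurable g -> bounded_measurable h ->
    ip (c *: g) (e *: h) = c * e * ip g h.
  move=> bg bh; rewrite /ip -mean_muZ; last exact: bM.
  by congr mean_mu; apply/funext => x; rewrite !fctE /GRing.scale/=; ring.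
have ip0 g : 0 <= ip g g by apply: mean_mu_ge0 => x; rewrite !fctE -expr2 sqr_ge0.
pose E g := ip (f - g) (f - g).
pose S := [set E g | g in P].
have infS : has_inf S.
  by split; [exists (E (cst 0)), (cst 0)|exists 0 => _ [g _ <-]; exact: ip0].
pose D := inf S.
have DE g : P g -> D <= E g.
  by move=> Pg; apply: ge_inf; [case: infS|exists g].
pose eta n : R := 8^-1 ^+ n.
have eta0 n : 0 < eta n by rewrite exprn_gt0// invr_gt0.
have /choice[g_ gP] : forall n, exists g, P g /\ E g < D + eta n.
  move=> n; have [_ [g Pg <-] h] := inf_adherent (eta0 n) infS.
  by exists g.
have Pg n : P (g_ n) by case: (gP n).
have bg n : bounded_measurable (g_ n) by apply: Pb.
have bfg n : bounded_measurable (f - g_ n) by apply: bB.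
have Eg n : E (g_ n) <= D + eta n by case: (gP n) => _ /ltW.
have D0 : 0 <= D by apply: lb_le_inf; [case: infS|move=> _ [g _ <-]; exact: ip0].
(* Polarization around the midpoint of two almost minimizers. *)
have cross n m : D - eta n - eta m <= ip (f - g_ n) (f - g_ m).
  have Pm : P (2^-1 *: g_ n + 2^-1 *: g_ m).
    by apply: (Plin) => //; rewrite -[_ *: _]addr0; exact: Plin.
  have := DE _ Pm; rewrite /E (_ : f - _ = 2^-1 *: (f - g_ n) + 2^-1 *: (f - g_ m)); last first.
    by apply/funext => x; rewrite !fctE /GRing.scale/=; field.
  have b2 k : bounded_measurable (2^-1 *: (f - g_ k)) by exact: (fa_scale A).
  rewrite ipq// ipZ// -[X in ip X (_ *: _)]scale1r ipZ//.
  have := Eg n; have := Eg m; have := eta0 n; have := eta0 m; rewrite /E; lra.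
have diff n : mean_mu ((g_ n.+1 - g_ n) * (g_ n.+1 - g_ n)) <= 6 * eta n.
  have -> : mean_mu ((g_ n.+1 - g_ n) * (g_ n.+1 - g_ n)) =
      E (g_ n) + E (g_ n.+1) - 2 * ip (f - g_ n) (f - g_ n.+1).
    have -> : (g_ n.+1 - g_ n) = (-1) *: (f - g_ n.+1) + (f - g_ n).
      by apply/funext => x; rewrite !fctE /GRing.scale/=; ring.
    by rewrite -/(ip _ _) ipq// /E [ip (f - g_ n) (f - g_ n.+1)]ipC; ring.
  have := Eg n; have := Eg n.+1; have := cross n n.+1.
  have : eta n.+1 <= eta n by rewrite /eta exprS ler_piMl ?exprn_ge0 ?invr_ge0// invf_le1// ler1n.
  lra.
have orth h : P h -> ip (f - g_ n) h @[n --> \oo] --> 0.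
  move=> Ph; have bh := Pb _ Ph; pose K := ip h h.
  pose t n : R := 2^-1 ^+ n.
  have tt : t n @[n --> \oo] --> 0 by apply: cvg_expr; rewrite ger0_norm ?invr_ge0// invf_lt1// ltr1n.
  have bnd n : `|ip (f - g_ n) h| <= t n * (1 + K).
    have t0 : 0 < t n by rewrite exprn_gt0// invr_gt0.
    have key (c : R) : 0 <= eta n - 2 * c * ip (f - g_ n) h + c ^+ 2 * K.
      have := DE _ (Plin c _ _ Ph (Pg n)); rewrite /E.
      rewrite (_ : f - (c *: h + g_ n) = (- c) *: h + (f - g_ n)); last first.
        by apply/funext => x; rewrite !fctE /GRing.scale/=; ring.
      rewrite ipq// -/K [ip h (f - _)]ipC.
      by have := Eg n; rewrite /E; lra.
    have et : eta n <= t n * t n.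
      rewrite /eta /t -exprMn; apply: lerXn2r; rewrite ?nnegrE; lra.
    have h1 := key (t n); have h2 := key (- t n).
    have h3 : 2 * (t n * `|ip (f - g_ n) h|) <= t n * (t n * (1 + K)).
      by case: (ger0P (ip (f - g_ n) h)) => _; move: h1 h2 et; rewrite sqrrN expr2; lra.
    have h4 : 0 <= t n * `|ip (f - g_ n) h| by rewrite mulr_ge0// ltW.
    rewrite -(ler_pM2l t0); lra.
  apply/norm_cvg0P; apply: (@squeeze_cvgr _ _ _ _ (cst 0) (fun n => t n * (1 + K))).
  - by apply: nearW => n; rewrite normr_ge0 bnd.
  - exact: cvg_cst.
  - by rewrite -[0](mul0r (1 + K)); apply: cvgMl.
pose d_ n := g_ n.+1 - g_ n.
pose SS x : \bar R := (\sum_(0 <= n <oo) (2 ^+ n * (d_ n x * d_ n x))%:E)%E.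
have sq0 n x : (0 <= (2 ^+ n * (d_ n x * d_ n x))%:E)%E.
  by rewrite lee_fin mulr_ge0 ?exprn_ge0// -expr2 sqr_ge0.
have bd n : bounded_measurable (d_ n) by apply: bB.
have msq n : measurable_fun setT (fun x => (2 ^+ n * (d_ n x * d_ n x))%:E).
  apply/measurable_EFinP; have [md _] := bd n.
  by apply: measurable_funM => //; exact: measurable_funM.
have iSS : mu.-integrable setT SS.
  apply/integrableP; split.
    by apply: ge0_emeasurable_sum => // n x _.
  under eq_integral do rewrite gee0_abs ?nneseries_ge0//.
  rewrite integral_nneseries//.
  apply: le_lt_trans (_ : \sum_(0 <= n <oo) (6 * (4^-1 ^+ n))%:E < +oo)%E.
    apply: lee_nneseries => [n _ _|n _]; first by apply: integral_ge0.
    have -> : (\int[mu]_x (2 ^+ n * (d_ n x * d_ n x))%:E =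
        (2 ^+ n * mean_mu (d_ n * d_ n))%:E)%E.
      rewrite -mean_muZ; last exact: bM.
      rewrite /mean_mu /Rintegral fineK//; apply: integrable_fin_num => //.
      by apply: bounded_measurable_integrable; apply: (fa_scale A); exact: bM.
    rewrite lee_fin (le_trans (ler_wpM2l _ (diff n)))// ?exprn_ge0//.
    rewrite mulrCA ler_wpM2l// /eta -exprMn lerXn2r// ?nnegrE; lra.
  have geo : series (geometric 6 4^-1) @ \oo --> (6 * (1 - 4^-1)^-1 : R).
    by apply: cvg_geometric_series; rewrite ger0_norm; lra.
  rewrite (@cvg_lim _ _ _ _ _ _ (6 * (1 - 4^-1)^-1)%:E) ?ltry//.
  under eq_fun do rewrite sumEFin.
  apply: cvg_EFin; first exact: nearW.
  exact: geo.
have SSfin : \forall x \ae mu, SS x \is a fin_num.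
  by have := integrable_ae measurableT iSS; apply: filterS => x; apply.
have [[_ [K0 fK0]] _] := (bfg 0%N, I).
have sum_d x n : SS x \is a fin_num ->
    \sum_(0 <= k < n) `|d_ k x| <= 1 + fine (SS x).
  move=> fS; apply: (@le_trans _ _ (\sum_(0 <= k < n) (2^-1 * 2^-1 ^+ k) +
      \sum_(0 <= k < n) (2 ^+ k * (d_ k x * d_ k x)))).
    rewrite -big_split/=; apply: ler_sum => k _.
    have p0 : 0 < 2 ^+ k :> R by rewrite exprn_gt0.
    rewrite exprVn; set p := 2 ^+ k; set u := `|_|; set q := p^-1.
    have pq : p * q = 1 by rewrite mulfV// gt_eqF.
    have -> : d_ k x * d_ k x = u * u by rewrite -!expr2 /u real_normK// num_real.
    have q0 : 0 <= q by rewrite invr_ge0 ltW.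
    have : 0 <= p * (u - q / 2) ^+ 2 by rewrite mulr_ge0 ?sqr_ge0// ltW.
    have -> : p * (u - q / 2) ^+ 2 = p * (u * u) - u * (p * q) + (p * q) * q / 4.
      by field.
    rewrite pq; lra.
  apply: lerD.
    have -> : \sum_(0 <= k < n) (2^-1 * 2^-1 ^+ k) = 1 - 2^-1 ^+ n :> R.
      elim: n => [|n IH]; first by rewrite big_geq// expr0 subrr.
      by rewrite big_nat_recr//= IH exprS; field.
    by rewrite gerBl exprn_ge0// invr_ge0.
  rewrite -lee_fin fineK// -sumEFin; apply: nneseries_lim_ge => k _ _.
  exact: sq0.
have tele x n : \sum_(0 <= k < n) d_ k x = g_ n x - g_ 0%N x.
  by rewrite telescope_sumr.
pose B x : \bar R := ((K0 + 1)%:E + SS x)%E.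
have iB : mu.-integrable setT B.
  apply: integrableD => //.
  exact: (bounded_measurable_integrable (fa_cst A (K0 + 1))).
have domB x n : SS x \is a fin_num -> (`|(f - g_ n) x|%:E <= B x)%E.
  move=> fS; rewrite /B -(fineK fS) -EFinD lee_fin -addrA.
  have -> : (f - g_ n) x = (f - g_ 0%N) x - \sum_(0 <= k < n) d_ k x.
    by rewrite tele !fctE; ring.
  rewrite (le_trans (ler_normB _ _))// lerD//.
  by rewrite (le_trans (ler_norm_sum _ _ _))// sum_d.
have cvg_g x : SS x \is a fin_num -> cvgn (fun n => g_ n x).
  move=> fS; have cd : cvgn (series (fun k => d_ k x)).
    apply: normed_cvg; apply: nondecreasing_is_cvgn.
      by apply: nondecreasing_series => *; exact: normr_ge0.
    by exists (1 + fine (SS x)) => _ [n _ <-]; exact: sum_d.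
  have -> : (fun n => g_ n x) = (fun n => g_ 0%N x + series (fun k => d_ k x) n).
    by apply/funext => n; rewrite /series/= tele addrC subrK.
  by apply: is_cvgD => //; exact: is_cvg_cst.
pose g x := fine (limn_esup (fun n => (g_ n x)%:E)).
have gE x : SS x \is a fin_num -> g_ n x @[n --> \oo] --> g x.
  move=> /cvg_g cg.
  have ce : (g_ n x)%:E @[n --> \oo] --> (limn (fun n => g_ n x))%:E.
    by apply: cvg_EFin; [exact: nearW|exact: cg].
  by rewrite /g (cvg_limn_einf_sup ce).2 /=; exact: cg.
have mg : measurable_fun setT g.
  apply: measurableT_comp; first exact: fine_measurable.
  apply: measurable_fun_limn_esup => n; apply/measurable_EFinP.
  by have [] := bg n.
pose r := f - g.
have mr : measurable_fun setT r by apply: measurable_funB => //; case: bf.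
have cvr x : SS x \is a fin_num -> (f - g_ n) x @[n --> \oo] --> r x.
  by move=> /gE h; apply: cvgB => //; exact: cvg_cst.
(* Dominated convergence against a bounded factor. *)
have dom h : bounded_measurable h ->
    mu.-integrable setT (EFin \o (r * h)) /\
    ip (f - g_ n) h @[n --> \oo] --> \int[mu]_x (r * h) x.
  move=> bh; have [mh [M hM]] := bh.
  apply: (@dominated_Rintegral _ _ (fun x => (`|M|%:E * B x)%E)).
  - by move=> n; have [] := bM _ _ (bfg n) bh.
  - exact: measurable_funM.
  - apply: filterS SSfin => x /cvr h'; apply: cvgM => //; exact: cvg_cst.
  - exact: integrableZl.
  - apply: filterS SSfin => x fS n.
    rewrite !fctE normrM EFinM muleC; apply: lee_pmul.
    + by rewrite lee_fin.
    + by rewrite lee_fin.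
    + by rewrite lee_fin (le_trans (hM x))// ler_norm.
    + exact: domB.
have ir : mu.-integrable setT (EFin \o r).
  have [+ _] := dom _ (fa_cst A 1).
  by rewrite (_ : r * cst 1 = r)//; apply/funext => x; rewrite !fctE mulr1.
have rP h : P h -> \int[mu]_x (r * h) x = 0.
  move=> Ph; have [_ c1] := dom _ (Pb _ Ph).
  exact: (cvg_unique _ c1 (orth h Ph)).
have rf : \int[mu]_x (r * f) x = 0.
  apply/eqP; rewrite -normr_le0; apply/ler_addgt0Pr => e e0; rewrite add0r.
  have [h Ph hh] := fweak r ir e e0; apply/ltW; apply: le_lt_trans hh.
  have [if_ _] := dom _ bf; have [ih _] := dom _ (Pb _ Ph).
  rewrite le_eqVlt; apply/orP; left; apply/eqP; congr (`|_|).
  rewrite -[LHS]subr0 -(rP h Ph) -RintegralB//.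
  by apply: eq_Rintegral => x _; rewrite !fctE; ring.
have rg n : \int[mu]_x (r * (f - g_ n)) x = 0.
  have [if_ _] := dom _ bf; have [ih _] := dom _ (bg n).
  rewrite -[RHS](subr0 0) -{1}rf -(rP _ (Pg n)) -RintegralB//.
  by apply: eq_Rintegral => x _; rewrite !fctE; ring.
have Dle n : D <= eta n.
  have [_ cn] := dom _ (bfg n); rewrite rg in cn.
  have ce : eta m @[m --> \oo] --> 0.
    by apply: cvg_expr; rewrite ger0_norm ?invr_ge0// invf_lt1// ltr1n.
  have c2 : (ip (f - g_ m) (f - g_ n) + eta m) @[m --> \oo] --> 0.
    by rewrite -[X in _ --> X](addr0 0); apply: cvgD.
  rewrite -subr_le0; apply: (cvgr_to_ge c2).
  by apply: nearW => m; have := cross m n; lra.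
have ce : eta m @[m --> \oo] --> 0.
  by apply: cvg_expr; rewrite ger0_norm ?invr_ge0// invf_lt1// ltr1n.
have D_le0 : D <= 0 by apply: (cvgr_to_ge ce); exact: nearW.
move=> e e0.
have /cvgr_le /(_ (e ^+ 2)) := ce.
move=> /(_ (exprn_gt0 2 e0)) [n _ /(_ n (leqnn n)) /= etae].
exists (g_ n) => //.
have h1 : E (g_ n) <= e ^+ 2 by apply: (le_trans (Eg n)); rewrite -[leRHS]add0r lerD.
have bq := bM _ _ (bfg n) (bfg n).
have -> : e = 2^-1 * e + (2^-1 * e^-1) * e ^+ 2 by field; rewrite gt_eqF.
apply: (@le_trans _ _ (2^-1 * e + 2^-1 * e^-1 * E (g_ n))); last first.
  by rewrite lerD2l ler_wpM2l// mulr_ge0 ?invr_ge0// ltW.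
rewrite /E /ip -[X in _ <= X + _](mean_mu_cst (2^-1 * e)) -mean_muZ// -mean_muD//; last 2 first.
- exact: (fa_cst A).
- exact: (fa_scale A).
apply: mean_mu_le => //.
- exact: (fa_abs A).
- by apply: (fa_add A); [exact: (fa_cst A)|exact: (fa_scale A)].
move=> x; rewrite /absf !fctE /GRing.scale/= -expr2 -[X in X ^+ 2]/(f x - g_ n x).
rewrite -[(f x - g_ n x) ^+ 2]real_normK ?num_real//; set u := `|_|.
have : 0 <= 2^-1 * e^-1 * (u - e) ^+ 2.
  by rewrite mulr_ge0 ?sqr_ge0// mulr_ge0 ?invr_ge0// ltW.
have -> : 2^-1 * e^-1 * (u - e) ^+ 2 = 2^-1 * e^-1 * u ^+ 2 - u + 2^-1 * e.
  by field; rewrite gt_eqF.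
lra.
Qed.

End BoundedMeasurable.

(** * Real and complex continuous functions *)

Section ComplexContinuity.
Context {R : realType}.
Local Notation C := R[i].
Local Notation Re := complex.Re.
Local Notation Im := complex.Im.

Lemma ReD (z w : C) : Re (z + w) = Re z + Re w. Proof. by case: z; case: w. Qed.
Lemma ImD (z w : C) : Im (z + w) = Im z + Im w. Proof. by case: z; case: w. Qed.
Lemma ReB (z w : C) : Re (z - w) = Re z - Re w. Proof. by case: z; case: w. Qed.
Lemma ImB (z w : C) : Im (z - w) = Im z - Im w. Proof. by case: z; case: w. Qed.
Lemma ReM (z w : C) : Re (z * w) = Re z * Re w - Im z * Im w.
Proof. by case: z; case: w. Qed.
Lemma ImM (z w : C) : Im (z * w) = Re z * Im w + Im z * Re w.
Proof. by case: z; case: w. Qed.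
Lemma ReJ (z : C) : Re (z^*)%C = Re z. Proof. by case: z. Qed.
Lemma ImJ (z : C) : Im (z^*)%C = - Im z. Proof. by case: z. Qed.
Lemma complex_eq (z w : C) : Re z = Re w -> Im z = Im w -> z = w.
Proof. by case: z; case: w => /= ? ? ? ? -> ->. Qed.

Lemma normc_complex (r : R) : normc r%:C%C = `|r|.
Proof. by rewrite /normc/= expr0n/= addr0 sqrtr_sqr. Qed.

Lemma abs_Re (z : C) : `|Re z| <= normc z.
Proof.
case: z => x y /=; rewrite -sqrtr_sqr ler_wsqrtr// lerDl; exact: sqr_ge0.
Qed.

Lemma abs_Im (z : C) : `|Im z| <= normc z.
Proof.
case: z => x y /=; rewrite -sqrtr_sqr ler_wsqrtr// lerDr; exact: sqr_ge0.
Qed.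

Lemma normc_le (z : C) : normc z <= `|Re z| + `|Im z|.
Proof.
rewrite -[z in leLHS](_ : (Re z)%:C%C + (complex.Complex 0 (Im z)) = z); last first.
  by apply: complex_eq; rewrite ?ReD ?ImD/= ?addr0 ?add0r.
rewrite (le_trans (le_normcD _ _))// normc_complex lerD2l.
by rewrite /normc/= expr0n/= add0r sqrtr_sqr.
Qed.

Context {X : topologicalType}.

Lemma continuous_complexP (f : X -> C) : continuous f <->
  continuous (fun x => Re (f x)) /\ continuous (fun x => Im (f x)).
Proof.
have normE (z : C) : `|z| = (normc z)%:C%C by rewrite normc_def; case: z.
split=> [cf|[cr ci] x].
  have H (h : C -> R) : (forall z w, `|h z - h w| <= normc (z - w)) ->
      continuous (fun x => h (f x)).
    move=> hl x; apply/cvgrPdist_le => /= e e0.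
    have /cvgrPdist_le /(_ (e%:C)%C) := cf x.
    rewrite ltcR => /(_ e0); apply: filterS => y.
    by rewrite normE lecR; exact: le_trans.
  split; apply: H => z w; first by rewrite -ReB abs_Re.
  by rewrite -ImB abs_Im.
apply/cvgrPdist_le => e e0.
have [r0 er] : 0 < Re e /\ e = (Re e)%:C%C.
  move: e0; rewrite ltcE /= => /andP[/eqP h ->]; split => //.
  by apply: complex_eq.
have e2 : 0 < Re e / 2 by rewrite divr_gt0.
have /cvgrPdist_le /(_ _ e2) h1 := cr x; have /cvgrPdist_le /(_ _ e2) h2 := ci x.
apply: filterS2 h1 h2 => y h1 h2; rewrite er normE lecR.
by rewrite (le_trans (normc_le _))// ReB ImB [leRHS]splitr lerD.
Qed.

Lemma complex_continuous (f : X -> R) : continuous f ->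
  continuous (fun x => (f x)%:C%C).
Proof.
by move=> cf; apply/continuous_complexP; split => //= x; exact: cvg_cst.
Qed.

(** Total on all functions, with value 0 at the discontinuous ones. *)
Definition cts_of (f : X -> R) : continuousType X C :=
  insubd (0 : continuousType X C) (fun x => (f x)%:C%C).

Lemma cts_ofE (f : X -> R) : continuous f ->
  forall x, cts_of f x = (f x)%:C%C.
Proof.
move=> cf x; have h : (fun x => (f x)%:C%C) \in @cts_pred R X.
  by apply/cts_predP; exact: complex_continuous.
by have := insubdK (0 : continuousType X C) h => /(congr1 (fun g => g x)).
Qed.

Lemma cts_eq (f g : continuousType X C) : (forall x, f x = g x) -> f = g.
Proof. by move=> fg; apply: val_inj; apply/funext => x; exact: fg. Qed.

Lemma Re_cts (f : continuousType X C) : continuous (fun x => Re (f x)).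
Proof. by have /continuous_complexP[] := @cts_fun _ _ f. Qed.

Lemma Im_cts (f : continuousType X C) : continuous (fun x => Im (f x)).
Proof. by have /continuous_complexP[] := @cts_fun _ _ f. Qed.

Definition cts_real : set (X -> R) := [set f | continuous f].

Lemma cts_real_algebra : compact [set: X] -> function_algebra cts_real.
Proof.
move=> cX; split.
- by move=> c x; exact: cvg_cst.
- by move=> c f g cf cg x; apply: cvgD; [apply: cvgMr; exact: cf|exact: cg].
- by move=> f g cf cg x; apply: cvgM; [exact: cf|exact: cg].
- by move=> f cf x; apply: cvg_norm; exact: cf.
- move=> f cf; have /compact_bounded[M [_ fM]] : compact (f @` setT).
    by apply: continuous_compact => //; exact: continuous_subspaceT.
  exists (M + 1) => x; apply: (fM (M + 1)); first by rewrite ltrDl.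
  by exists x.
Qed.

Context {G : groupType} (a : cts_action G X).

Lemma cts_real_translate : translate_closed a cts_real.
Proof.
move=> s f cf x; apply: (@continuous_comp _ _ _ (a s^-1%g) f).
  exact: act_continuous.
exact: cf.
Qed.

(** A property of real functions that survives the algebra operations and
    uniform limits defines a C*-subalgebra: the functions whose real and
    imaginary parts have it.  Generation by [p] is therefore an induction
    principle. *)
Lemma generating_cts_ind (p : nat -> continuousType X C) (P : set (X -> R)) :
  dyn_generating_cts a p -> unit_ball_cts p ->
  P `<=` cts_real -> (forall c, P (cst c)) ->
  (forall (c : R) f g, P f -> P g -> P (c *: f + g)) ->
  (forall f g, P f -> P g -> P (f * g)) ->
  (forall s f, P f -> P (translate a s f)) ->
  (forall f, cts_real f -> (forall e, 0 < e -> exists2 g, P g &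
    forall x, `|f x - g x| <= e) -> P f) ->
  (forall n, P (fun x => Re (p n x))) -> cts_real `<=` P.
Proof.
move=> gen ball Pc Pcst Plin Pmul Ptr Plim Pp f cf.
pose A : set (continuousType X C) :=
  [set g | P (fun x => Re (g x)) /\ P (fun x => Im (g x))].
have PD g h : P g -> P h -> P (fun x => g x + h x).
  by move=> Pg Ph; have := Plin 1 _ _ Pg Ph; rewrite scale1r.
have PZ (c : R) g : P g -> P (fun x => c * g x).
  by move=> Pg; have := Plin c _ _ Pg (Pcst 0); rewrite [_ + cst 0]addr0.
have PN g : P g -> P (fun x => - g x).
  move=> Pg; have := PZ (-1) _ Pg; congr P; apply/funext => x; exact: mulN1r.
have AT : A = setT.
  apply: (gen A).
  - split.
    + by split; [exact: (Pcst 1)|exact: (Pcst 0)].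
    + move=> c g h [Pgr Pgi] [Phr Phi]; split.
        rewrite (_ : (fun x => _) = fun x => (Re c * Re (g x) + - (Im c * Im (g x))) + Re (h x)).
          by apply/(PD _ _ _ Phr)/(PD _ _ (PZ _ _ Pgr))/PN/PZ.
        by apply/funext => x; rewrite ReD ReM.
      rewrite (_ : (fun x => _) = fun x => (Re c * Im (g x) + Im c * Re (g x)) + Im (h x)).
        by apply/(PD _ _ _ Phi)/(PD _ _ (PZ _ _ Pgi))/PZ.
      by apply/funext => x; rewrite ImD ImM.
    + move=> g h [Pgr Pgi] [Phr Phi]; split.
        rewrite (_ : (fun x => _) = fun x => (Re (g x) * Re (h x) + - (Im (g x) * Im (h x)))).
          by apply: PD; [exact: Pmul|apply: PN; exact: Pmul].
        by apply/funext => x; rewrite ReM.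
      rewrite (_ : (fun x => _) = fun x => (Re (g x) * Im (h x) + Im (g x) * Re (h x))).
        by apply: PD; exact: Pmul.
      by apply/funext => x; rewrite ImM.
    + move=> g h [Pgr Pgi] hg; split.
        by rewrite (_ : (fun x => _) = fun x => Re (g x))//; apply/funext => x; rewrite hg ReJ.
      rewrite (_ : (fun x => _) = fun x => - Im (g x)); first exact: PN.
      by apply/funext => x; rewrite hg ImJ.
    + move=> g gapp; split; (apply: Plim; first by (exact: Re_cts || exact: Im_cts)) => e e0;
        have [h [Pr Pi] gh] := gapp e e0.
        eexists; first exact: Pr.
        by move=> x; rewrite -ReB (le_trans (abs_Re _))// ltW.
      eexists; first exact: Pi.
      by move=> x; rewrite -ImB (le_trans (abs_Im _))// ltW.
  - by move=> s g [Pr Pi]; split; [exact: (Ptr s _ Pr)|exact: (Ptr s _ Pi)].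
  - move=> n; split; first exact: Pp.
    rewrite (_ : (fun x => _) = cst 0); first exact: Pcst.
    by apply/funext => x; have [/RIm_real h _] := ball n x; case: h.
have [+ _] : A (cts_of f) by rewrite AT.
by congr P; apply/funext => x; rewrite cts_ofE.
Qed.

End ComplexContinuity.

(** * Essentially bounded functions and unital positive maps *)

Section LinftyReal.
Context {R : realType} {disp : measure_display} {T : measurableType disp}.
Context (mu : probability T R).
Local Notation C := R[i].
Local Notation Re := complex.Re.
Local Notation Im := complex.Im.
Local Notation LX := (Linf mu).
Local Notation bm := (@bounded_measurable R disp T).

Definition Linf_of (f : T -> R) : LX := insubd (0 : LX) (fun x => (f x)%:C%C).

Lemma Linf_of_pred (f : T -> R) : bm f -> (fun x => (f x)%:C%C) \in Linf_pred mu.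
Proof.
move=> [mf [M fM]]; apply/Linf_predP; split => //.
by exists M; apply: nearW => x; rewrite normc_complex.
Qed.

Lemma Linf_ofE (f : T -> R) : bm f -> forall x, Linf_of f x = (f x)%:C%C.
Proof.
move=> /Linf_of_pred h x.
by have := insubdK (0 : LX) h => /(congr1 (fun g => g x)).
Qed.

Lemma Linf_linE (c : C) (f g : LX) x : Linf_fun (c *: f + g) x = c * f x + g x.
Proof. by []. Qed.

Lemma Linf_subE (f g : LX) x : Linf_fun (f - g) x = f x - g x.
Proof. by []. Qed.

Lemma Linf_mulE (f g : LX) x : Linf_fun (f * g) x = f x * g x.
Proof. by []. Qed.

Lemma Linf_eq (f g : LX) : (forall x, f x = g x) -> f = g.
Proof. by move=> fg; apply: val_inj; apply/funext => x; exact: fg. Qed.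

Lemma Linf_of1 : Linf_of (cst 1) = 1.
Proof.
apply: Linf_eq => x; rewrite Linf_ofE//; exact: (fa_cst bounded_measurable_algebra).
Qed.

Lemma Linf_of_lin (c : R) f g : bm f -> bm g ->
  Linf_of (c *: f + g) = (c%:C)%C *: Linf_of f + Linf_of g.
Proof.
move=> bf bg; apply: Linf_eq => x.
rewrite Linf_ofE; last exact: (fa_lin bounded_measurable_algebra).
by rewrite Linf_linE !Linf_ofE// !fctE rmorphD rmorphM.
Qed.

Lemma Linf_of_mul f g : bm f -> bm g -> Linf_of (f * g) = Linf_of f * Linf_of g.
Proof.
move=> bf bg; apply: Linf_eq => x.
rewrite Linf_ofE; last exact: (fa_mul bounded_measurable_algebra).
by rewrite Linf_mulE !Linf_ofE// !fctE rmorphM.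
Qed.

Section FromComplex.
Context {d : nat} (phi : LX -> 'I_d -> C).
Hypothesis pos_phi : unital_positive phi.

Let phi_lin (c : C) f g k : phi (c *: f + g) k = c * phi f k + phi g k.
Proof. by have [h _ _] := pos_phi; rewrite h. Qed.

Let phiB f g k : phi (f - g) k = phi f k - phi g k.
Proof. by rewrite addrC -scaleN1r phi_lin mulN1r addrC. Qed.

Lemma unital_positive_ae (f g : LX) : (\forall x \ae mu, f x = g x) -> phi f = phi g.
Proof.
have [_ _ p0] := pos_phi => fg; apply/funext => k; apply/eqP; rewrite -subr_eq0 -phiB.
rewrite eq_le; apply/andP; split; last first.
  by apply: p0; apply: filterS fg => x fg; rewrite Linf_subE fg subrr.
rewrite -oppr_ge0 phiB opprB -phiB; apply: p0; apply: filterS fg => x fg.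
by rewrite Linf_subE fg subrr.
Qed.

(** A unital positive map is determined by its values at real functions, which
    are real. *)
Definition real_part (f : T -> R) (k : 'I_d) : R := Re (phi (Linf_of f) k).

Let phi_ge0 f k : bm f -> (\forall x \ae mu, 0 <= f x) -> 0 <= phi (Linf_of f) k.
Proof.
have [_ _ p0] := pos_phi => bf f0; apply: p0.
by apply: filterS f0 => x f0; rewrite Linf_ofE// ler0c.
Qed.

Lemma real_partE f k : bm f -> phi (Linf_of f) k = (real_part f k)%:C%C.
Proof.
move=> bf; have [_ [M fM]] := bf; have bmA := @bounded_measurable_algebra R _ T.
have b1 := fa_cst bmA 1.
have bM : bm (M *: cst 1 + f) by exact: (fa_lin bmA).
have : 0 <= phi (Linf_of (M *: cst 1 + f)) k.
  apply: phi_ge0 => //; apply: nearW => x; rewrite !fctE /GRing.scale/= mulr1.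
  by have := fM x; rewrite ler_norml => /andP[+ _]; lra.
have [_ p1 _] := pos_phi.
rewrite Linf_of_lin// phi_lin Linf_of1 p1 [(1 : 'I_d -> C) k](_ : _ = 1)// mulr1.
move=> /ger0_Im; rewrite ImD /= add0r => h; apply: complex_eq => //.
Qed.

Lemma real_part_mono f g k : bm f -> bm g -> (\forall x \ae mu, f x <= g x) ->
  real_part f k <= real_part g k.
Proof.
move=> bf bg fg; have bmA := @bounded_measurable_algebra R _ T.
have : 0 <= phi (Linf_of (g - f)) k.
  apply: phi_ge0; first exact: (fa_sub bmA).
  by apply: filterS fg => x; rewrite !fctE subr_ge0.
rewrite addrC -scaleN1r Linf_of_lin// phi_lin !real_partE//.
by rewrite lecE => /andP[_]; rewrite ReD ReM /= mul0r subr0 mulN1r addrC subr_ge0.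
Qed.

Lemma real_part_state : state_map bm real_part.
Proof.
split.
- by move=> k; rewrite /real_part Linf_of1; have [_ -> _] := pos_phi.
- move=> c f g k bf bg; rewrite /real_part Linf_of_lin// phi_lin ReD ReM /=.
  by rewrite mul0r subr0.
- by move=> f g k bf bg fg; apply: real_part_mono => //; exact: nearW.
Qed.

End FromComplex.

(** State maps act on functions bounded everywhere; an essentially bounded
    function is replaced with such a representative. *)
Definition bounded_rep (f : T -> R) : T -> R :=
  xget (cst 0) [set g | bm g /\ \forall x \ae mu, f x = g x].

Lemma bounded_repP (f : T -> R) : measurable_fun setT f ->
  (exists M : R, \forall x \ae mu, `|f x| <= M) ->
  bm (bounded_rep f) /\ \forall x \ae mu, f x = bounded_rep f x.
Proof.
move=> mf [M fM]; rewrite /bounded_rep; case: xgetP => [g _ //|ng].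
exfalso; apply: (ng (fun x => if `|f x| <= M then f x else 0)); split; first split.
- apply: measurable_fun_ifT => //.
  by apply: measurable_fun_ler => //; exact: measurableT_comp.
- by exists `|M| => x; case: ifP => h; rewrite ?normr0// (le_trans h)// ler_norm.
- by apply: filterS fM => x ->.
Qed.

Lemma bounded_rep_Re (f : LX) : bm (bounded_rep (fun x => Re (f x))) /\
  \forall x \ae mu, Re (f x) = bounded_rep (fun x => Re (f x)) x.
Proof.
have /Linf_predP[mR mI [M fM]] := valP f.
by apply: bounded_repP => //; exists M; apply: filterS fM => x; apply: le_trans (abs_Re _).
Qed.

Lemma bounded_rep_Im (f : LX) : bm (bounded_rep (fun x => Im (f x))) /\
  \forall x \ae mu, Im (f x) = bounded_rep (fun x => Im (f x)) x.
Proof.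
have /Linf_predP[mR mI [M fM]] := valP f.
by apply: bounded_repP => //; exists M; apply: filterS fM => x; apply: le_trans (abs_Im _).
Qed.

Section ToComplex.
Context {d : nat} (U : (T -> R) -> 'I_d -> R).
Hypothesis sU : state_map bm U.
Hypothesis aeU : forall f g, bm f -> bm g -> (\forall x \ae mu, f x = g x) -> U f = U g.

(** The complex-linear extension, defined through representatives; it is linear
    because [U] does not distinguish almost everywhere equal functions. *)
Definition complexify (f : LX) (k : 'I_d) : C :=
  complex.Complex (U (bounded_rep (fun x => Re (f x))) k)
                  (U (bounded_rep (fun x => Im (f x))) k).

Lemma complexifyE f : bm f -> complexify (Linf_of f) = fun k => (U f k)%:C%C.
Proof.
move=> bf; apply/funext => k; apply: complex_eq => /=.
  have [bg fg] := bounded_rep_Re (Linf_of f); rewrite (aeU bg bf)//.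
  by apply: filterS fg => x <-; rewrite Linf_ofE.
have [bg fg] := bounded_rep_Im (Linf_of f).
have b0 : bm (cst 0) by exact: (fa_cst bounded_measurable_algebra 0).
rewrite (aeU bg b0) ?(sm_cst bounded_measurable_algebra sU 0)//.
by apply: filterS fg => x <-; rewrite Linf_ofE.
Qed.

Lemma complexify_lin (c : C) (f g : LX) :
  complexify (c *: f + g) = c *: complexify f + complexify g.
Proof.
have bmA := @bounded_measurable_algebra R _ T.
apply/funext => k.
have [bfr fr] := bounded_rep_Re f; have [bfi fi] := bounded_rep_Im f.
have [bgr gr] := bounded_rep_Re g; have [bgi gi] := bounded_rep_Im g.
have [bhr hr] := bounded_rep_Re (c *: f + g).
have [bhi hi] := bounded_rep_Im (c *: f + g).
set ur := bounded_rep (fun x => Re (f x)) in bfr fr.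
set ui := bounded_rep (fun x => Im (f x)) in bfi fi.
set vr := bounded_rep (fun x => Re (g x)) in bgr gr.
set vi := bounded_rep (fun x => Im (g x)) in bgi gi.
have b1 : bm (- Im c *: ui + vr) by exact: (fa_lin bmA).
have b2 : bm (Im c *: ur + vi) by exact: (fa_lin bmA).
rewrite /complexify.
rewrite (aeU bhr (fa_lin bmA (Re c) bfr b1)); last first.
  apply: filterS2 hr (filterI (filterI fr fi) gr) => x + [[fr' fi'] gr']; rewrite Linf_linE ReD ReM => <-.
  by rewrite !fctE /GRing.scale/= -fr' -fi' -gr'; ring.
rewrite (aeU bhi (fa_lin bmA (Re c) bfi b2)); last first.
  apply: filterS2 hi (filterI (filterI fr fi) gi) => x + [[fr' fi'] gi']; rewrite Linf_linE ImD ImM => <-.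
  by rewrite !fctE /GRing.scale/= -fr' -fi' -gi'; ring.
rewrite !(sm_lin sU)//; apply: complex_eq.
  by rewrite [X in _ = Re X](_ : _ = c * complexify f k + complexify g k)// ReD ReM /=; ring.
by rewrite [X in _ = Im X](_ : _ = c * complexify f k + complexify g k)// ImD ImM /=; ring.
Qed.

Lemma complexify_unital_positive : unital_positive complexify.
Proof.
have bmA := @bounded_measurable_algebra R _ T.
split.
- by move=> c f g; exact: complexify_lin.
- rewrite -Linf_of1 complexifyE; last exact: (fa_cst bmA).
  by apply/funext => k; rewrite (sm_one sU).
- move=> f f0 k.
  have [bfr fr] := bounded_rep_Re f; have [bfi fi] := bounded_rep_Im f.
  rewrite lecE; apply/andP; split; apply/eqP || idtac.
    rewrite /complexify /= (aeU bfi (fa_cst bmA 0)) ?(sm_cst bmA sU)//.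
    by apply: filterS2 fi f0 => x <- /ger0_Im.
  rewrite /complexify /=.
  have bM : bm (absf (bounded_rep (fun x => Re (f x)))) by exact: (fa_abs bmA).
  rewrite (aeU bfr bM) ?(sm_abs_ge0 bmA sU)//.
  apply: filterS2 fr f0 => x fr; rewrite lecE /absf -fr => /andP[_ h].
  by rewrite ger0_norm.
Qed.

End ToComplex.
End LinftyReal.

(** * Functions on a space with an invariant measure *)

Section InvariantMeasure.
Context {R : realType} {G : groupType} {X : topologicalType}.
Context {a : cts_action G X} (mu : invariant_measure R a).
Local Notation C := R[i].
Local Notation Re := complex.Re.
Local Notation Im := complex.Im.
Local Notation LX := (Linf mu).
Local Notation T := (borel (im_nonempty mu)).
Local Notation bm := (@bounded_measurable R _ T).
Local Notation tr := (translate a).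

Lemma ae_act (s : G) (Q : T -> Prop) :
  (\forall x \ae mu, Q x) -> \forall x \ae mu, Q (a s x).
Proof.
move=> [N [mN N0 NQ]]; exists (a s @^-1` N); split.
- by rewrite -[X in measurable X]setTI; have ms := @act_measurable _ _ _ a mu s; exact: ms.
- by rewrite im_invariant.
- by move=> x /= nQ; apply: NQ.
Qed.

Lemma bounded_measurable_translate : translate_closed a bm.
Proof.
move=> s f [mf [M fM]]; split; last by exists M => x; exact: fM.
exact: (measurableT_comp mf (@act_measurable _ _ _ a mu s^-1%g)).
Qed.

Lemma mean_mu_translate s (f : T -> R) : bm f ->
  mean_mu mu (tr s f) = mean_mu mu f.
Proof.
move=> bf; have [M fM] := bf.2; have bmA := @bounded_measurable_algebra R _ T.
have ge0_case (h : T -> R) : bm h -> (forall x, 0 <= h x) ->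
    mean_mu mu (tr s h) = mean_mu mu h.
  move=> [mh _] h0; congr fine.
  have ms := @act_measurable _ _ _ a mu s^-1%g.
  transitivity (\int[pushforward mu (a s^-1%g : T -> T)]_y (h y)%:E)%E.
    rewrite ge0_integral_pushforward//.
    - by apply/measurable_EFinP.
    - by move=> x _; rewrite lee_fin.
  apply: eq_measure_integral => A mA _.
  by rewrite /pushforward; exact: im_invariant.
have b1 : bm (cst 1) by exact: (fa_cst bmA).
have bt := bounded_measurable_translate s bf.
have bM : bm (M *: cst 1 + f) by exact: (fa_lin bmA).
have := ge0_case _ bM; rewrite (_ : tr s _ = M *: cst 1 + tr s f)//.
rewrite !mean_mu_lin ?mean_mu_cst//.
move=> h; apply: (addrI (M * 1)); apply: h => x.
rewrite !fctE /GRing.scale/= mulr1.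
by have := fM x; rewrite ler_norml => /andP[+ _]; lra.
Qed.

Lemma Linf_of_translate s f : bm f -> Linf_of mu (tr s f) = alpha_Linf s (Linf_of mu f).
Proof.
move=> bf; apply: Linf_eq => x.
rewrite Linf_ofE; last exact: bounded_measurable_translate.
by rewrite [RHS](Linf_ofE mu bf).
Qed.

(** As for continuous functions, generation by [q] is an induction principle.
    Closure in the L1 norm is enough: a weak-* limit is a limit in the L2
    norm, because both topologies have the same closed subspaces. *)
Lemma generating_Linf_ind (q : nat -> LX) (qr : nat -> T -> R)
    (P : set (T -> R)) :
  dyn_generating_Linf q ->
  (forall n, \forall x \ae mu, q n x = (qr n x)%:C%C) ->
  P `<=` bm -> (forall c, P (cst c)) ->
  (forall (c : R) f g, P f -> P g -> P (c *: f + g)) ->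
  (forall f g, P f -> P g -> P (f * g)) ->
  (forall s f, P f -> P (tr s f)) ->
  (forall f, bm f -> (forall e, 0 < e -> exists2 g, P g &
    mean_mu mu (absf (f - g)) <= e) -> P f) ->
  (forall n, P (qr n)) -> bm `<=` P.
Proof.
move=> gen qE Pb Pcst Plin Pmul Ptr Plim Pq f bf.
have bmA := @bounded_measurable_algebra R _ T.
have Pae g h : P g -> bm h -> (\forall x \ae mu, h x = g x) -> P h.
  move=> Pg bh hg; apply: Plim => // e e0; exists g => //.
  rewrite (@eq_mean_mu_ae _ _ _ mu _ (cst 0)) ?mean_mu_cst ?ltW//.
  - by apply: (fa_abs bmA); apply: (fa_sub bmA) => //; exact: Pb.
  - exact: (fa_cst bmA).
  - by apply: filterS hg => x hg; rewrite /absf !fctE hg subrr normr0.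
have PD g h : P g -> P h -> P (fun x => g x + h x).
  by move=> Pg Ph; have := Plin 1 _ _ Pg Ph; rewrite scale1r.
have PZ (c : R) g : P g -> P (fun x => c * g x).
  by move=> Pg; have := Plin c _ _ Pg (Pcst 0); rewrite [_ + cst 0]addr0.
have PN g : P g -> P (fun x => - g x).
  move=> Pg; have := PZ (-1) _ Pg; congr P; apply/funext => x; exact: mulN1r.
pose part (h : T -> R) := exists2 u, P u & \forall x \ae mu, h x = u x.
pose A : set LX := [set g | part (fun x => Re (g x)) /\ part (fun x => Im (g x))].
have weak (h : T -> R) : measurable_fun setT h ->
    (exists M : R, \forall x \ae mu, `|h x| <= M) ->
    (forall r : T -> R, mu.-integrable setT (EFin \o r) -> forall e : R, 0 < e ->
      exists2 g : T -> R, measurable_fun setT g /\ part g &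
      `|\int[mu]_x ((h x - g x) * r x)| < e) -> part h.
  move=> mh hM happ; have [bh hh] := bounded_repP mh hM.
  exists (bounded_rep mu h) => //; apply: Plim => // e e0.
  apply: (@weak_closure_subspace _ _ _ mu P) => // r ir e' e'0.
  have [g [mg [u Pu gu]] gr] := happ r ir e' e'0; exists u => //.
  suff <- : \int[mu]_x ((h x - g x) * r x) =
      \int[mu]_x ((bounded_rep mu h x - u x) * r x) by [].
  have mr : measurable_fun setT r.
    by apply/measurable_EFinP; exact: measurable_int ir.
  congr fine; apply: ae_eq_integral => //.
  - by apply/measurable_EFinP; apply: measurable_funM => //; exact: measurable_funB.
  - apply/measurable_EFinP; apply: measurable_funM => //.
    by apply: measurable_funB; [case: bh|case: (Pb _ Pu)].
  - by apply: filterS2 hh gu => x -> -> .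
have Abd (g : LX) : [/\ measurable_fun setT (fun x => Re (g x)),
    measurable_fun setT (fun x => Im (g x)),
    (exists M : R, \forall x \ae mu, `|Re (g x)| <= M) &
    (exists M : R, \forall x \ae mu, `|Im (g x)| <= M)].
  have /Linf_predP[mR mI [M fM]] := valP g; split => //; exists M.
    by apply: filterS fM => x; apply: le_trans (abs_Re _).
  by apply: filterS fM => x; apply: le_trans (abs_Im _).
have AT : A = setT.
  apply: (gen A).
  - split.
    + by split; [exists (cst 1)|exists (cst 0)] => //; exact: nearW.
    + move=> c g h [[gr Pgr gE] [gi Pgi giE]] [[hr Phr hE] [hi Phi hiE]]; split.
        exists (fun x => (Re c * gr x + - (Im c * gi x)) + hr x).
          by apply/(PD _ _ _ Phr)/(PD _ _ (PZ _ _ Pgr))/PN/PZ.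
        apply: filterS3 gE giE hE => x <- <- <-.
        by rewrite Linf_linE ReD ReM.
      exists (fun x => (Re c * gi x + Im c * gr x) + hi x).
        by apply/(PD _ _ _ Phi)/(PD _ _ (PZ _ _ Pgi))/PZ.
      apply: filterS3 gE giE hiE => x <- <- <-.
      by rewrite Linf_linE ImD ImM.
    + move=> g h [[gr Pgr gE] [gi Pgi giE]] [[hr Phr hE] [hi Phi hiE]].
      have E : \forall x \ae mu, (Re (g x) = gr x /\ Im (g x) = gi x) /\
          (Re (h x) = hr x /\ Im (h x) = hi x).
        by apply: filterI; apply: filterI.
      split.
        exists (fun x => gr x * hr x + - (gi x * hi x)).
          by apply: PD; [exact: Pmul|apply: PN; exact: Pmul].
        by apply: filterS E => x [[<- <-] [<- <-]]; rewrite Linf_mulE ReM.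
      exists (fun x : T => gr x * hi x + gi x * hr x).
        by apply: PD; exact: Pmul.
      by move: E; apply: filterS => x [[<- <-] [<- <-]]; rewrite Linf_mulE ImM.
    + move=> g h [[gr Pgr gE] [gi Pgi giE]] hg; split.
        by exists gr => //; apply: filterS gE => x <-; rewrite hg ReJ.
      exists (fun x => - gi x); first exact: PN.
      by apply: filterS giE => x <-; rewrite hg ImJ.
    + move=> g gapp; have [mR mI bR bI] := Abd g.
      have test (r : T -> R) e : mu.-integrable setT (EFin \o r) -> 0 < e ->
        exists2 h : LX, A h & normc (cintegral mu (fun x => (g x - h x) * (r x)%:C%C)) < e.
        move=> ir e0; have [_|h Ah hh] := gapp 1%N (fun _ x => (r x)%:C%C) _ e e0.
          by split => //=; exact: integrable0.
        by exists h => //; exact: (hh ord0).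
      split; apply: weak => // r ir e e0; have [h Ah hh] := test r e ir e0.
        exists (fun x => Re (h x)); first by split; [case: (Abd h)|case: Ah].
        apply: le_lt_trans hh; apply: le_trans (abs_Re _) => /=.
        rewrite le_eqVlt; apply/orP; left; apply/eqP; congr (`|_|).
        by apply: eq_Rintegral => x _; rewrite ReM /= mulr0 subr0 ReB.
      exists (fun x => Im (h x)); first by split; [case: (Abd h)|case: Ah].
      apply: le_lt_trans hh; apply: le_trans (abs_Im _) => /=.
      rewrite le_eqVlt; apply/orP; left; apply/eqP; congr (`|_|).
      by apply: eq_Rintegral => x _; rewrite ImM /= mulr0 add0r ImB.
  - move=> s g [[gr Pgr gE] [gi Pgi giE]]; split.
      by exists (tr s gr); [exact: Ptr|exact: (ae_act s^-1%g gE)].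
    by exists (tr s gi); [exact: Ptr|exact: (ae_act s^-1%g giE)].
  - move=> n; split.
      by exists (qr n) => //; apply: filterS (qE n) => x ->.
    by exists (cst 0) => //; apply: filterS (qE n) => x ->.
have [[u Pu fu] _] : A (Linf_of mu f) by rewrite AT.
apply: (Pae _ _ Pu bf); apply: filterS fu => x fu.
by rewrite -fu Linf_ofE.
Qed.

End InvariantMeasure.

(** * Density of continuous functions *)

Section MetricFunctions.
Context {R : realType} {X : metricType R}.

Lemma continuous_lipschitz (f : X -> R) :
  (forall x y, f x <= f y + mdist x y) -> continuous f.
Proof.
move=> fL x; apply/cvgrPdist_lt => e e0; near=> y.
have xy : mdist x y < e.
  have : ball x e y by near: y; exact: nbhsx_ballx.
  by rewrite ballEmdist.
have h1 := fL x y; have := fL y x; rewrite [mdist y x]metric_sym => h2.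
by rewrite ltr_norml; apply/andP; split; lra.
Unshelve. all: by end_near. Qed.

Definition dist_to (A : set X) (x : X) : R := inf [set mdist x y | y in A].

Lemma dist_to_continuous A : A !=set0 -> continuous (dist_to A).
Proof.
move=> [z Az]; apply: continuous_lipschitz => x y.
have lb w : has_lbound [set mdist w u | u in A].
  by exists 0 => _ [u _ <-]; exact: mdist_ge0.
rewrite -lerBlDr; apply: lb_le_inf; first by exists (mdist y z), z.
move=> _ [u Au <-]; rewrite lerBlDr.
apply: le_trans (_ : mdist x u <= _); first by apply: ge_inf => //; exists u.
by rewrite addrC metric_triangle.
Qed.

(** The distance to the complement, or 1 if the complement is empty. *)
Lemma open_positive_set (O : set X) : open O -> exists u : X -> R,
  [/\ continuous u, (forall x, 0 <= u x) & (forall x, O x <-> 0 < u x)].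
Proof.
move=> oO; have [nO|] := pselect ((~` O) !=set0); last first.
  move=> nO; exists (cst 1); split => // [x|x]; first exact: cvg_cst.
  split=> // _; apply: contrapT => nOx; apply: nO; by exists x.
have lb w : has_lbound [set mdist w u | u in ~` O].
  by exists 0 => _ [u _ <-]; exact: mdist_ge0.
have ne w : [set mdist w u | u in ~` O] !=set0.
  by have [z Oz] := nO; exists (mdist w z), z.
exists (dist_to (~` O)); split; first exact: dist_to_continuous.
  by move=> x; apply: lb_le_inf => // _ [u _ <-]; exact: mdist_ge0.
move=> x; split => [Ox|].
  have : nbhs x O by exact: open_nbhs_nbhs.
  rewrite -nbhs_ballE => -[e /= e0 xeO].
  apply: (lt_le_trans e0); apply: lb_le_inf => // _ [u nOu <-].
  rewrite leNgt; apply/negP => xu; apply: nOu; apply: xeO.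
  by rewrite ballEmdist.
move=> h; apply: contrapT => nOx; move: h; rewrite ltNge => /negP; apply.
by apply: ge_inf => //; exists x => //; exact: mdistxx.
Qed.

Lemma continuous_minr (f g : X -> R) : continuous f -> continuous g ->
  continuous (fun x => Num.min (f x) (g x)).
Proof.
move=> cf cg; have -> : (fun x => Num.min (f x) (g x)) =
    (fun x => (f x + g x - `|f x - g x|) / 2).
  by apply/funext => x; rewrite minr_absE.
move=> x; apply: cvgMl; apply: cvgB; first by apply: cvgD; [exact: cf|exact: cg].
by apply: cvg_norm; apply: cvgB; [exact: cf|exact: cg].
Qed.

Definition ramp (u : X -> R) (n : nat) (x : X) : R := Num.min 1 (n%:R * u x).

Lemma ramp_continuous u n : continuous u -> continuous (ramp u n).
Proof.
move=> cu; apply: continuous_minr => x; first exact: cvg_cst.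
by apply: cvgMr; exact: cu.
Qed.

Lemma ramp_itv u n x : 0 <= u x -> 0 <= ramp u n x <= 1.
Proof.
by move=> u0; rewrite /ramp ge_min lexx /= andbT le_min ler01 mulr_ge0.
Qed.

Lemma ramp_cvg u x : 0 < u x -> \forall n \near \oo, ramp u n x = 1.
Proof.
move=> ux; near=> n; rewrite /ramp min_l// -ler_pdivrMr// div1r.
near: n; exact: nbhs_infty_ger.
Unshelve. all: by end_near. Qed.

Lemma ramp0 u n x : u x = 0 -> ramp u n x = 0.
Proof. by move=> ux; rewrite /ramp ux mulr0 min_r. Qed.

End MetricFunctions.

Section Density.
Context {R : realType} {X : metricType R} (X0 : [set: X] !=set0).
Hypothesis cX : compact [set: X].
Local Notation T := (borel X0).
Local Notation bm := (@bounded_measurable R _ T).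

Lemma continuous_measurable (f : X -> R) : continuous f ->
  measurable_fun setT (f : T -> R).
Proof.
move=> cf; apply: (measurability _ (RGenOInfty.measurableE R)).
move=> _ [_ [r ->] <-]; rewrite setTI; apply: sub_gen_smallest => /=.
move/continuousP : cf; apply; rewrite set_itvoy; exact: open_gt.
Qed.

Lemma continuous_bounded_measurable (f : X -> R) : continuous f -> bm f.
Proof.
move=> cf; split; first exact: continuous_measurable.
exact: (fa_bnd (cts_real_algebra cX) cf).
Qed.

Context (mu : probability T R).

(** Continuous functions are dense in the L1 norm: the sets whose indicator can
    be approximated form a sigma-algebra containing the open sets. *)
Lemma continuous_dense (f : T -> R) (e : R) : bm f -> 0 < e ->
  exists2 g : X -> R, continuous g & mean_mu mu (absf (f - g)) <= e.
Proof.
have bmA := @bounded_measurable_algebra R _ T.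
have ctA := @cts_real_algebra R _ cX.
pose P (f : T -> R) := bm f /\ forall e : R, 0 < e -> exists2 g : X -> R, continuous g &
  mean_mu mu (absf (f - g)) <= e.
have tri (g h k : T -> R) : bm g -> bm h -> bm k ->
    mean_mu mu (absf (g - k)) <= mean_mu mu (absf (g - h)) + mean_mu mu (absf (h - k)).
  move=> bg bh bk; have babs u v : bm u -> bm v -> bm (absf (u - v)).
    by move=> bu bv; apply/(fa_abs bmA)/(fa_sub bmA).
  have b1 := babs _ _ bg bh; have b2 := babs _ _ bh bk.
  rewrite -mean_muD//; apply: mean_mu_le; [exact: babs|exact: (fa_add bmA)|].
  move=> x; rewrite /absf !fctE; apply: le_trans (ler_normD _ _).
  by rewrite addrA subrK.
have Pcts g : continuous (g : X -> R) -> P g.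
  move=> cg; split; first exact: continuous_bounded_measurable.
  move=> e' e'0; exists g => //; rewrite (_ : absf _ = cst 0) ?mean_mu_cst ?ltW//.
  by apply/funext => x; rewrite /absf !fctE subrr normr0.
have Plim g : bm g -> (forall e, 0 < e -> exists2 h, P h & mean_mu mu (absf (g - h)) <= e) -> P g.
  move=> bg gapp; split => // e' e'0.
  have e2 : 0 < e' / 2 by rewrite divr_gt0.
  have [h [bh happ] gh] := gapp _ e2; have [k ck hk] := happ _ e2.
  exists k => //; rewrite [e']splitr; apply: le_trans (tri g h k _ _ _) _ => //.
    exact: continuous_bounded_measurable.
  exact: lerD.
have Plin (c : R) g h : P g -> P h -> P (c *: g + h).
  move=> [bg gapp] [bh happ]; split; first exact: (fa_lin bmA).
  move=> e' e'0; pose e1 := e' / 2 / (`|c| + 1).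
  have c1 : 0 < `|c| + 1 by rewrite ltr_pwDr.
  have e10 : 0 < e1 by rewrite !divr_gt0.
  have [g' cg' gg'] := gapp e1 e10; have [h' ch' hh'] := happ (e' / 2) ltac:(by rewrite divr_gt0).
  have bg' := continuous_bounded_measurable cg'; have bh' := continuous_bounded_measurable ch'.
  exists (c *: g' + h'); first exact: (fa_lin ctA c cg' ch').
  have b1 : bm (absf (g - g')) by apply/(fa_abs bmA)/(fa_sub bmA).
  have b2 : bm (absf (h - h')) by apply/(fa_abs bmA)/(fa_sub bmA).
  apply: (@le_trans _ _ (mean_mu mu (`|c| *: absf (g - g') + absf (h - h')))).
    apply: mean_mu_le.
    - by apply/(fa_abs bmA)/(fa_sub bmA); apply: (fa_lin bmA).
    - exact: (fa_lin bmA).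
    - move=> x; rewrite /absf !fctE /GRing.scale/= -normrM.
      apply: le_trans (ler_normD _ _); rewrite le_eqVlt; apply/orP; left; apply/eqP.
      by congr (`|_|); ring.
  rewrite mean_mu_lin// [e']splitr lerD//.
  apply: (@le_trans _ _ ((`|c| + 1) * e1)); last by rewrite /e1 mulrC divfK// gt_eqF.
  apply: ler_pM => //; first by apply: mean_mu_ge0 => x; exact: normr_ge0.
  by rewrite lerDl.
have mulstep g h (M : R) : bm g -> bm h -> (forall x, `|g x| <= M) ->
    forall h', bm h' -> mean_mu mu (absf (g * h - g * h')) <= `|M| * mean_mu mu (absf (h - h')).
  move=> bg bh gM h' bh'; have b2 : bm (absf (h - h')) by apply/(fa_abs bmA)/(fa_sub bmA).
  rewrite -mean_muZ//; apply: mean_mu_le.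
  - by apply/(fa_abs bmA)/(fa_sub bmA); apply: (fa_mul bmA).
  - exact: (fa_scale bmA).
  - move=> x; rewrite /absf !fctE -mulrBr normrM ler_wpM2r//.
    by rewrite (le_trans (gM x))// ler_norm.
have Pmul g h : P g -> P h -> P (g * h).
  have half g' h' : continuous (g' : X -> R) -> P h' -> P (g' * h').
    move=> cg' [bh' happ]; have bg' := continuous_bounded_measurable cg'.
    have [M g'M] := bg'.2; split; first exact: (fa_mul bmA).
    move=> e' e'0; have M1 : 0 < `|M| + 1 by rewrite ltr_pwDr.
    have [k ck hk] := happ (e' / (`|M| + 1)) ltac:(by rewrite divr_gt0).
    exists (g' * k); first exact: (fa_mul ctA cg' ck).
    apply: le_trans (mulstep _ _ _ bg' bh' g'M _ (continuous_bounded_measurable ck)) _.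
    apply: (@le_trans _ _ ((`|M| + 1) * (e' / (`|M| + 1)))); last by rewrite mulrC divfK// gt_eqF.
    apply: ler_pM => //; first by apply: mean_mu_ge0 => x; exact: normr_ge0.
    by rewrite lerDl.
  move=> [bg gapp] Ph; have [bh _] := Ph; have [M hM] := bh.2.
  apply: Plim; first exact: (fa_mul bmA).
  move=> e' e'0; have M1 : 0 < `|M| + 1 by rewrite ltr_pwDr.
  have [k ck gk] := gapp (e' / (`|M| + 1)) ltac:(by rewrite divr_gt0).
  exists (k * h); first exact: half.
  rewrite ![_ * h]mulrC.
  apply: le_trans (mulstep _ _ _ bh bg hM _ (continuous_bounded_measurable ck)) _.
  apply: (@le_trans _ _ ((`|M| + 1) * (e' / (`|M| + 1)))); last by rewrite mulrC divfK// gt_eqF.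
  apply: ler_pM => //; first by apply: mean_mu_ge0 => x; exact: normr_ge0.
  by rewrite lerDl.
have Pdom (g_ : nat -> T -> R) g : (forall n, P (g_ n)) -> bm g ->
    (forall n x, `|g_ n x - g x| <= 1) -> (forall x, g_ n x @[n --> \oo] --> g x) -> P g.
  move=> Pg bg g1 gg; apply: Plim => // e' e'0.
  have b1 := fa_cst bmA 1.
  have bd n : bm (absf (g - g_ n)).
    by apply/(fa_abs bmA)/(fa_sub bmA) => //; case: (Pg n).
  have [|||||_ cv] := @dominated_Rintegral _ _ _ mu (fun n => absf (g - g_ n)) (cst 0) (EFin \o cst 1).
  - by move=> n; case: (bd n).
  - exact: measurable_cst.
  - apply: nearW => x.
    have : `|g x - g_ n x| @[n --> \oo] --> `|g x - g x|.
      by apply: cvg_norm; apply: cvgB => //; exact: cvg_cst.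
    by rewrite subrr normr0.
  - exact: bounded_measurable_integrable.
  - by apply: nearW => x n; rewrite lee_fin /absf !fctE normr_id distrC.
  move: cv; rewrite [X in _ --> X](mean_mu_cst mu 0) => /cvgr_le /(_ _ e'0)[n _ /(_ n (leqnn n)) h].
  by exists (g_ n).
have Pind (B : set T) : measurable B -> P \1_B.
  have ind_bm (C : set T) : measurable C -> bm \1_C.
    move=> mC; split; first exact: measurable_indic.
    by exists 1 => x; rewrite indicE ger0_norm//; case: (_ \in _).
  pose D : set (set T) := [set B | measurable B /\ P \1_B].
  suff : <<s @open X >> `<=` D by move=> sD mB; have [] := sD B mB.
  apply: smallest_sub; last first.
    move=> O oO; have mO : measurable (O : set T) by exact: sub_gen_smallest.
    split => //; have [u [cu u0 Ou]] := open_positive_set oO.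
    apply: (Pdom (ramp u)).
    - by move=> n; apply: Pcts; exact: ramp_continuous.
    - exact: ind_bm.
    - move=> n x; have /andP[r0 r1] := @ramp_itv _ _ u n x (u0 x).
      by rewrite indicE ler_norml; case: (_ \in _) => /=; apply/andP; split; lra.
    - move=> x; rewrite indicE; have [/set_mem /Ou ux|xO] := boolP (x \in O).
        apply: cvg_near_cst; exact: ramp_cvg.
      have ux : u x = 0.
        apply/eqP; rewrite eq_le u0 andbT leNgt; apply/negP => /Ou h.
        by move: xO; rewrite (mem_set h).
      by apply: cvg_near_cst; apply: nearW => n; rewrite ramp0.
  have P0 : P (cst 0) by apply: Pcts => x; exact: cvg_cst.
  have P1 : P (cst 1) by apply: Pcts => x; exact: cvg_cst.
  have DC B' : D B' -> D (~` B').
    move=> [mB PB]; split; first exact: measurableC.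
    have -> : \1_(~` B') = (-1) *: \1_B' + cst 1 :> (T -> R).
      apply/funext => x; rewrite !fctE !indicE in_setC /GRing.scale/=.
      by case: (x \in B') => /=; ring.
    exact: Plin.
  have DI A B' : D A -> D B' -> D (A `&` B').
    move=> [mA PA] [mB PB]; split; first exact: measurableI.
    by rewrite indicI; exact: Pmul.
  split.
  - by split; [exact: measurable0|rewrite indic0].
  - by move=> A DA; rewrite setTD; exact: DC.
  - move=> F DF.
    have Dn n : D (\bigcup_(i < n) F i).
      elim: n => [|n IH].
        by rewrite bigcup_mkord big_ord0; split; [exact: measurable0|rewrite indic0].
      rewrite bigcup_mkord big_ord_recr/= -bigcup_mkord -[_ `|` _]setCK setCU.
      by apply: (DC); apply: DI; exact: DC.
    split; first by apply: bigcupT_measurable => n; case: (DF n).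
    apply: (Pdom (fun n => \1_(\bigcup_(i < n) F i))).
    - by move=> n; case: (Dn n).
    - by apply: ind_bm; apply: bigcupT_measurable => n; case: (DF n).
    - by move=> n x; rewrite !indicE; case: (_ \in _); case: (_ \in _);
        rewrite /= ?subrr ?subr0 ?sub0r ?normrN ?normr0 ?normr1.
    - move=> x; rewrite !indicE; have [/set_mem[n _ Fnx]|] := boolP (x \in _).
        apply: cvg_near_cst; exists n.+1 => // m nm; rewrite indicE mem_set//.
        by exists n.
      move=> nFx; apply: cvg_near_cst; apply: nearW => n; rewrite indicE memNset//.
      by move=> [k _ Fk]; move: nFx; rewrite mem_set//; exists k.
suff Pbm g : bm g -> P g by move=> /Pbm[_]; exact.
move=> bg; have [M0 gM0] := bg.2; pose M := `|M0| + 1.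
have M0' : 0 < M by rewrite ltr_pwDr.
have gM x : `|g x| < M by rewrite (le_lt_trans (gM0 x))// (le_lt_trans (ler_norm _))// ltrDl.
apply: Plim => // e' e'0.
(* Layer-cake approximation with steps of height [e']. *)
have [N hN] : exists N : nat, 2 * M <= N%:R * e'.
  exists (Num.truncn (2 * M / e')).+1; rewrite -ler_pdivrMr//.
  by rewrite ltW// truncnS_gt.
pose lay (k : nat) : set T := [set x | - M + k.+1%:R * e' <= g x].
have mlay k : measurable (lay k).
  have [mg _] := bg; rewrite -[lay k]setTI.
  have := mg measurableT `[(- M + k.+1%:R * e'), +oo[%classic (measurable_itv _).
  by congr measurable; apply/seteqP; split => x [_] /=; rewrite in_itv/= andbT.
pose s : T -> R := e' *: (\sum_(k < N) \1_(lay k)) + cst (- M).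
have Ps : P s.
  apply: (Plin); last by apply: Pcts => x; exact: cvg_cst.
  apply: (@big_ind _ P).
  - by apply: (Pcts) => x; exact: cvg_cst.
  - by move=> u v Pu Pv; rewrite -[u]scale1r; exact: Plin.
  - by move=> k _; exact: Pind.
exists s => //; rewrite -[leRHS](mean_mu_cst mu); apply: mean_mu_le.
- by apply/(fa_abs bmA)/(fa_sub bmA) => //; case: Ps.
- exact: (fa_cst bmA).
move=> x; rewrite /absf /s !fctE /GRing.scale/= fct_sumE.
set t := (g x + M) / e'.
have t0 : 0 <= t by rewrite divr_ge0 ?(ltW e'0)//; have := gM x; rewrite ltr_norml => /andP[]; lra.
have tN : t < N%:R by rewrite ltr_pdivrMr//; have := gM x; rewrite ltr_norml => /andP[]; lra.
have -> : \sum_(k < N) \1_(lay k) x = (Num.truncn t)%:R :> R.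
  transitivity (\sum_(k < N) ((k < Num.truncn t)%N)%:R : R).
    apply: eq_bigr => k _; rewrite indicE; congr ((nat_of_bool _)%:R).
    apply/idP/idP => [/set_mem|] h.
      rewrite truncn_ge_nat// ler_pdivlMr//.
      by move: h; rewrite /lay/=; lra.
    apply/mem_set; move: h; rewrite truncn_ge_nat// ler_pdivlMr// /lay/=; lra.
  have tN' : (Num.truncn t <= N)%N by rewrite ltnW// truncn_lt_nat.
  rewrite -natr_sum; congr (_%:R).
  suff h n m : (\sum_(k < n) (k < m))%N = minn m n by rewrite h (minn_idPl tN').
  elim: n => [|n IH]; first by rewrite big_ord0 minn0.
  by rewrite big_ord_recr /= IH; lia.
have := truncn_itv t0; set m := Num.truncn t => /andP[m1 m2].
have gE : g x = t * e' - M by rewrite /t divfK ?addrK// gt_eqF.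
have -> : g x - (e' * m%:R + - M) = e' * (t - m%:R) by rewrite gE; ring.
rewrite normrM ger0_norm ?(ltW e'0)// ger0_norm ?subr_ge0// -[leRHS]mulr1.
rewrite ler_wpM2l ?(ltW e'0)// lerBlDr addrC.
by move: m2; rewrite -natr1; exact: ltW.
Qed.

End Density.

(** * The Riesz-Markov theorem *)

Section RieszMarkov.
Context {R : realType} {X : metricType R} (X0 : [set: X] !=set0).
Hypothesis cX : compact [set: X].
Variable I : (X -> R) -> R.
(* A positive unital functional is a state map with one component. *)
Hypothesis sI : state_map (@cts_real R X) (fun f (_ : 'I_1) => I f).
Local Notation T := (borel X0).

Let ctA := @cts_real_algebra R X cX.
Let k0 : 'I_1 := ord0.

Let I_lin (c : R) f g : cts_real f -> cts_real g -> I (c *: f + g) = c * I f + I g.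
Proof. by move=> cf cg; exact: (sm_lin sI c k0 cf cg). Qed.
Let I_add f g : cts_real f -> cts_real g -> I (f + g) = I f + I g.
Proof. by move=> cf cg; exact: (sm_add sI k0 cf cg). Qed.
Let I_subc f c : cts_real f -> I (f - cst c) = I f - c.
Proof. by move=> cf; exact: (sm_subc ctA sI c k0 cf). Qed.
Let I_mono f g : cts_real f -> cts_real g -> (forall x, f x <= g x) -> I f <= I g.
Proof. by move=> cf cg fg; exact: (sm_mono sI k0 cf cg fg). Qed.
Let I_cst c : I (cst c) = c. Proof. exact: (sm_cst ctA sI c k0). Qed.

(** Continuous functions below the indicator of [O]. *)
Definition below (O : set X) : set (X -> R) := [set f |
  [/\ cts_real f, forall x, 0 <= f x <= 1 & forall x, ~ O x -> f x = 0]].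

Lemma below0 O : below O (cst 0).
Proof. by split=> // [|x]; [exact: (fa_cst ctA)|rewrite lexx ler01]. Qed.

Let I_itv O f : below O f -> 0 <= I f <= 1.
Proof.
move=> [cf f01 _]; rewrite -{1}(I_cst 0) -(I_cst 1).
rewrite !I_mono//; try exact: (fa_cst ctA); by move=> x; have /andP[] := f01 x.
Qed.

Definition open_mass (O : set X) : R := sup [set I f | f in below O].

Let mass_has_sup O : has_sup [set I f | f in below O].
Proof.
split; first by exists (I (cst 0)), (cst 0) => //; exact: below0.
by exists 1 => _ [f /I_itv /andP[_ h] <-].
Qed.

Lemma le_open_mass O f : below O f -> I f <= open_mass O.
Proof. by move=> bf; apply: ub_le_sup; [case: (mass_has_sup O)|exists f]. Qed.

Lemma open_mass_le O c : (forall f, below O f -> I f <= c) -> open_mass O <= c.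
Proof.
by move=> h; apply: ge_sup; [case: (mass_has_sup O)|move=> _ [f bf <-]; exact: h].
Qed.

Lemma open_mass_ge0 O : 0 <= open_mass O.
Proof. by rewrite -(I_cst 0); apply: le_open_mass; exact: below0. Qed.

Lemma open_mass_mono O O' : O `<=` O' -> open_mass O <= open_mass O'.
Proof.
move=> OO'; apply: open_mass_le => f [cf f01 f0]; apply: le_open_mass.
by split => // x nO'x; apply: f0 => /OO'.
Qed.

Lemma open_massT : open_mass setT = 1.
Proof.
apply/eqP; rewrite eq_le; apply/andP; split.
  by apply: open_mass_le => f /I_itv/andP[].
rewrite -(I_cst 1); apply: le_open_mass; split; first exact: (fa_cst ctA).
- by move=> x; rewrite ler01 lexx.
- by move=> x /(_ Logic.I).
Qed.

Lemma open_mass0 : open_mass set0 = 0.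
Proof.
apply/eqP; rewrite eq_le open_mass_ge0 andbT; apply: open_mass_le => f [cf _ f0].
by rewrite (_ : f = cst 0) ?I_cst//; apply/funext => x; apply: f0.
Qed.

Lemma compact_increasing (V : nat -> set X) : (forall n, open (V n)) ->
  (forall n m, (n <= m)%N -> V n `<=` V m) -> (forall x, exists n, V n x) ->
  exists N, forall x, V N x.
Proof.
move=> oV mV cV; have /compact_near_coveringP := cX.
move=> /(_ nat \oo (fun n x => V n x) _)[].
  move=> x _; have [n Vnx] := cV x.
  exists (V n, [set m | (n <= m)%N]) => /=.
    split; first by apply: open_nbhs_nbhs; split.
    exact: nbhs_infty_ge.
  by move=> [y m] [/= Vny nm]; exact: mV Vny.
by move=> N _ /(_ N (leqnn N)) VN; exists N => x; exact: VN.
Qed.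

Lemma open_cut (f : X -> R) (e : R) : continuous f -> open [set x | f x < e].
Proof.
move=> cf; have -> : [set x | f x < e] = f @^-1` [set y | y < e] by [].
by move/continuousP : cf; apply; exact: open_lt.
Qed.

Let excess f e : below setT f -> 0 < e -> cts_real (fun x => Num.max 0 (f x - e)).
Proof.
move=> [cf _ _] e0; have -> : (fun x => Num.max 0 (f x - e)) =
    (fun x => (0 + (f x - e) + `|0 - (f x - e)|) / 2).
  by apply/funext => x; rewrite maxr_absE.
move=> x; have h : (fun x => f x - e) x0 @[x0 --> x] --> f x - e.
  by apply: cvgB; [exact: cf|exact: cvg_cst].
apply: cvgMl; apply: cvgD; first by apply: cvgD => //; exact: cvg_cst.
by apply: cvg_norm; apply: cvgB => //; exact: cvg_cst.
Qed.

(** A function below the union is, up to [e], supported on the compact set where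
    it is at least [e], hence on finitely many of the open sets, between which
    it is then divided. *)
Lemma open_mass_sigma_subadditive (O : nat -> set X) : (forall n, open (O n)) ->
  ((open_mass (\bigcup_n O n))%:E <= \sum_(0 <= n <oo) (open_mass (O n))%:E)%E.
Proof.
move=> oO.
have /choice[u uP] : forall n, exists u : X -> R, [/\ continuous u,
  (forall x, 0 <= u x) & (forall x, O n x <-> 0 < u x)].
  by move=> n; exact: open_positive_set.
suff key f e : below (\bigcup_n O n) f -> 0 < e -> exists N : nat,
    I f <= \sum_(0 <= n < N) open_mass (O n) + e.
  apply/lee_addgt0Pr => e e0.
  have S0 : (0 <= \sum_(0 <= n <oo) (open_mass (O n))%:E)%E.
    by apply: nneseries_ge0 => n _ _; rewrite lee_fin open_mass_ge0.
  case E : (\sum_(0 <= n <oo) (open_mass (O n))%:E)%E S0 => [r| |]// _.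
    rewrite -EFinD lee_fin; apply: open_mass_le => f bf.
    have [N fN] := key f e bf e0; apply: (le_trans fN); rewrite lerD2r -lee_fin -E -sumEFin.
    by apply: nneseries_lim_ge => n _ _; rewrite lee_fin open_mass_ge0.
  by rewrite addye// leey.
move=> [cf f01 f0] e0.
pose V (N : nat) : set X := [set x | f x < e] `|`
  \bigcup_(n in [set n | (n < N)%N]) [set x | 1 < N%:R * u n x].
have [||x|N VN] := @compact_increasing V.
- move=> n; apply: openU; first exact: open_cut.
  apply: bigcup_open => k _.
  have -> : [set x | 1 < n%:R * u k x] = (fun x => n%:R * u k x) @^-1` [set y | 1 < y] by [].
  have ch : continuous (fun x => n%:R * u k x).
    by move=> x; apply: cvgMr; case: (uP k) => cu _ _; exact: cu.
  by move/continuousP : ch; apply; exact: open_gt.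
- move=> n m nm x [fx|[k /= kn h]]; first by left.
  right; exists k; first by rewrite /= (leq_trans kn).
  have [_ u0 _] := uP k; apply: (lt_le_trans h).
  by rewrite ler_wpM2r// ler_nat.
- have [xe|xe] := ltP (f x) e; first by exists 0%N; left.
  have [n _ Onx] : (\bigcup_n O n) x.
    apply: contrapT => /f0 fx0; move: xe; rewrite fx0 leNgt e0//.
  have ux : 0 < u n x by case: (uP n) => _ _ h; exact/h.
  exists (maxn n.+1 (Num.truncn (u n x)^-1).+1); right; exists n.
    by rewrite /= leq_max ltnSn.
  rewrite /= -ltr_pdivrMr// div1r; apply: (lt_le_trans (truncnS_gt _)).
  by rewrite ler_nat leq_max leqnn orbT.
exists N; have cr n : cts_real (ramp (u n) N) by apply: ramp_continuous; case: (uP n).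
have csum n : cts_real (\sum_(0 <= k < n) ramp (u k) N).
  elim: n => [|n IH]; first by rewrite big_geq//; exact: (fa_cst ctA 0).
  by rewrite big_nat_recr//=; exact: (fa_add ctA).
have Isum n : I (\sum_(0 <= k < n) ramp (u k) N) = \sum_(0 <= k < n) I (ramp (u k) N).
  elim: n => [|n IH]; first by rewrite !big_geq//; exact: (I_cst 0).
  by rewrite !big_nat_recr//= I_add// IH.
rewrite -lerBlDr -I_subc//; apply: (@le_trans _ _ (I (\sum_(0 <= k < N) ramp (u k) N))).
  apply: I_mono => //; first by apply: (fa_sub ctA) => //; exact: (fa_cst ctA).
  move=> x; rewrite !fctE fct_sumE.
  have r0 k : 0 <= ramp (u k) N x.
    by have [_ u0 _] := uP k; have /andP[] := @ramp_itv _ _ (u k) N x (u0 x).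
  have [xe|[n /= nN h]] := VN x.
    by apply: (@le_trans _ _ 0); [rewrite subr_le0 ltW|exact: sumr_ge0].
  rewrite big_mkord (bigD1 (Ordinal nN))//=.
  apply: (@le_trans _ _ 1); first by have /andP[_ f1] := f01 x; rewrite lerBlDr (le_trans f1)// lerDl ltW.
  rewrite -[leLHS]addr0 lerD//; last exact: sumr_ge0.
  by rewrite /ramp min_l// ltW.
rewrite Isum; apply: ler_sum => k _; apply: le_open_mass; split => //.
  by move=> x; have [_ u0 _] := uP k; exact: ramp_itv.
move=> x nOx; apply: ramp0; have [_ u0 uO] := uP k.
by apply/eqP; rewrite eq_le u0 andbT leNgt; apply/negP => /uO.
Qed.

Definition outer_mass (A : set (pointed_copy X0)) : \bar R :=
  (inf [set open_mass O | O in [set O : set X | open O /\ A `<=` O]])%:E.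

Let outer_has_inf (A : set X) :
  has_inf [set open_mass O | O in [set O : set X | open O /\ A `<=` O]].
Proof.
split; last by exists 0 => _ [ O _ <-]; exact: open_mass_ge0.
by exists (open_mass setT), setT => //; split => //; exact: openT.
Qed.

Lemma outer_mass_le (A O : set X) : open O -> A `<=` O ->
  (outer_mass A <= (open_mass O)%:E)%E.
Proof.
by move=> oO AO; rewrite lee_fin; apply: ge_inf; [case: (outer_has_inf A)|exists O].
Qed.

Lemma le_outer_mass (A : set X) c : (forall O, open O -> A `<=` O -> c <= open_mass O) ->
  (c%:E <= outer_mass A)%E.
Proof.
move=> h; rewrite lee_fin; apply: lb_le_inf; first by case: (outer_has_inf A).
by move=> _ [ O [oO AO] <-]; exact: h.
Qed.

Lemma outer_mass_open (O : set X) : open O -> outer_mass O = (open_mass O)%:E.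
Proof.
move=> oO; apply/eqP; rewrite eq_le outer_mass_le//=; apply: le_outer_mass => O' _.
exact: open_mass_mono.
Qed.

Let outer_mass0 : outer_mass set0 = 0%E.
Proof. by have := outer_mass_open open0; rewrite open_mass0. Qed.

Let outer_mass_ge0 A : (0 <= outer_mass A)%E.
Proof. by apply: le_outer_mass => O _ _; exact: open_mass_ge0. Qed.

Let outer_mass_homo : {homo outer_mass : A B / A `<=` B >-> (A <= B)%E}.
Proof.
move=> A B AB; apply: le_outer_mass => O oO BO; rewrite -lee_fin.
by apply: outer_mass_le => // x /AB /BO.
Qed.

Let outer_mass_sigma : sigma_subadditive outer_mass.
Proof.
move=> A; apply/lee_addgt0Pr => e e0.
apply: le_trans (epsilon_trick _ _ (ltW e0)); last by [].
have /choice[ O OP] : forall n, exists O : set X, [/\ open O, A n `<=` O &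
    ((open_mass O)%:E <= outer_mass (A n) + (e / (2 ^ n.+1)%:R)%:E)%E].
  move=> n; have en : 0 < e / (2 ^ n.+1)%:R by rewrite divr_gt0// ltr0n expn_gt0.
  have [_ [ O [oO AO] <-] h] := inf_adherent en (outer_has_inf (A n)).
  by exists O; split => //; rewrite -EFinD lee_fin ltW.
apply: (@le_trans _ _ (open_mass (\bigcup_n O n))%:E).
  apply: outer_mass_le; first by apply: bigcup_open => n _; case: (OP n).
  by apply: subset_bigcup => n _; case: (OP n).
apply: le_trans (open_mass_sigma_subadditive _) _; first by move=> n; case: (OP n).
apply: lee_nneseries => [n _ _|n _]; first by rewrite lee_fin open_mass_ge0.
by case: (OP n).
Qed.

HB.instance Definition _ := isOuterMeasure.Build R (pointed_copy X0) outer_mass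
  outer_mass0 outer_mass_ge0 outer_mass_homo outer_mass_sigma.

(** A function [f] nearly optimal below [V :&: O] leaves room in [V] for any
    function supported on the open set where [f < e], which contains the part
    of [V] outside [O]. *)
Lemma open_caratheodory (O : set X) : open O ->
  caratheodory_measurable outer_mass (O : set (pointed_copy X0)).
Proof.
move=> oO; apply: le_caratheodory_measurable => A /=.
have fin B : outer_mass B \is a fin_num by [].
apply: le_outer_mass => V oV AV.
suff key f e : below (V `&` O) f -> 0 < e ->
    I f + fine (outer_mass (A `&` ~` O)) <= open_mass V + e.
  apply/ler_addgt0Pr => e e0.
  have h1 := outer_mass_le (openI oV oO) (fun x (p : (A `&` O) x) => conj (AV x p.1) p.2).
  apply: le_trans (_ : open_mass (V `&` O) + fine (outer_mass (A `&` ~` O)) <= _).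
    by rewrite lerD2r -lee_fin.
  rewrite -lerBrDr; apply: open_mass_le => f bf; rewrite lerBrDr.
  exact: key.
move=> bf e0; have [cf f01 f0] := bf.
pose W := V `&` [set x | f x < e].
have oW : open W by apply: openI => //; exact: open_cut.
have AW : A `&` ~` O `<=` W.
  by move=> x [Ax nOx]; split; [exact: AV|rewrite /= f0// => -[]].
have bfT : below setT f by split => // x /(_ Logic.I).
have ce := excess bfT e0; set g := (fun x => _) in ce.
apply: (@le_trans _ _ (I f + open_mass W)).
  by rewrite lerD2l -lee_fin; exact: outer_mass_le.
rewrite addrC -lerBrDr; apply: open_mass_le => h [ch h01 h0].
have := @le_open_mass V (g + h); rewrite I_add// => Igh.
have bgh : below V (g + h).
  split; first exact: (fa_add ctA).
  - move=> x; rewrite fctE /g; have /andP[a0 a1] := f01 x; have /andP[b0 b1] := h01 x.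
    have [Wx|/h0 ->] := pselect (W x).
      by rewrite max_l ?add0r ?b0// subr_le0; case: Wx => _ /ltW.
    by rewrite addr0 le_max lexx /= ge_max ler01; lra.
  - move=> x nVx; rewrite fctE h0 => [|[]//]; rewrite addr0 /g f0 => [|[]//].
    by rewrite max_l// sub0r oppr_le0 ltW.
have Ig : I f - e <= I g.
  rewrite -I_subc//; apply: I_mono => //.
    by apply: (fa_sub ctA) => //; exact: (fa_cst ctA).
  by move=> x; rewrite !fctE /g le_max lexx orbT.
have := Igh bgh; lra.
Qed.

Lemma borel_caratheodory (A : set T) : measurable A ->
  caratheodory_measurable outer_mass A.
Proof.
suff h : <<s @open X >> `<=` caratheodory_measurable outer_mass by exact: h.
apply: smallest_sub; last by move=> O; exact: open_caratheodory.
split.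
- exact: caratheodory_measurable_set0.
- by move=> B mB; rewrite setTD; exact: caratheodory_measurable_setC.
- by move=> B mB; exact: caratheodory_measurable_bigcup.
Qed.

Definition riesz_measure (A : set T) : \bar R := outer_mass A.

Let riesz0 : riesz_measure set0 = 0%E. Proof. exact: outer_mass0. Qed.
Let riesz_ge0 A : (0 <= riesz_measure A)%E. Proof. exact: outer_mass_ge0. Qed.
Let riesz_sigma : semi_sigma_additive riesz_measure.
Proof.
move=> A mA tA mUA; apply: caratheodory_measure_sigma_additive => //.
  by move=> n; exact: borel_caratheodory.
exact: borel_caratheodory.
Qed.

HB.instance Definition _ := isMeasure.Build _ T R riesz_measure riesz0 riesz_ge0 riesz_sigma.

Let rieszT : riesz_measure setT = 1%E.
Proof. by rewrite /riesz_measure outer_mass_open ?open_massT//; exact: openT. Qed.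

HB.instance Definition _ := Measure_isProbability.Build _ T R riesz_measure rieszT.

Let riesz_prob : probability T R := riesz_measure.

(** The function [N * f] is the sum of its slices between consecutive integers;
    the slice above [k] lies below the indicator of the set where [N * f > k],
    whose mass dominates its integral. *)
Lemma riesz_le (f : X -> R) : cts_real f -> (forall x, 0 <= f x <= 1) ->
  I f <= mean_mu riesz_prob f.
Proof.
move=> cf f01; apply/ler_addgt0Pr => e e0.
have [n nP] : exists n : nat, 1 <= e * n.+1%:R.
  by exists (Num.truncn e^-1); rewrite -ler_pdivrMl// mulr1 ltW// truncnS_gt.
pose N := n.+1; pose t x := N%:R * f x.
have ct : cts_real t by move=> x; apply: cvgMr; exact: cf.
pose pos (k : nat) x := Num.max 0 (t x - k%:R).
pose g (k : nat) x := Num.min 1 (pos k x).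
have cg k : cts_real (g k).
  apply: continuous_minr => [x|]; first exact: cvg_cst.
  have -> : pos k = (fun x => (0 + (t x - k%:R) + `|0 - (t x - k%:R)|) / 2).
    by apply/funext => x; rewrite /pos maxr_absE.
  move=> x; have h : (fun x => t x - k%:R) y @[y --> x] --> t x - k%:R.
    by apply: cvgB; [exact: ct|exact: cvg_cst].
  apply: cvgMl; apply: cvgD; first by apply: cvgD => //; exact: cvg_cst.
  by apply: cvg_norm; apply: cvgB => //; exact: cvg_cst.
have t0 x : 0 <= t x <= N%:R.
  by have /andP[f0 f1] := f01 x; rewrite /t mulr_ge0//= ler_piMr.
pose L (k : nat) : set X := [set x | k%:R < t x].
have oL k : open (L k).
  have -> : L k = t @^-1` [set y | k%:R < y] by [].
  by move/continuousP : ct; apply; exact: open_gt.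
have mL k : measurable (L k : set T) by exact: sub_gen_smallest.
have bg k : below (L k) (g k).
  split => // x.
    by rewrite /g /pos le_min ler01 ge_min lexx /= le_max lexx.
  move=> /negP; rewrite -leNgt => tk.
  by rewrite /g /pos max_l ?min_r// subr_le0.
have sumg m x : \sum_(0 <= k < m) g k x = Num.min (t x) m%:R.
  elim: m => [|m IH].
    by rewrite big_geq// min_r//; case/andP: (t0 x).
  rewrite big_nat_recr//= IH /g /pos -natr1.
  rewrite /Num.min /Num.max; have /andP[h _] := t0 x.
  by do !case: ifPn; rewrite -?leNgt; lra.
have sumL m x : \sum_(0 <= k < m) (\1_(L k) x : R) <= Num.min (t x + 1) m%:R.
  elim: m => [|m IH].
    by rewrite big_geq// le_min lexx; case/andP: (t0 x) => h _; rewrite addr_ge0.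
  have -> : \sum_(0 <= k < m.+1) (\1_(L k) x : R) =
      \sum_(0 <= k < m) (\1_(L k) x : R) + (x \in L m)%:R.
    by rewrite big_nat_recr//= indicE.
  move: IH; rewrite !le_min -[m.+1%:R]natr1 => /andP[IH1 IH2].
  have [/set_mem h|h] := boolP (x \in L m); last by rewrite addr0; apply/andP; split; lra.
  by have h' : m%:R < t x := h; rewrite mulr1n; apply/andP; split; lra.
have Isum m : I (\sum_(0 <= k < m) g k) = \sum_(0 <= k < m) I (g k).
  have csum j : cts_real (\sum_(0 <= k < j) g k).
    elim: j => [|j IH]; first by rewrite big_geq//; exact: (fa_cst ctA 0).
    by rewrite big_nat_recr//=; exact: (fa_add ctA).
  elim: m => [|m IH]; first by rewrite !big_geq//; exact: (I_cst 0).
  by rewrite !big_nat_recr//= I_add// IH.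
have bmA := @bounded_measurable_algebra R _ T.
have ind k : bounded_measurable (\1_(L k) : T -> R).
  split; first exact: measurable_indic.
  by exists 1 => x; rewrite indicE ger0_norm//; case: (_ \in _).
have mind k : mean_mu riesz_prob \1_(L k) = open_mass (L k).
  rewrite /mean_mu /Rintegral integral_indic// setIT.
  by rewrite [X in fine X](outer_mass_open (oL k)).
have bs m : bounded_measurable (\sum_(0 <= k < m) \1_(L k) : T -> R).
  elim: m => [|m IH]; first by rewrite big_geq//; exact: (fa_cst bmA 0).
  by rewrite big_nat_recr//=; exact: (fa_add bmA).
have msum m : mean_mu riesz_prob (\sum_(0 <= k < m) \1_(L k)) = \sum_(0 <= k < m) open_mass (L k).
  elim: m => [|m IH]; first by rewrite !big_geq//; exact: (mean_mu_cst _ 0).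
  by rewrite !big_nat_recr//= mean_muD// IH mind.
have bt : bounded_measurable (t : T -> R) by exact: continuous_bounded_measurable.
have bf : bounded_measurable (f : T -> R) by exact: continuous_bounded_measurable.
have tE : t = \sum_(0 <= k < N) g k.
  apply/funext => x; rewrite fct_sumE sumg min_l//; by case/andP: (t0 x).
have It : I t = N%:R * I f.
  exact: (sm_scale ctA sI N%:R k0 cf).
have mt : mean_mu riesz_prob t = N%:R * mean_mu riesz_prob f by exact: mean_muZ.
have N0 : 0 < N%:R :> R by rewrite ltr0n.
have h1 : I t <= mean_mu riesz_prob t + 1.
  rewrite {1}tE Isum -(mean_mu_cst riesz_prob 1) -mean_muD//; last exact: (fa_cst bmA).
  apply: (@le_trans _ _ (mean_mu riesz_prob (\sum_(0 <= k < N) \1_(L k)))).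
    by rewrite msum; apply: ler_sum => k _; exact: le_open_mass.
  apply: mean_mu_le => //; first by apply: (fa_add bmA) => //; exact: (fa_cst bmA).
  move=> x; rewrite fct_sumE (le_trans (sumL N x))//.
  by rewrite ge_min lexx.
rewrite -(ler_pM2l N0) -It (le_trans h1)// mt mulrDr lerD2l mulrC//.
Qed.

(** The Riesz-Markov theorem on a compact metric space.  On an open set the
    measure is the supremum of the functional over the functions below the
    indicator; regularity is built into the outer measure. *)
Lemma riesz_markov : exists mu : probability T R,
  (forall f, cts_real f -> mean_mu mu f = I f) /\
  (forall O, open O -> mu O = (open_mass O)%:E).
Proof.
exists riesz_prob; split; last by move=> O oO; exact: outer_mass_open.
have bmA := @bounded_measurable_algebra R _ T.
have itv f : cts_real f -> (forall x, 0 <= f x <= 1) -> mean_mu riesz_prob f = I f.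
  move=> cf f01; apply/eqP; rewrite eq_le riesz_le// andbT.
  have c1 : cts_real ((-1) *: f + cst 1) by apply: (fa_lin ctA) => //; exact: (fa_cst ctA).
  have bf : bounded_measurable (f : T -> R) by exact: continuous_bounded_measurable.
  have := riesz_le c1; rewrite I_lin ?I_cst//; last exact: (fa_cst ctA).
  rewrite mean_mu_lin ?mean_mu_cst//; last exact: (fa_cst bmA).
  have h x : 0 <= ((-1) *: f + cst 1) x <= 1.
    by have := f01 x; rewrite !fctE /GRing.scale/=; lra.
  by move=> /(_ h); lra.
move=> f cf; have [M0 fM0] := fa_bnd ctA cf; pose M := `|M0| + 1.
have M1 : 0 < M by rewrite ltr_pwDr.
have M2 : M != 0 by rewrite gt_eqF.
pose g := (2 * M)^-1 *: f + cst 2^-1.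
have cg : cts_real g by apply: (fa_lin ctA) => //; exact: (fa_cst ctA).
have bf : bounded_measurable (f : T -> R) by exact: continuous_bounded_measurable.
have := itv g cg; rewrite I_lin ?I_cst//; last exact: (fa_cst ctA).
rewrite mean_mu_lin ?mean_mu_cst//; last exact: (fa_cst bmA).
have h x : 0 <= g x <= 1.
  have : `|f x| <= M by rewrite (le_trans (fM0 x))// (le_trans (ler_norm _))// lerDl.
  rewrite /g !fctE /GRing.scale/= ler_norml => /andP[a1 a2].
  have -> : (2 * M)^-1 * f x + 2^-1 = (f x + M) / (2 * M) by field.
  by rewrite ler_pdivlMr ?mulr_gt0// ler_pdivrMr ?mulr_gt0//; lra.
move=> /(_ h) /addIr /mulfI; apply.
by rewrite invr_eq0 mulf_neq0.
Qed.

End RieszMarkov.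

(** * Invariant limit measures *)

Section LimitMeasure.
Context {R : realType} {G : groupType} {X : metricType R}.
Context (a : cts_action G X) (d : nat -> nat) (sigma : forall i, G -> 'S_(d i)).
Hypotheses (cX : compact [set: X]) (X0 : [set: X] !=set0).
Hypothesis dy : d i @[i --> \oo] --> \oo.
Local Notation tr := (translate a).
Local Notation T := (borel X0).

(** Intervals are compact. *)
Lemma ultra_bounded_cvg (Z : Type) (F : set_system Z) (h : Z -> R) (M : R) :
  UltraFilter F -> (\forall z \near F, `|h z| <= M) -> exists l : R, h @ F --> l.
Proof.
move=> UF hM; have /(_ (h @ F)) := @segment_compact R (- M) M.
case; first by apply: filterS hM => z; rewrite /= in_itv/= ler_norml.
move=> l [_ hl]; exists l => B Bl; have [//|FnB] := in_ultra_setVsetC (h @^-1` B) UF.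
by have [y [nBy By]] := hl (~` B) B FnB Bl.
Qed.

Context {Y : nat -> Type} (F : set_system {i & Y i}) {UF : UltraFilter F}.
Let FF : Filter F := @filter_filter _ _ (@ultra_proper _ _ UF).
Variable U : forall i, Y i -> (X -> R) -> 'I_(d i) -> R.
Hypothesis sU : \forall z \near F, state_map (@cts_real R X) (U (projT2 z)).
Hypothesis eU : forall f, cts_real f -> equivariant a sigma F U f.
Hypothesis big : projT1 z @[z --> F] --> \oo.

Let ctA := @cts_real_algebra R X cX.

Lemma d_near : \forall z \near F, (0 < d (projT1 z))%N.
Proof.
have d0 : \forall i \near \oo, (0 < d i)%N.
  by have /(_ [set n | (0 < n)%N]) := dy; apply; exists 1%N.
exact: (big d0).
Qed.

(** Along an ultrafilter the means converge, to a positive unital functional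
    which is invariant because the mean over the coordinates is invariant under
    permutations. *)
Lemma limit_invariant_measure : exists mu : invariant_measure R a,
  forall f, cts_real f -> mean (U (projT2 z) f) @[z --> F] --> mean_mu mu f.
Proof.
have PF := @ultra_proper _ _ UF.
have /choice[I IP] : forall f : X -> R, exists l : R, cts_real f ->
    mean (U (projT2 z) f) @[z --> F] --> l.
  move=> f; have [cf|ncf] := pselect (cts_real f); last by exists 0.
  have [M0 fM0] := fa_bnd ctA cf; pose M := `|M0|.
  have fM x : `|f x| <= M by rewrite (le_trans (fM0 x))// ler_norm.
  have [|l hl] := @ultra_bounded_cvg _ F (fun z => mean (U (projT2 z) f)) M UF.
    apply: filterS sU => z sz; apply: (le_trans (mean_norm _)).
    apply: le_trans (mean_cst_le (normr_ge0 M0)); apply: mean_le => k.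
    exact: (sm_bnd ctA sz k cf).
  by exists l.
have sI : state_map (@cts_real R X) (fun f (_ : 'I_1) => I f).
  split.
  - move=> _; have c1 : cts_real (cst 1 : X -> R) by exact: (fa_cst ctA).
    apply: (cvg_unique _ (IP _ c1)) => //; apply: cvg_near_cst.
    apply: filterS2 sU d_near => z sz dz; rewrite -[RHS](mean_cst 1 dz).
    by congr mean; apply/funext => k; rewrite (sm_one sz).
  - move=> c f g _ cf cg; have cfg := fa_lin ctA c cf cg.
    apply: (cvg_unique _ (IP _ cfg)) => //.
    apply: cvg_trans (cvgD (cvgMr (IP _ cf)) (IP _ cg)).
    apply: near_eq_cvg; apply: filterS sU => z sz.
    transitivity (c * mean (U (projT2 z) f) + mean (U (projT2 z) g)); first by [].
    rewrite -meanZ -meanD; congr mean; apply/funext => k.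
    by rewrite (sm_lin sz).
  - move=> f g _ cf cg fg; rewrite -subr_ge0.
    apply: (cvgr_to_ge (cvgB (IP _ cg) (IP _ cf))).
    suff h : \forall z \near F, 0 <= mean (U (projT2 z) g) - mean (U (projT2 z) f) by [].
    by apply: filterS sU => z sz; rewrite subr_ge0; apply: mean_le => k; exact: (sm_mono sz).
have Itr s f : cts_real f -> I (tr s f) = I f.
  move=> cf; have ctf : cts_real (tr s f) by exact: cts_real_translate.
  apply/eqP; rewrite -subr_eq0 -normr_le0.
  have h : `|mean (U (projT2 z) (tr s f)) - mean (U (projT2 z) f)| @[z --> F] -->
      `|I (tr s f) - I f|.
    by apply: cvg_norm; apply: cvgB; exact: IP.
  apply/ler_addgt0Pr => e e0; rewrite add0r; apply: (cvgr_to_le h).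
  apply: filterS (eU cf s e0) => z; apply: le_trans.
  rewrite -(mean_perm (sigma (projT1 z) s) (U (projT2 z) (tr s f))).
  rewrite (_ : _ - _ = mean (fun k => U (projT2 z) (tr s f) (sigma (projT1 z) s k) - U (projT2 z) f k)).
    exact: mean_norm.
  rewrite -[mean (U _ f)]mul1r -mulNr -meanZ -meanD; congr mean.
  by apply/funext => k; rewrite mulN1r.
have [mu [muI muO]] := riesz_markov X0 cX sI.
have massinv s (O : set X) : open O -> open_mass I (a s @^-1` O) = open_mass I O.
  have le s' O' : open_mass I O' <= open_mass I (a s' @^-1` O').
    apply: (open_mass_le cX sI) => f [cf f01 f0]; rewrite -(Itr s'^-1%g f cf).
    apply: (le_open_mass cX sI); split.
    - exact: cts_real_translate.
    - by move=> x; exact: f01.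
    - move=> x nO; rewrite /translate; apply: f0.
      by have -> : ((s'^-1)^-1 = s' :> G)%g by exact: invgK.
  move=> oO; apply/eqP; rewrite eq_le le andbT.
  apply: le_trans (le s^-1%g _) _.
  have -> // : a s^-1%g @^-1` (a s @^-1` O) = O.
  have ss : (s * s^-1 = 1 :> G)%g by exact: mulgV.
  by apply/seteqP; split => x /=; rewrite -Defs.actM ss Defs.act1.
have inv (s : G) (B : set T) : measurable B -> mu (a s @^-1` B) = mu B.
  have ms : measurable_fun setT (a s : T -> T).
    apply: (@measurability _ _ T T setT (a s) (@open X : set (set (pointed_copy X0)))) => //.
    move=> _ [B' oB <-]; rewrite setTI; apply: sub_gen_smallest => /=.
    by move/continuousP : (@act_continuous _ _ a s); apply.
  move=> mB; apply: (@g_sigma_algebra_measure_unique _ R T (@open X) _ (fun=> setT) _ _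
    (pushforward mu (a s : T -> T)) mu) => //.
  - by move=> O oO; exact: sub_gen_smallest.
  - by move=> _; exact: openT.
  - by apply/seteqP; split => // x _; exists 0%N.
  - by move=> A B' oA oB'; exact: openI.
  - move=> O oO; have oaO : open (a s @^-1` O).
      by move/continuousP : (@act_continuous _ _ a s); apply.
    by apply: (etrans (muO _ oaO)); rewrite massinv//; exact/esym/muO.
  - move=> _; have h : (mu setT < +oo)%E by rewrite probability_setT ltry.
    exact: h.
exists (@InvariantMeasure R G X a X0 mu inv) => f cf.
by have := IP f cf; rewrite -muI.
Qed.

End LimitMeasure.

(** * Couplings and smearing *)

Section Coupling.
Context {R : realType}.

Lemma near_list (Z K : Type) (F : set_system Z) (ks : seq K) (P : K -> Z -> Prop) :
  Filter F -> (forall k, List.In k ks -> \forall z \near F, P k z) ->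
  \forall z \near F, forall k, List.In k ks -> P k z.
Proof.
move=> FF; elim: ks => [|k ks IH] h; first by apply: nearW => z k [].
have h1 := h k (or_introl erefl).
have h2 : \forall z \near F, forall k', List.In k' ks -> P k' z.
  by apply: IH => k' hk'; apply: h; right.
by apply: filterS2 h1 h2 => z Pz IHz k' [<-|/IHz].
Qed.

(** Microstates of a first kind (along [F]) are coupled with microstates of a
    second kind as soon as finitely many defects can be made small
    simultaneously; along the resulting filter all defects vanish. *)
Lemma coupling (Y Y' : nat -> Type) (F : set_system {i & Y i}) (K : Type)
    (q : K -> {i & (Y i * Y' i)%type} -> R) (S : set {i & (Y i * Y' i)%type}) :
  Filter F ->
  (forall (ks : seq K) e, 0 < e -> \forall z \near F, exists y' : Y' (projT1 z),
    let w := existT (fun i => (Y i * Y' i)%type) (projT1 z) (projT2 z, y') in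
    S w /\ forall k, List.In k ks -> q k w <= e) ->
  exists GG : set_system {i & (Y i * Y' i)%type}, [/\ Filter GG, GG S,
    (forall A, F A -> GG [set w | A (existT Y (projT1 w) (projT2 w).1)]),
    (forall k, vanishes GG (q k)) &
    (forall B, GG B -> exists2 A, F A & forall i y, A (existT _ i y) ->
      exists y', B (existT _ i (y, y')))].
Proof.
move=> FF h.
pose base (t : set {i & Y i} * seq K * R) : set {i & (Y i * Y' i)%type} :=
  [set w | [/\ t.1.1 (existT Y (projT1 w) (projT2 w).1), S w &
    forall k, List.In k t.1.2 -> q k w <= t.2]].
pose D := [set t : set {i & Y i} * seq K * R | F t.1.1 /\ 0 < t.2].
exists (filter_from D base); split.
- apply: filter_from_filter.
    by exists (setT, [::], 1) => /=; split => //; exact: filterT.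
  move=> [[A ks] e] [[A' ks'] e'] [/= FA e0] [/= FA' e'0].
  exists (A `&` A', (ks ++ ks')%SEQ, Num.min e e').
    by split; [exact: filterI|rewrite /= lt_min e0].
  move=> w [/= [Aw A'w] Sw qw]; split; split => //= k ik.
    by have := qw k (proj2 (List.in_app_iff _ _ _) (or_introl ik)); rewrite le_min => /andP[].
  by have := qw k (proj2 (List.in_app_iff _ _ _) (or_intror ik)); rewrite le_min => /andP[].
- by exists (setT, [::], 1) => [|w []//]; split => //=; exact: filterT.
- by move=> A FA; exists (A, [::], 1) => [|w []//]; split.
- move=> k e e0; exists (setT, [:: k], e) => [|w [_ _ /= qw]].
    by split => //=; exact: filterT.
  by apply: qw; left.
- move=> B [[[A ks] e] [/= FA e0] baseB].
  exists (A `&` [set z | exists y' : Y' (projT1 z),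
    let w := existT (fun i => (Y i * Y' i)%type) (projT1 z) (projT2 z, y') in
    S w /\ forall k, List.In k ks -> q k w <= e]).
    by apply: filterI => //; exact: h.
  by move=> i y [Ay [y' [Sw qw]]]; exists y'; apply: baseB; split.
Qed.

End Coupling.

Section Smear.
Context {R : realType} {disp : measure_display} {T : measurableType disp}.
Context (mu : probability T R).
Local Notation bm := (@bounded_measurable R disp T).
Local Notation mm := (mean_mu mu).
Let bmA : function_algebra bm := bounded_measurable_algebra.

(** The average of [f] with respect to the density proportional to [h]; the
    value for a null density only has to be a state. *)
Definition weighted (h f : T -> R) : R :=
  if mm h == 0 then mm f else mm (h * f) / mm h.

Lemma weighted_ae h f g : bm h -> bm f -> bm g -> (\forall x \ae mu, f x = g x) ->
  weighted h f = weighted h g.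
Proof.
move=> bh bf bg fg; rewrite /weighted (eq_mean_mu_ae bf bg fg); case: ifP => // _.
congr (_ / _); apply: eq_mean_mu_ae; [exact: (fa_mul bmA)|exact: (fa_mul bmA)|].
by apply: filterS fg => x fg; rewrite !fctE fg.
Qed.

Section OneWeight.
Context (h : T -> R) (bh : bm h) (h0 : forall x, 0 <= h x).

Lemma weighted_lin (c : R) f g : bm f -> bm g ->
  weighted h (c *: f + g) = c * weighted h f + weighted h g.
Proof.
move=> bf bg; rewrite /weighted; case: ifP => _; first exact: mean_mu_lin.
have -> : h * (c *: f + g) = c *: (h * f) + h * g.
  by apply/funext => x; rewrite !fctE /GRing.scale/=; ring.
by rewrite mean_mu_lin; [ring|exact: (fa_mul bmA)|exact: (fa_mul bmA)].
Qed.

Lemma weighted_mono f g : bm f -> bm g -> (forall x, f x <= g x) ->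
  weighted h f <= weighted h g.
Proof.
move=> bf bg fg; rewrite /weighted; case: ifP => _; first exact: mean_mu_le.
rewrite ler_wpM2r ?invr_ge0 ?mean_mu_ge0//; apply: mean_mu_le.
- exact: (fa_mul bmA).
- exact: (fa_mul bmA).
- by move=> x; rewrite !fctE ler_wpM2l.
Qed.

Lemma weighted_cst c : weighted h (cst c) = c.
Proof.
rewrite /weighted; case: ifPn => h1; first exact: mean_mu_cst.
have -> : h * cst c = c *: h by apply/funext => x; rewrite !fctE /GRing.scale/= mulrC.
by rewrite mean_muZ// mulfK.
Qed.

Lemma weighted_abs f : bm f -> `|weighted h f| <= weighted h (absf f).
Proof.
move=> bf; have ba := fa_abs bmA bf; have b0 := fa_cst bmA 0.
have bn : bm ((-1) *: f + cst 0) by exact: (fa_lin bmA).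
rewrite ler_norml; apply/andP; split.
  rewrite lerNl -[leLHS]mulN1r -[leLHS]addr0 -(weighted_cst 0) -weighted_lin//.
  apply: weighted_mono => // x; rewrite /absf !fctE /GRing.scale/= addr0 mulN1r -normrN.
  exact: ler_norm.
by apply: weighted_mono => // x; exact: ler_norm.
Qed.

Lemma weighted_bnd f M : bm f -> (forall x, `|f x| <= M) -> `|weighted h f| <= M.
Proof.
move=> bf fM; apply: (le_trans (weighted_abs bf)); rewrite -[M]weighted_cst.
by apply: weighted_mono => //; [exact: (fa_abs bmA)|exact: (fa_cst bmA)].
Qed.

Lemma weightedE f : bm f -> mm h * weighted h f = mm (h * f).
Proof.
move=> bf; rewrite /weighted; case: ifPn => [/eqP h1|h1]; last first.
  by rewrite mulrC divfK.
rewrite h1 mul0r; have [M0 fM0] := bf.2; pose M := `|M0|.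
apply/esym/eqP; rewrite -normr_le0 -[leRHS](mulr0 M) -h1 -mean_muZ//.
apply: (le_trans (mean_mu_abs _ _)); first exact: (fa_mul bmA).
apply: mean_mu_le.
- by apply: (fa_abs bmA); exact: (fa_mul bmA).
- exact: (fa_scale bmA).
- move=> x; rewrite /absf !fctE /GRing.scale/= normrM mulrC (ger0_norm (h0 x)).
  by rewrite ler_wpM2r// (le_trans (fM0 x))// ler_norm.
Qed.

End OneWeight.

Context {V : set (T -> R)} (algV : function_algebra V) (Vbm : V `<=` bm).
Context {d : nat} {W : (T -> R) -> 'I_d -> R} (sW : state_map V W).
Context {J : finType} (h : J -> T -> R).
Hypotheses (Vh : forall j, V (h j)) (h0 : forall j x, 0 <= h j x)
  (h1 : forall x, \sum_j h j x = 1).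

(** A state [W _ k] on [V] is spread into a convex combination of averages
    that are absolutely continuous with respect to [mu]. *)
Definition smear (f : T -> R) (k : 'I_d) : R :=
  \sum_j W (h j) k * weighted (h j) f.

Let bh j : bm (h j). Proof. exact/Vbm/Vh. Qed.

Let V_sum (g : J -> T -> R) : (forall j, V (g j)) -> V (\sum_j g j).
Proof.
move=> Vg; apply: (@big_ind _ V) => //.
  exact: (fa_cst algV 0).
by move=> u v Vu Vv; exact: (fa_add algV).
Qed.

Let W_sum (g : J -> T -> R) k : (forall j, V (g j)) ->
  W (\sum_j g j) k = \sum_j W (g j) k.
Proof.
move=> Vg; suff [] : V (\sum_j g j) /\ W (\sum_j g j) k = \sum_j W (g j) k by [].
apply: (@big_ind2 _ _ (fun f r => V f /\ W f k = r)).
- by split; [exact: (fa_cst algV 0)|exact: (sm_zero algV sW k)].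
- move=> f r g' r' [Vf <-] [Vg' <-]; split; first exact: (fa_add algV).
  exact: (sm_add sW).
- by move=> j _.
Qed.

Let Wh0 j k : 0 <= W (h j) k. Proof. exact: (sm_ge0 algV sW). Qed.

Let Wh1 k : \sum_j W (h j) k = 1.
Proof.
rewrite -W_sum// -(sm_one sW k); congr (W _ k).
by apply/funext => x; rewrite fct_sumE h1.
Qed.

Lemma smear_state : state_map bm smear.
Proof.
split.
- move=> k; rewrite -[RHS](Wh1 k); apply: eq_bigr => j _.
  by rewrite (weighted_cst (bh j)) mulr1.
- move=> c f g k bf bg; rewrite /smear mulr_sumr -big_split/=; apply: eq_bigr => j _.
  by rewrite weighted_lin//; ring.
- move=> f g k bf bg fg; apply: ler_sum => j _; rewrite ler_wpM2l//.
  exact: weighted_mono.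
Qed.

Lemma smear_ae f g : bm f -> bm g -> (\forall x \ae mu, f x = g x) ->
  smear f = smear g.
Proof.
move=> bf bg fg; apply/funext => k; apply: eq_bigr => j _; congr (_ * _).
exact: weighted_ae.
Qed.

(** The only way in which the means of [W] enter the estimates for [smear]. *)
Definition weight_error : R := \sum_j `|mean (W (h j)) - mm (h j)|.

Let mean_weights (e : J -> R) M : (forall j, 0 <= e j <= M) ->
  \sum_j mean (W (h j)) * e j <= \sum_j mm (h j) * e j + M * weight_error.
Proof.
move=> eM; rewrite /weight_error mulr_sumr -big_split/=; apply: ler_sum => j _.
have /andP[e0 e1] := eM j; rewrite -lerBlDl -mulrBl mulrC.
by rewrite (le_trans (ler_norm _))// normrM (ger0_norm e0) ler_wpM2r.
Qed.

(** With the exact weights [mu(h_j)] the averages would integrate to [mu(g)]. *)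
Lemma smear_mean g M : bm g -> (forall x, `|g x| <= M) ->
  `|mean (smear g) - mm g| <= M * weight_error.
Proof.
move=> bg gM.
have -> : mean (smear g) = \sum_j mean (W (h j)) * weighted (h j) g.
  rewrite /smear mean_sum; apply: eq_bigr => j _.
  by rewrite mulrC -meanZ; congr mean; apply/funext => k; rewrite mulrC.
have -> : mm g = \sum_j mm (h j) * weighted (h j) g.
  transitivity (mm (\sum_j h j * g)).
    congr (mean_mu _ _); apply/funext => x; rewrite fct_sumE.
    by under eq_bigr do rewrite fctE; rewrite -mulr_suml h1 mul1r.
  transitivity (\sum_j mm (h j * g)); last by apply: eq_bigr => j _; rewrite weightedE.
  suff [] : bm (\sum_j h j * g) /\ mm (\sum_j h j * g) = \sum_j mm (h j * g) by [].
  apply: (@big_ind2 _ _ (fun f r => bm f /\ mm f = r)).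
  - by split; [exact: (fa_cst bmA 0)|exact: (mean_mu_cst mu 0)].
  - move=> f r g' r' [Vf <-] [Vg' <-]; split; first exact: (fa_add bmA).
    exact: mean_muD.
  - by move=> j _; split => //; exact: (fa_mul bmA).
rewrite -sumrB (le_trans (ler_norm_sum _ _ _))// mulr_sumr; apply: ler_sum => j _.
by rewrite -mulrBl normrM mulrC ler_wpM2r//; exact: weighted_bnd.
Qed.

Context (f : T -> R) (c : J -> R) (eta M : R) (Vf : V f).
Hypotheses (fM : forall x, `|f x| <= M) (cM : forall j, `|c j| <= M)
  (hc : forall x, \sum_j h j x * `|f x - c j| <= eta).

Let bf : bm f. Proof. exact: Vbm. Qed.
Let dev j : T -> R := absf (f - cst (c j)).
Let bdev j : bm (dev j). Proof. exact: (fa_absB bmA). Qed.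
Let devM j x : `|dev j x| <= 2 * M.
Proof.
rewrite /dev /absf !fctE normr_id (le_trans (ler_normB _ _))//.
by rewrite mulr_natl mulr2n lerD.
Qed.

Let dispersion k := \sum_j W (h j) k * weighted (h j) (dev j).

Let dispersion_mean : mean dispersion <= eta + 2 * M * weight_error.
Proof.
have -> : mean dispersion = \sum_j mean (W (h j)) * weighted (h j) (dev j).
  rewrite /dispersion mean_sum; apply: eq_bigr => j _.
  by rewrite mulrC -meanZ; congr mean; apply/funext => k; rewrite mulrC.
have e0 j : 0 <= weighted (h j) (dev j) <= 2 * M.
  have w0 : 0 <= weighted (h j) (dev j).
    rewrite -(weighted_cst (bh j) 0); apply: weighted_mono => //.
      exact: (fa_cst bmA).
    by move=> x; exact: normr_ge0.
  by rewrite w0 -[X in X <= _](ger0_norm w0); exact: weighted_bnd.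
apply: (le_trans (mean_weights e0)); rewrite lerD2r.
under eq_bigr do rewrite weightedE//.
suff [bs <-] : bm (\sum_j h j * dev j) /\ mm (\sum_j h j * dev j) = \sum_j mm (h j * dev j).
  rewrite -(mean_mu_cst mu eta); apply: mean_mu_le => //; first exact: (fa_cst bmA).
  by move=> x; rewrite fct_sumE (le_trans _ (hc x)).
apply: (@big_ind2 _ _ (fun f r => bm f /\ mm f = r)).
- by split; [exact: (fa_cst bmA 0)|exact: (mean_mu_cst mu 0)].
- move=> g r g' r' [Vg <-] [Vg' <-]; split; first exact: (fa_add bmA).
  exact: mean_muD.
- by move=> j _; split => //; exact: (fa_mul bmA).
Qed.

Let err_ge0 : 0 <= 2 * eta + 2 * M * weight_error.
Proof.
have z : T := point.
have M0 : 0 <= M by exact: le_trans (normr_ge0 _) (fM z).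
rewrite addr_ge0 ?mulr_ge0//.
  by apply: le_trans (hc z); apply: sumr_ge0 => j _; rewrite mulr_ge0.
by apply: sumr_ge0 => j _; exact: normr_ge0.
Qed.

(** Both states give [f] the values [c j] with the weights [W (h j)], up to the
    mean deviation of [f] from [c j] on [h j]. *)
Lemma smear_close :
  mean (fun k => `|smear f k - W f k|) <= 2 * eta + 2 * M * weight_error.
Proof.
have [d0|d0] := posnP d.
  by rewrite mean_dim0// err_ge0.
have step k : `|smear f k - W f k| <= dispersion k + eta.
  have -> : smear f k - W f k =
      \sum_j W (h j) k * (weighted (h j) f - c j) - W (\sum_j h j * (f - cst (c j))) k.
    have Vhf j : V (h j * (f - cst (c j))).
      by apply: (fa_mul algV) => //; apply: (fa_sub algV) => //; exact: (fa_cst algV).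
    rewrite W_sum// -sumrB.
    have -> : W f k = \sum_j W (h j * f) k.
      rewrite -W_sum; last by move=> j; exact: (fa_mul algV).
      congr (W _ k); apply/funext => x; rewrite fct_sumE.
      by under eq_bigr do rewrite fctE; rewrite -mulr_suml h1 mul1r.
    rewrite /smear -sumrB; apply: eq_bigr => j _.
    have -> : h j * (f - cst (c j)) = (- c j) *: h j + h j * f.
      by apply/funext => x; rewrite !fctE /GRing.scale/=; ring.
    rewrite (sm_lin sW)//; last exact: (fa_mul algV).
    ring.
  rewrite (le_trans (ler_normB _ _))// lerD//.
    rewrite (le_trans (ler_norm_sum _ _ _))//; apply: ler_sum => j _.
    rewrite normrM ger0_norm// ler_wpM2l//.
    have b2 : bm (f - cst (c j)) by apply: (fa_sub bmA) => //; exact: (fa_cst bmA).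
    apply: le_trans (weighted_abs (bh j) (h0 j) b2).
    have -> : f - cst (c j) = 1 *: f + cst (- c j).
      by apply/funext => x; rewrite !fctE /GRing.scale/= mul1r.
    by rewrite weighted_lin ?weighted_cst ?mul1r//; exact: (fa_cst bmA).
  have Vs : V (\sum_j h j * (f - cst (c j))).
    apply: V_sum => j; apply: (fa_mul algV) => //.
    by apply: (fa_sub algV) => //; exact: (fa_cst algV).
  apply: (sm_bnd algV sW k Vs) => x.
  rewrite fct_sumE (le_trans (ler_norm_sum _ _ _))// (le_trans _ (hc x))//.
  by apply: ler_sum => j _; rewrite !fctE normrM ger0_norm.
apply: (@le_trans _ _ (mean (fun k => dispersion k + eta))); first exact: mean_le.
rewrite meanD mean_cst//; have := dispersion_mean; lra.
Qed.

(** Centering at [W f], the deviation of [f] splits into that from [c j] and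
    that of [c j] from [W f]; the latter is controlled by the spread of [W]. *)
Lemma smear_spread :
  spread smear f <= 2 * spread W f + (4 * eta + 4 * M * weight_error).
Proof.
have [d0|d0] := posnP d.
  rewrite [leLHS]mean_dim0// addr_ge0//.
    by rewrite mulr_ge0// (spread_ge0 algV sW).
  by have := err_ge0; lra.
apply: (le_trans (spread_center bmA smear_state (W f) bf)).
have step k : smear (absf (f - cst (W f k))) k <=
    (dispersion k + eta) + W (absf (f - cst (W f k))) k.
  have Vd : V (absf (f - cst (W f k))) by exact: (fa_absB algV).
  apply: (@le_trans _ _ (dispersion k + \sum_j W (h j) k * `|c j - W f k|)).
    rewrite /dispersion -big_split/=; apply: ler_sum => j _.
    rewrite -mulrDr ler_wpM2l//.
    have -> : weighted (h j) (dev j) + `|c j - W f k| =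
        weighted (h j) (1 *: dev j + cst `|c j - W f k|).
      by rewrite weighted_lin ?weighted_cst ?mul1r//; exact: (fa_cst bmA).
    apply: weighted_mono => //.
    - exact: (fa_absB bmA).
    - by apply: (fa_lin bmA) => //; exact: (fa_cst bmA).
    - move=> x; rewrite /dev /absf !fctE scale1r (le_trans _ (ler_normD _ _))//.
      by rewrite addrA subrK.
  rewrite -addrA lerD2l.
  have -> : \sum_j W (h j) k * `|c j - W f k| = W (\sum_j `|c j - W f k| *: h j) k.
    rewrite W_sum; last by move=> j; exact: (fa_scale algV).
    by apply: eq_bigr => j _; rewrite (sm_scale algV sW)// mulrC.
  rewrite -(sm_cst algV sW eta k) -(sm_add sW)//; last exact: (fa_cst algV).
  apply: (sm_mono sW).
  - by apply: V_sum => j; exact: (fa_scale algV).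
  - by apply: (fa_add algV) => //; exact: (fa_cst algV).
  - move=> x; rewrite fct_sumE /absf !fctE.
    apply: (@le_trans _ _ (\sum_j h j x * (`|f x - c j| + `|f x - W f k|))).
      apply: ler_sum => j _; rewrite [leLHS]mulrC ler_wpM2l//.
      by rewrite (distrC (f x) (c j)) (le_trans _ (ler_normD _ _))// addrA subrK.
    under eq_bigr do rewrite mulrDr.
    by rewrite big_split/= -mulr_suml h1 mul1r lerD2r.
apply: (@le_trans _ _ (2 * (mean (fun k => dispersion k + eta) + spread W f))).
  by rewrite ler_pM2l// /spread -meanD; apply: mean_le => k; exact: step.
rewrite meanD mean_cst//; have := dispersion_mean; lra.
Qed.

End Smear.

(** * Partitions of unity *)

Section PartitionsOfUnity.
Context {R : realType}.

(** Compactness gives finitely many [c j] such that the sum of the [g (c j)] is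
    positive everywhere; [w] is its inverse.  A common factor [w] keeps the
    members of the partition in any ideal that contains the [g (c j)]. *)
Lemma partition_of_unity (X : topologicalType) (g : X -> X -> R) :
  compact [set: X] -> (forall c, continuous (g c)) -> (forall c x, 0 <= g c x) ->
  (forall c, 0 < g c c) ->
  exists (J : finType) (c : J -> X) (w : X -> R),
    [/\ cts_real w, forall x, 0 <= w x & forall x, \sum_j g (c j) x * w x = 1].
Proof.
move=> cX cg g0 gpos.
have [D cov] : exists D : {fset X}, forall x, exists2 c, c \in D & 0 < g c x.
  pose FD : set_system {fset X} :=
    filter_from setT (fun D => [set D' | (D `<=` D')%fset]).
  have FFD : Filter FD.
    apply: filter_from_filter; first by exists fset0.
    move=> D D' _ _; exists (D `|` D')%fset => // E /= DE; split => /=.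
      exact: fsubset_trans (fsubsetUl _ _) DE.
    exact: fsubset_trans (fsubsetUr _ _) DE.
  have /compact_near_coveringP := cX.
  move=> /(_ _ FD (fun D x => exists2 c, c \in D & 0 < g c x) FFD)[].
    move=> x _; exists ([set y | 0 < g x y], [set D : {fset X} | x \in D]) => /=.
      split; last by exists [fset x]%fset => // D /= /fsubsetP; apply; rewrite inE.
      apply: open_nbhs_nbhs; split; last exact: gpos.
      have -> : [set y | 0 < g x y] = g x @^-1` [set y | 0 < y] by [].
      by move/continuousP : (cg x); apply; exact: open_gt.
    by move=> [y D] /= [gy xD]; exists x.
  move=> D _ /(_ D (fsubset_refl D)) h; exists D => x; exact: h.
pose s x := \sum_(c : D) g (val c) x.
have s0 x : 0 < s x.
  have [c cD gc] := cov x.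
  rewrite /s (bigD1 [` cD]%fset)//= ltr_pwDl//.
  by apply: sumr_ge0 => c' _.
have cs : continuous s.
  have -> : s = \sum_(c : D) g (val c) by apply/funext => x; rewrite fct_sumE.
  apply: (@big_ind _ (fun f : X -> R => continuous f)) => [x|f f' cf cf' x|c _].
  - exact: cvg_cst.
  - by apply: cvgD; [exact: cf|exact: cf'].
  - exact: cg.
exists D, val, (fun x => (s x)^-1); split.
- by move=> x; apply: cvgV; [rewrite gt_eqF|exact: cs].
- by move=> x; rewrite invr_ge0 ltW.
- by move=> x; rewrite -mulr_suml -/(s x) mulfV// gt_eqF.
Qed.

(** A product of bumps around [c], one for each function, vanishes where one of
    the functions is not [eta]-close to its value at [c]. *)
Lemma adapted_partition (X : topologicalType) (fs : seq (X -> R)) (eta : R) :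
  compact [set: X] -> 0 < eta -> (forall f, List.In f fs -> cts_real f) ->
  exists (J : finType) (c : J -> X) (h : J -> X -> R),
    [/\ forall j, cts_real (h j), forall j x, 0 <= h j x,
        forall x, \sum_j h j x = 1 & forall f, List.In f fs ->
          forall x, \sum_j h j x * `|f x - f (c j)| <= eta].
Proof.
move=> cX e0 cfs.
pose bump (f : X -> R) c x := Num.max 0 (eta - `|f x - f c|).
have cb f c : cts_real f -> continuous (bump f c).
  move=> cf; have -> : bump f c = (fun x => (0 + (eta - `|f x - f c|) + `|0 - (eta - `|f x - f c|)|) / 2).
    by apply/funext => x; rewrite /bump maxr_absE.
  have h : continuous (fun x => eta - `|f x - f c|).
    move=> x; apply: cvgB; first exact: cvg_cst.
    by apply: cvg_norm; apply: cvgB; [exact: cf|exact: cvg_cst].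
  move=> x; apply: cvgMl; apply: cvgD; first by apply: cvgD; [exact: cvg_cst|exact: h].
  by apply: cvg_norm; apply: cvgB; [exact: cvg_cst|exact: h].
have b0 f c x : 0 <= bump f c x by rewrite le_max lexx.
pose g c x := foldr (fun f r => bump f c x * r) 1 fs.
have [cg g0 gpos] : [/\ forall c, continuous (g c), forall c x, 0 <= g c x &
    forall c, 0 < g c c].
  split.
  - move=> c; rewrite /g {g}; elim: fs cfs => [_|f fs IH cfs] x /=; first exact: cvg_cst.
    apply: cvgM; first by apply: cb; apply: cfs; left.
    by apply: IH => f' f'fs; apply: cfs; right.
  - move=> c x; rewrite /g {g}; elim: fs {cfs} => [|f fs IH] /=; first exact: ler01.
    exact: mulr_ge0.
  - move=> c; rewrite /g {g}; elim: fs {cfs} => [|f fs IH] /=; first exact: ltr01.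
    by rewrite mulr_gt0// /bump subrr normr0 subr0 lt_max e0 orbT.
have [J [c [w [cw w0 h1]]]] := partition_of_unity cX cg g0 gpos.
exists J, c, (fun j x => g (c j) x * w x); split => //.
- by move=> j x; apply: cvgM; [exact: cg|exact: cw].
- by move=> j x; rewrite mulr_ge0.
move=> f ffs x.
apply: (@le_trans _ _ (\sum_j g (c j) x * w x * eta)); last by rewrite -mulr_suml h1 mul1r.
apply: ler_sum => j _; have [hz|hz] := eqVneq (g (c j) x) 0; first by rewrite hz !mul0r.
rewrite ler_wpM2l ?mulr_ge0// leNgt; apply/negP => fe; move/eqP: hz; apply.
suff: forall fs', List.In f fs' -> foldr (fun f r => bump f (c j) x * r) 1 fs' = 0 by exact.
elim=> [//|f' fs' IH] /= [->|/IH->]; last by rewrite mulr0.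
by rewrite /bump max_l ?mul0r// subr_le0 ltW.
Qed.

(** Refining by one function [y] with values in [-1, 1]: multiplying [N] times
    by [u] or [1 - u], where [u = (1 + y) / 2], gives Bernstein polynomials in
    [y]; the number [S] of factors [u] estimates [N * u] with the variance
    [N * u * (1 - u)] of a binomial law. *)
Lemma bernstein_refine (T : Type) (H : set (T -> R)) (y : T -> R) (J : finType)
    (h : J -> T -> R) (N : nat) :
  (forall f, H f -> H (f * y)) ->
  (forall (c : R) f g, H f -> H g -> H (c *: f + g)) ->
  (forall x, `|y x| <= 1) ->
  (forall j, H (h j)) -> (forall j x, 0 <= h j x) -> (forall x, \sum_j h j x = 1) ->
  exists (J' : finType) (h' : J' -> T -> R) (pi : J' -> J) (S : J' -> R),
    [/\ forall j, H (h' j), forall j x, 0 <= h' j x,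
        forall x (w : J -> R), \sum_j h' j x * w (pi j) = \sum_j h j x * w j,
        forall j, 0 <= S j <= N%:R &
        forall x, \sum_j h' j x * (S j - N%:R * ((1 + y x) / 2)) ^+ 2 =
          N%:R * ((1 + y x) / 2 * (1 - (1 + y x) / 2))].
Proof.
move=> Hy Hlin y1 Hh h0 h1; elim: N => [|N [J' [h' [pi [S [Hh' h'0 hpi SN var]]]]]].
  exists J, h, id, (fun=> 0); split => //.
  - by move=> j; rewrite lexx.
  - by move=> x; rewrite !mul0r big1 // => j _; rewrite subrr expr0n mulr0.
pose u x := (1 + y x) / 2.
have u01 x : 0 <= u x <= 1.
  by have := y1 x; rewrite ler_norml /u => /andP[? ?]; apply/andP; split; lra.
exists (J' * bool)%type, (fun jb x => h' jb.1 x * (if jb.2 then u x else 1 - u x)),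
  (fun jb => pi jb.1), (fun jb : J' * bool => S jb.1 + (nat_of_bool jb.2)%:R).
have sumE (x : T) (F : J' -> bool -> R) :
    \sum_(jb : J' * bool) (h' jb.1 x * (if jb.2 then u x else 1 - u x)) * F jb.1 jb.2 =
    \sum_j h' j x * (u x * F j true + (1 - u x) * F j false).
  rewrite -(pair_big xpredT xpredT (fun j (b : bool) =>
    (h' j x * (if b then u x else 1 - u x)) * F j b))/=.
  by apply: eq_bigr => j _; rewrite big_bool /=; ring.
split.
- move=> [j []] /=.
    have -> : (fun x => h' j x * u x) = 2^-1 *: (h' j * y) + (2^-1 *: h' j + (-1 *: h' j + h' j)).
      by apply/funext => x; rewrite !fctE /GRing.scale/= /u; field.
    have Hz : H (-1 *: h' j + h' j) by exact: Hlin.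
    by apply: (Hlin); [exact: Hy|exact: Hlin].
  have -> : (fun x => h' j x * (1 - u x)) = (- 2^-1) *: (h' j * y) + (2^-1 *: h' j + (-1 *: h' j + h' j)).
    by apply/funext => x; rewrite !fctE /GRing.scale/= /u; field.
  have Hz : H (-1 *: h' j + h' j) by exact: Hlin.
  by apply: (Hlin); [exact: Hy|exact: Hlin].
- move=> [j b] x /=; rewrite mulr_ge0//; have /andP[a0 a1] := u01 x.
  by case: b => //; rewrite subr_ge0.
- move=> x w; rewrite (sumE x (fun j _ => w (pi j))) -hpi; apply: eq_bigr => j _.
  by ring.
- move=> [j b] /=; have /andP[a0 a1] := SN j; rewrite -natr1.
  by case: b; rewrite /= ?mulr1n ?mulr0n; apply/andP; split; lra.
- move=> x; rewrite -/(u x).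
  rewrite (sumE x (fun j b => (S j + (nat_of_bool b)%:R - N.+1%:R * u x) ^+ 2)).
  have := var x; rewrite -/(u x) => varx.
  transitivity (\sum_j (h' j x * (S j - N%:R * u x) ^+ 2 + h' j x * (u x * (1 - u x)))).
    by apply: eq_bigr => j _; rewrite /= mulr1n mulr0n -natr1; ring.
  rewrite big_split/= varx -mulr_suml.
  have -> : \sum_j h' j x = 1.
    have := hpi x (fun=> 1); under eq_bigr do rewrite mulr1.
    by move=> ->; under eq_bigr do rewrite mulr1; rewrite h1.
  by rewrite -natr1; ring.
Qed.

(** The functions are treated one after the other; by the variance bound,
    the frequency of factors [u] estimates [u] with mean error of order
    [N^-1/2]. *)
Lemma bernstein_partition (T : Type) (H : set (T -> R)) (fs : seq (T -> R)) (eta : R) :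
  0 < eta -> H (cst 1) ->
  (forall (c : R) f g, H f -> H g -> H (c *: f + g)) ->
  (forall y f, List.In y fs -> H f -> H (f * y)) ->
  (forall y, List.In y fs -> forall x, `|y x| <= 1) ->
  exists (J : finType) (h : J -> T -> R),
    [/\ forall j, H (h j), forall j x, 0 <= h j x,
        forall x, \sum_j h j x = 1 & forall y, List.In y fs ->
        exists2 c : J -> R, forall j, `|c j| <= 1 &
          forall x, \sum_j h j x * `|y x - c j| <= eta].
Proof.
move=> e0 H1 Hlin; elim: fs => [_ _|y fs IH Hmul ybd].
  exists unit, (fun _ => cst 1); split => // x.
  by rewrite big_const card_unit /= addr0.
have [||J [h [Hh h0 h1 hfs]]] := IH.
- by move=> y' f y'fs; apply: Hmul; right.
- by move=> y' y'fs; apply: ybd; right.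
have y1 := ybd y (or_introl erefl).
(* The number of factors that makes the standard deviation small. *)
have [N N0 etaN] : exists2 N : nat, (0 < N)%N & 2 / (eta * N%:R) <= eta / 2.
  pose N := (Num.truncn (4 / eta ^+ 2)).+1; exists N => //.
  have : 4 / eta ^+ 2 < N%:R by rewrite /N truncnS_gt.
  rewrite ltr_pdivrMr ?exprn_gt0// => hN.
  have N0 : 0 < N%:R :> R by rewrite ltr0n.
  rewrite ler_pdivrMr ?mulr_gt0//.
  have -> : eta / 2 * (eta * N%:R) = (N%:R * eta ^+ 2) / 2 by field.
  by rewrite ler_pdivlMr//; move: hN; lra.
have [J' [h' [pi [S [Hh' h'0 hpi SN var]]]]] :=
  bernstein_refine N (fun f => Hmul y f (or_introl erefl)) Hlin y1 Hh h0 h1.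
have h'1 x : \sum_j h' j x = 1.
  have := hpi x (fun=> 1); under eq_bigr do rewrite mulr1.
  by move=> ->; under eq_bigr do rewrite mulr1; rewrite h1.
exists J', h'; split => // z /= [<-|/hfs[c c1 hc]]; last first.
  exists (fun j => c (pi j)) => // x.
  by rewrite (hpi x (fun j => `|z x - c j|)).
have N0r : 0 < N%:R :> R by rewrite ltr0n.
have Nn0 : N%:R != 0 :> R by rewrite gt_eqF.
exists (fun j => 2 * S j / N%:R - 1).
  move=> j; have /andP[s0 s1] := SN j; rewrite ler_norml; apply/andP; split.
    by rewrite lerBrDl subrr divr_ge0// mulr_ge0.
  by rewrite lerBlDr ler_pdivrMr//; lra.
move=> x; pose u := (1 + y x) / 2; pose D j := S j - N%:R * u.
have key j : `|y x - (2 * S j / N%:R - 1)| <= eta / 2 + 2 / (eta * N%:R ^+ 2) * D j ^+ 2.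
  have -> : y x - (2 * S j / N%:R - 1) = - (2 / N%:R * D j) by rewrite /D /u; field.
  rewrite normrN normrM ger0_norm; last by rewrite divr_ge0.
  rewrite -[D j ^+ 2]real_normK ?num_real//; set v := `|D j|.
  have : 0 <= 2 / eta * (v / N%:R - eta / 2) ^+ 2 by rewrite mulr_ge0 ?sqr_ge0// divr_ge0// ltW.
  have -> : 2 / eta * (v / N%:R - eta / 2) ^+ 2 =
    eta / 2 + 2 / (eta * N%:R ^+ 2) * v ^+ 2 - 2 / N%:R * v.
    by field; rewrite Nn0 gt_eqF.
  by rewrite subr_ge0.
apply: (@le_trans _ _ (\sum_j h' j x * (eta / 2 + 2 / (eta * N%:R ^+ 2) * D j ^+ 2))).
  by apply: ler_sum => j _; rewrite ler_wpM2l.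
have -> : \sum_j h' j x * (eta / 2 + 2 / (eta * N%:R ^+ 2) * D j ^+ 2) =
    eta / 2 + 2 / (eta * N%:R ^+ 2) * \sum_j h' j x * D j ^+ 2.
  rewrite -[X in X + _]mul1r -(h'1 x) mulr_suml mulr_sumr -big_split/=.
  by apply: eq_bigr => j _; ring.
rewrite var -/u.
have /andP[u0 u1] : 0 <= u <= 1.
  by have := y1 x; rewrite ler_norml /u => /andP[? ?]; apply/andP; split; lra.
rewrite [leRHS]splitr lerD2l; apply: le_trans etaN.
have -> : 2 / (eta * N%:R ^+ 2) * (N%:R * (u * (1 - u))) = 2 / (eta * N%:R) * (u * (1 - u)).
  by field; rewrite Nn0 gt_eqF.
rewrite ler_piMr//; first by rewrite divr_ge0// mulr_ge0// ltW.
by rewrite mulr_ile1// ?subr_ge0// lerBlDr lerDl.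
Qed.

End PartitionsOfUnity.

(** * From generators to all functions *)

Section Generation.
Context {R : realType} {G : groupType} {X : topologicalType}.
Variables (a : cts_action G X) (d : nat -> nat) (sigma : forall i, G -> 'S_(d i)).
Local Notation tr := (translate a).
Hypothesis dy : d i @[i --> \oo] --> \oo.
Hypothesis sigmaM : asymptotically_multiplicative R sigma.

Section Families.
Context {Y : nat -> Type} (F : set_system {i & Y i}) {FF : Filter F}.
Hypothesis big : projT1 z @[z --> F] --> \oo.
Variables U U' : forall i, Y i -> (X -> R) -> 'I_(d i) -> R.

Section Continuous.
Hypothesis cX : compact [set: X].
Local Notation C := (@cts_real R X).
Let algV := @cts_real_algebra R X cX.
Let trV := @cts_real_translate R X G a.
Hypothesis sU : \forall z \near F, state_map C (U (projT2 z)).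
Hypothesis sU' : \forall z \near F, state_map C (U' (projT2 z)).
Variable p : nat -> continuousType X R[i].
Hypotheses (gen : dyn_generating_cts a p) (ball : unit_ball_cts p).
Let pr n x := complex.Re (p n x).
Let cpr n : cts_real (pr n). Proof. exact: Re_cts. Qed.

Let uniform_mean f g e : cts_real f -> cts_real g -> 0 <= e ->
  (forall x, `|f x - g x| <= e) -> forall s i (u : (X -> R) -> 'I_(d i) -> R),
  state_map C u -> mean (u (absf (tr s f - tr s g))) <= e.
Proof.
move=> cf cg e0 fg s i u su; apply: le_trans (mean_cst_le e0); apply: mean_le => k.
apply: (sm_le_cst algV su) => [|x]; last exact: fg.
by apply: (fa_abs algV); apply: (fa_sub algV); exact: trV.
Qed.

(** The functions that are asymptotically multiplicative and equivariant form a
    closed invariant algebra. *)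
Lemma generated_continuous : (forall n, concentrated (V:=C) a F U (pr n)) ->
  (forall n, equivariant a sigma F U (pr n)) ->
  forall f, cts_real f -> concentrated (V:=C) a F U f /\ equivariant a sigma F U f.
Proof.
move=> cp ep; apply: (generating_cts_ind gen ball) => //.
- by move=> f [[]].
- move=> c; split; first exact: (concentrated_cst a algV sU).
  exact: (equivariant_cst a sigma algV sU).
- move=> c f g [cf ef] [cg eg]; have [Vf _] := cf; have [Vg _] := cg; split.
    exact: (concentrated_lin algV trV sU).
  exact: (equivariant_lin trV sU).
- move=> f g [cf ef] [cg eg]; have [Vf _] := cf; split.
    exact: (concentrated_mul algV trV sU).
  exact: (equivariant_mul algV trV sU).
- move=> s f [cf ef]; have [Vf _] := cf; split.
    exact: (concentrated_act trV).
  exact: (equivariant_act algV trV sU big dy sigmaM).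
- move=> f cf fapp; split.
    apply: (concentrated_lim algV trV sU) => // e e0.
    have [g [cg _] fg] := fapp e e0; exists g => // s; have [Vg _] := cg.
    by apply: filterS sU => z; apply: uniform_mean => //; exact: ltW.
  apply: (equivariant_lim algV trV sU) => // e e0.
  have [g [[Vg _] eg] fg] := fapp e e0; exists g => // s.
  by apply: filterS sU => z; apply: uniform_mean => //; exact: ltW.
- by move=> n; split; [exact: cp|exact: ep].
Qed.

(** Likewise, the functions on which two families asymptotically agree form a
    closed invariant algebra. *)
Lemma asymptotic_continuous :
  (forall f, cts_real f -> concentrated (V:=C) a F U f) ->
  (forall f, cts_real f -> concentrated (V:=C) a F U' f) ->
  (forall n, equivariant a sigma F U (pr n)) ->
  (forall n, equivariant a sigma F U' (pr n)) ->
  (forall n, vanishes F (fun z =>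
    mean (fun k => `|U (projT2 z) (pr n) k - U' (projT2 z) (pr n) k|))) ->
  forall f, cts_real f -> asymptotic a F U U' f.
Proof.
move=> cU cU' ep ep' vp f cf.
suff [] : cts_real f /\ asymptotic a F U U' f by [].
apply: (generating_cts_ind gen ball (P := [set f | cts_real f /\ asymptotic a F U U' f])) cf => //.
- by move=> g [].
- by move=> c; split; [exact: (fa_cst algV)|exact: (asymptotic_cst a algV sU sU')].
- move=> c g h [Vg ag] [Vh ah]; split; first exact: (fa_lin algV).
  exact: (asymptotic_lin trV sU sU').
- move=> g h [Vg ag] [Vh ah]; split; first exact: (fa_mul algV).
  by apply: (asymptotic_mul algV trV sU sU') => //; [exact: cU|exact: cU'].
- by move=> s g [Vg ag]; split; [exact: trV|exact: asymptotic_act].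
- move=> g Vg gapp; split => //; apply: (asymptotic_lim algV trV sU sU') => // e e0.
  have [h [Vh ah] gh] := gapp e e0; exists h => // s.
  by apply: filterS2 sU sU' => z sz sz'; split; apply: uniform_mean => //; exact: ltW.
- by move=> n; split; [exact: cpr|exact: (asymptotic_generator (ep n) (ep' n) (vp n))].
Qed.

End Continuous.

Section Measurable.
Variable mu : invariant_measure R a.
Local Notation T := (borel (im_nonempty mu)).
Local Notation bm := (@bounded_measurable R _ T).
Let algV : function_algebra bm := bounded_measurable_algebra.
Let trV : translate_closed a bm := @bounded_measurable_translate _ _ _ _ mu.
Hypothesis sU : \forall z \near F, state_map bm (U (projT2 z)).
Hypothesis sU' : \forall z \near F, state_map bm (U' (projT2 z)).
Variables (q : nat -> Linf mu) (qr : nat -> T -> R).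
Hypotheses (gen : dyn_generating_Linf q) (bqr : forall n, bm (qr n))
  (qE : forall n, \forall x \ae mu, q n x = (qr n x)%:C%C).

Definition mean_converges (u : forall i, Y i -> (X -> R) -> 'I_(d i) -> R) :=
  forall g, bm g -> vanishes F (fun z => `|mean (u _ (projT2 z) g) - mean_mu mu g|).

Hypotheses (mU : mean_converges U) (mU' : mean_converges U').

(** The mean over the coordinates of a state map is asymptotically [mu], and so
    approximation in the L1 norm of [mu] is enough. *)
Lemma mean_close u f g e : mean_converges u -> bm f -> bm g -> 0 < e ->
  mean_mu mu (absf (f - g)) <= e / 2 -> forall s, \forall z \near F,
  mean (u _ (projT2 z) (absf (tr s f - tr s g))) <= e.
Proof.
move=> mu_ bf bg e0 fg s.
have bfg : bm (absf (f - g)) by apply: (fa_abs algV); exact: (fa_sub algV).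
have e2 : 0 < e / 2 by rewrite divr_gt0.
apply: filterS (mu_ _ (trV s bfg) _ e2) => z.
rewrite (mean_mu_translate s bfg) (_ : tr s _ = absf (tr s f - tr s g))// => h.
by have := le_trans (ler_norm _) h; lra.
Qed.

(** As for continuous functions, closure now being taken in the L1 norm. *)
Lemma generated_measurable : (forall n, concentrated (V:=bm) a F U (qr n)) ->
  (forall n, equivariant a sigma F U (qr n)) ->
  forall f, bm f -> concentrated (V:=bm) a F U f /\ equivariant a sigma F U f.
Proof.
move=> cp ep; apply: (generating_Linf_ind gen qE) => //.
- by move=> f [[]].
- move=> c; split; first exact: (concentrated_cst a algV sU).
  exact: (equivariant_cst a sigma algV sU).
- move=> c f g [cf ef] [cg eg]; have [Vf _] := cf; have [Vg _] := cg; split.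
    exact: (concentrated_lin algV trV sU).
  exact: (equivariant_lin trV sU).
- move=> f g [cf ef] [cg eg]; have [Vf _] := cf; split.
    exact: (concentrated_mul algV trV sU).
  exact: (equivariant_mul algV trV sU).
- move=> s f [cf ef]; have [Vf _] := cf; split.
    exact: (concentrated_act trV).
  exact: (equivariant_act algV trV sU big dy sigmaM).
- move=> f cf fapp; split.
    apply: (concentrated_lim algV trV sU) => // e e0; have e2 : 0 < e / 2 by rewrite divr_gt0.
    have [g [cg _] fg] := fapp _ e2; exists g => // s; have [Vg _] := cg.
    exact: (mean_close mU).
  apply: (equivariant_lim algV trV sU) => // e e0; have e2 : 0 < e / 2 by rewrite divr_gt0.
  have [g [[Vg _] eg] fg] := fapp _ e2; exists g => // s.
  exact: (mean_close mU).
Qed.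

Lemma asymptotic_measurable :
  (forall f, bm f -> concentrated (V:=bm) a F U f) ->
  (forall f, bm f -> concentrated (V:=bm) a F U' f) ->
  (forall n, equivariant a sigma F U (qr n)) ->
  (forall n, equivariant a sigma F U' (qr n)) ->
  (forall n, vanishes F (fun z =>
    mean (fun k => `|U (projT2 z) (qr n) k - U' (projT2 z) (qr n) k|))) ->
  forall f, bm f -> asymptotic a F U U' f.
Proof.
move=> cU cU' ep ep' vp f cf.
suff [] : bm f /\ asymptotic a F U U' f by [].
apply: (generating_Linf_ind gen qE (P := [set f | bm f /\ asymptotic a F U U' f])) cf => //.
- by move=> g [].
- by move=> c; split; [exact: (fa_cst algV)|exact: (asymptotic_cst a algV sU sU')].
- move=> c g h [Vg ag] [Vh ah]; split; first exact: (fa_lin algV).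
  exact: (asymptotic_lin trV sU sU').
- move=> g h [Vg ag] [Vh ah]; split; first exact: (fa_mul algV).
  by apply: (asymptotic_mul algV trV sU sU') => //; [exact: cU|exact: cU'].
- by move=> s g [Vg ag]; split; [exact: trV|exact: asymptotic_act].
- move=> g Vg gapp; split => //; apply: (asymptotic_lim algV trV sU sU') => // e e0.
  have e2 : 0 < e / 2 by rewrite divr_gt0.
  have [h [Vh ah] gh] := gapp _ e2; exists h => // s.
  by apply: filterI; apply: mean_close.
- by move=> n; split; [exact: bqr|exact: (asymptotic_generator (ep n) (ep' n) (vp n))].
Qed.

End Measurable.
End Families.
End Generation.

(** * Norms, distances and filters given by a base *)

Section NormComparison.
Context {R : realType}.
Local Notation C := R[i].

Section Dim.
Context {d : nat}.
Implicit Types f : 'I_d -> C.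

Definition mean_normc f : R := mean (fun k => normc (f k)).

Lemma norm2_ge0 f : 0 <= norm2 f. Proof. exact: sqrtr_ge0. Qed.

Lemma norm2_sqr f : norm2 f ^+ 2 = mean (fun k => normc (f k) ^+ 2).
Proof. by rewrite /norm2 sqr_sqrtr// mulr_ge0 ?invr_ge0// sumr_ge0// => k _; exact: sqr_ge0. Qed.

Lemma mean_normc_le_norm2 f : mean_normc f <= norm2 f.
Proof.
have m0 : 0 <= mean_normc f by apply: mean_ge0 => k; exact: normc_ge0.
rewrite -(@ler_pXn2r _ 2) ?nnegrE ?norm2_ge0// norm2_sqr.
have [d0|d0] := posnP d; first by rewrite /mean_normc !mean_dim0// expr0n.
set m := mean_normc f in m0 *.
have : 0 <= mean (fun k => (normc (f k) - m) ^+ 2) by apply: mean_ge0 => k; exact: sqr_ge0.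
have -> : (fun k => (normc (f k) - m) ^+ 2) =
  (fun k => normc (f k) ^+ 2 + ((- (2 * m)) * normc (f k) + m ^+ 2)).
  by apply/funext => k; ring.
by rewrite !meanD meanZ mean_cst// -/(mean_normc f) -/m; lra.
Qed.

(** For bounded vectors the 2-norm is controlled by the 1-norm. *)
Lemma norm2_le f M e : (forall k, normc (f k) <= M) -> 0 <= e ->
  M * mean_normc f <= e ^+ 2 -> norm2 f <= e.
Proof.
move=> fM e0 h; rewrite -(@ler_pXn2r _ 2) ?nnegrE ?norm2_ge0// norm2_sqr.
apply: le_trans h; rewrite -meanZ; apply: mean_le => k.
by rewrite expr2 ler_wpM2r ?normc_ge0.
Qed.

End Dim.

(** The common form of [rho_seq] and of the sum in [HomS]. *)
Definition dyadic_sum (w : nat -> R) : \bar R :=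
  (\sum_(0 <= n <oo) ((2 ^- n.+1 * w n)%:E))%E.

Let term_ge0 (w : nat -> R) n : (forall n, 0 <= w n) -> (0 <= (2 ^- n.+1 * w n)%:E)%E.
Proof. by move=> w0; rewrite lee_fin mulr_ge0// invr_ge0 exprn_ge0. Qed.

Lemma dyadic_sum_term w n e : (forall n, 0 <= w n) ->
  (dyadic_sum w <= e%:E)%E -> w n <= 2 ^+ n.+1 * e.
Proof.
move=> w0 we; have h : ((2 ^- n.+1 * w n)%:E <= e%:E)%E.
  apply: le_trans we; apply: le_trans (nneseries_lim_ge n.+1 _); last first.
    by move=> k _ _; exact: term_ge0.
  rewrite big_nat_recr//= -[leLHS]add0e leeD2r//.
  by apply: sume_ge0 => k _; exact: term_ge0.
by move: h; rewrite lee_fin ler_pdivrMl// exprn_gt0.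
Qed.

Lemma dyadic_sum_le w N e : (forall n, 0 <= w n <= 2) -> 0 <= e ->
  (forall n, (n < N)%N -> w n <= e) -> (dyadic_sum w <= (e + 2 * 2 ^- N)%:E)%E.
Proof.
move=> w2 e0 we; have w0 n : 0 <= w n by case/andP: (w2 n).
apply: lime_le; first by apply: is_cvg_nneseries => n _ _; exact: term_ge0.
apply: nearW => K; rewrite sumEFin lee_fin.
have p0 n : 0 < 2 ^- n :> R by rewrite invr_gt0 exprn_gt0.
have pS n : 2 ^- n = 2 * 2 ^- n.+1 :> R by rewrite exprS; field; rewrite expf_neq0.
suff h : \sum_(0 <= n < K) 2 ^- n.+1 * w n <=
    e * (1 - 2 ^- K) + 2 * (if (K <= N)%N then 0 else 2 ^- N - 2 ^- K).
  apply: (le_trans h); apply: lerD.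
    by rewrite ler_piMr// gerBl ltW.
  by rewrite ler_pM2l//; case: ifP => _; [exact: ltW|rewrite gerBl ltW].
elim: K => [|K IH]; first by rewrite big_geq// expr0 invr1 subrr mulr0 leq0n mulr0 addr0.
rewrite big_nat_recr//=; apply: (le_trans (lerD IH (lexx _))).
have := pS K; have := p0 K.+1; set x := 2 ^- K.+1 => x0 ->.
have /andP[_ wK2] := w2 K.
case: (leqP K N) => KN; last first.
  by rewrite leqNgt ltnS (ltnW KN) /=; nra.
case: (ltngtP K N) KN => // KN _.
  by have := we K KN; rewrite subr0 || idtac; nra.
by rewrite -KN pS -/x; nra.
Qed.

(** Terms are at most 2, so the tail of the series is uniformly small. *)
Lemma dyadic_sum_small e : 0 < e -> exists N e', 0 < e' /\
  forall d (v : nat -> 'I_d -> C), (forall n k, normc (v n k) <= 2) ->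
  (forall n, (n < N)%N -> mean_normc (v n) <= e') ->
  (dyadic_sum (fun n => norm2 (v n)) < e%:E)%E.
Proof.
move=> e0; pose eta := e / 2; have eta0 : 0 < eta by rewrite divr_gt0.
have [N hN] : exists N, 2 * 2 ^- N < eta :> R.
  exists (Num.truncn (2 / eta)).+1; rewrite ltr_pdivrMr ?exprn_gt0// -ltr_pdivrMl//.
  rewrite mulrC; set n := (Num.truncn _); apply: (@lt_le_trans _ _ n.+1%:R); first exact: truncnS_gt.
  by rewrite -natrX ler_nat ltnW// ltn_expl.
exists N, (eta ^+ 2 / 2); split; first by rewrite divr_gt0// exprn_gt0.
move=> d v v2 vN.
have n2 n : 0 <= norm2 (v n) <= 2.
  rewrite norm2_ge0/=; apply: (norm2_le (M := 2)) => //; rewrite expr2 ler_pM2l//.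
  by apply: le_trans (mean_cst_le _) => //; exact: mean_le.
apply: le_lt_trans (dyadic_sum_le (N := N) n2 (ltW eta0) _) _; last first.
  by rewrite lte_fin [ltRHS]splitr ltrD2l.
move=> n nN; apply: (norm2_le (M := 2)) => //; first exact: ltW.
by rewrite mulrC -ler_pdivlMr//; exact: vN.
Qed.

End NormComparison.

Section BaseFilter.
Context {R : realType} {K : Type} {Y : nat -> Type}.
Variables (D : set K) (S : K -> forall i, set (Y i)).

(** Microstates satisfying conditions [S k], for all large indices [i]. *)
Definition base_filter : set_system {i & Y i} :=
  filter_from [set kn : K * nat | D kn.1]
    (fun kn => [set z | (kn.2 <= projT1 z)%N /\ S kn.1 (projT2 z)]).

Hypothesis D0 : D !=set0.
Hypothesis DI : forall k k', D k -> D k' -> exists2 k'', D k'' &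
  forall i, @S k'' i `<=` @S k i `&` @S k' i.

Lemma base_filter_filter : Filter base_filter.
Proof.
apply: filter_from_filter; first by have [k Dk] := D0; exists (k, 0%N).
move=> [k n] [k' n'] /= Dk Dk'; have [k'' Dk'' h] := DI Dk Dk'.
exists (k'', maxn n n') => // z /= [nz Sz]; have [Skz Sk'z] := h _ _ Sz.
by move: nz; rewrite geq_max => /andP[].
Qed.

Lemma base_filter_near k : D k -> \forall z \near base_filter, S k (projT2 z).
Proof. by move=> Dk; exists (k, 0%N) => // z []. Qed.

Lemma base_filter_big : D !=set0 -> projT1 z @[z --> base_filter] --> \oo.
Proof. by move=> [k Dk] A [n _ nA]; exists (k, n) => // z [nz _]; exact: nA. Qed.

Lemma growth_base_filter (d : nat -> nat) (rho : forall i, Y i -> Y i -> \bar R) eps :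
  growth d rho eps base_filter = ereal_inf [set
    limn_esup (fun i => ((d i)%:R^-1)%:E *
      lne (separation_number eps (@S k i) (@rho i)))%E | k in D].
Proof.
apply/eqP; rewrite eq_le; apply/andP; split; apply: le_ereal_inf_tmp.
- move=> _ [k Dk <-]; apply: ereal_inf_lbound.
  exists [set z | S k (projT2 z)] => //; exact: base_filter_near.
- move=> _ [A [[k n] /= Dk kA] <-]; apply: (le_trans (ereal_inf_lbound _)).
    by exists k => //; exact: erefl.
  apply: limn_esup_le; near=> i.
  suff h : (separation_number eps (@S k i) (@rho i) <=
      separation_number eps (@fiber _ A i) (@rho i))%E.
    apply: lee_wpmul2l; first by rewrite lee_fin invr_ge0.
    have [->|n0] := eqVneq (separation_number eps (@S k i) (@rho i)) 0%E.
      by rewrite le0_lneNy// leNye.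
    by rewrite lee_lne// in_itv/= leey andbT separation_number_ge0.
  apply: separation_number_sub => y Sy; apply: kA; split => //=.
  by near: i; exists n.
Unshelve. all: by end_near. Qed.

End BaseFilter.

Lemma ereal_inf_pair {R : realType} (A B : Type) (DA : set A) (DB : set B)
    (f : A -> B -> \bar R) :
  ereal_inf [set ereal_inf [set f x y | y in DB] | x in DA] =
  ereal_inf [set f xy.1 xy.2 | xy in DA `*` DB].
Proof.
apply/eqP; rewrite eq_le; apply/andP; split; apply: le_ereal_inf_tmp.
- move=> _ [[x y] [/= Dx Dy] <-].
  apply: (@le_trans _ _ (ereal_inf [set f x y | y in DB])).
    by apply: ereal_inf_lbound; exists x.
  by apply: ereal_inf_lbound; exists y.
- move=> _ [x Dx <-]; apply: le_ereal_inf_tmp => _ [y Dy <-].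
  by apply: ereal_inf_lbound; exists (x, y).
Qed.

(** * Characters of the algebra of continuous functions *)

Section Homomorphisms.
Context {R : realType} {X : topologicalType}.
Hypothesis cX : compact [set: X].
Local Notation C := R[i].
Local Notation CX := (continuousType X C).
Local Notation Re := complex.Re.
Let ctA := @cts_real_algebra R X cX.

Lemma cts_linE (c : C) (f g : CX) x : (c *: f + g : CX) x = c * f x + g x.
Proof. by []. Qed.

(** Functionals that are multiplicative are evaluations: otherwise every point
    is missed by some function of the kernel, and by compactness a finite sum
    of squared moduli of such functions is an invertible element of the
    kernel. *)
Lemma character_evaluation (chi : CX -> C) :
  (forall c f g, chi (c *: f + g) = c * chi f + chi g) -> chi 1 = 1 ->
  {morph chi : f g / f * g} -> exists x, forall f, chi f = f x.
Proof.
move=> lin one mul; apply: contrapT => nx.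
have chi0 : chi 0 = 0.
  have /eqP := lin 1 0 0; rewrite scale1r addr0 mul1r -subr_eq subrr.
  by move=> /eqP.
have /choice[f fP] : forall x, exists f : CX, chi f = 0 /\ f x != 0.
  move=> x; apply: contrapT => h; apply: nx; exists x => f.
  apply/eqP; rewrite -subr_eq0; apply/negP => /negP ne.
  apply: h; exists (- chi f *: (1 : CX) + f); split; first by rewrite lin one mulr1 addNr.
  rewrite cts_linE [(1 : CX) x](_ : _ = 1)// mulr1 addrC.
  by rewrite -oppr_eq0 opprB.
pose g c x : R := normc (f c x) ^+ 2.
have gE c x : f c x * (f c x)^*%C = (g c x)%:C%C.
  rewrite /g; case: (f c x) => u v; rewrite /normc sqr_sqrtr ?addr_ge0 ?sqr_ge0//.
  by apply: complex_eq => /=; ring.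
have g0 c x : 0 <= g c x by exact: sqr_ge0.
have cg c : continuous (g c).
  have [cr ci] : continuous (fun x => Re (f c x)) /\ continuous (fun x => complex.Im (f c x)).
    by apply/continuous_complexP; exact: cts_fun.
  have -> : g c = (fun x => Re (f c x) * Re (f c x) + complex.Im (f c x) * complex.Im (f c x)).
    apply/funext => x; rewrite /g; case: (f c x) => u v.
    by rewrite /normc sqr_sqrtr ?addr_ge0 ?sqr_ge0//= !expr2.
  by move=> x; apply: cvgD; apply: cvgM; [exact: cr|exact: cr|exact: ci|exact: ci].
have gpos c : 0 < g c c.
  rewrite lt_neqAle g0 andbT eq_sym expf_eq0/=; apply/eqP => h.
  by have [_ /eqP] := fP c; apply; exact: eq0_normc.
have [J [c [w [cw w0 h1]]]] := partition_of_unity cX cg g0 gpos.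
have chi_sum (F : J -> CX) : (forall j, chi (F j) = 0) -> chi (\sum_j F j) = 0.
  move=> F0; apply: (@big_ind _ (fun u => chi u = 0)) => // u v u0 v0.
  by rewrite -[u]scale1r lin u0 v0 mulr0 addr0.
have cre j : continuous (fun x => w x * Re (f (c j) x)).
  by move=> x; apply: cvgM; [exact: cw|exact: Re_cts].
have cim j : continuous (fun x => w x * complex.Im (f (c j) x)).
  by move=> x; apply: cvgM; [exact: cw|exact: Im_cts].
have [A AE] : exists A : J -> CX, forall j x, A j x = (w x * Re (f (c j) x))%:C%C.
  by exists (fun j => cts_of (fun x => w x * Re (f (c j) x))) => j x; exact: (cts_ofE (cre j)).
have [B BE] : exists B : J -> CX, forall j x, B j x = (w x * complex.Im (f (c j) x))%:C%C.
  by exists (fun j => cts_of (fun x => w x * complex.Im (f (c j) x))) => j x; exact: (cts_ofE (cim j)).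
(* [K j] is the continuous function [w] times the conjugate of [f (c j)]. *)
pose K j : CX := - 'i%C *: B j + A j.
have KE j x : K j x = - 'i%C * B j x + A j x by [].
pose F j : CX := f (c j) * K j.
have cF j : chi (F j) = 0 by rewrite /F mul (fP _).1 mul0r.
have := chi_sum F cF.
have -> : \sum_j F j = 1.
  apply: cts_eq => x.
  have -> : (\sum_j F j : CX) x = \sum_j F j x.
    by apply: (big_morph (fun u : CX => u x)).
  rewrite [RHS](_ : _ = (1 : R)%:C%C)// -(h1 x) rmorph_sum; apply: eq_bigr => j _; have -> : F j x = f (c j) x * K j x by [].
  have -> : K j x = (w x)%:C%C * (f (c j) x)^*%C.
    rewrite KE AE BE.
    by case: (f (c j) x) => u v; apply: complex_eq => /=; ring.
  by rewrite mulrCA gE -rmorphM mulrC.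
by rewrite one => /eqP; rewrite oner_eq0.
Qed.

End Homomorphisms.

(** * Topological microstates *)

Section HomMicrostates.
Context {R : realType} {G : groupType} {X : topologicalType}.
Variables (a : cts_action G X) (d : nat -> nat) (sigma : forall i, G -> 'S_(d i)).
Hypothesis cX : compact [set: X].
Local Notation C := R[i].
Local Notation CX := (continuousType X C).
Local Notation Re := complex.Re.
Local Notation tr := (translate a).
Let ctA := @cts_real_algebra R X cX.
Variable p : nat -> CX.
Hypothesis ball : unit_ball_cts p.

Definition real_gen n x : R := Re (p n x).

Lemma real_genE n x : p n x = (real_gen n x)%:C%C.
Proof. by have [/RRe_real h _] := ball n x; rewrite -[LHS]h complexRe. Qed.

Lemma real_gen_continuous n : cts_real (real_gen n). Proof. exact: Re_cts. Qed.

Lemma real_gen_bnd n x : `|real_gen n x| <= 1.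
Proof. by have [_] := ball n x; apply: le_trans; exact: abs_Re. Qed.

Section Evaluation.
Context {n : nat}.
Implicit Types (phi : CX -> 'I_n -> C) (x : 'I_n -> X).

(** On a compact space, every unital homomorphism [phi] is of this form. *)
Definition evaluates phi x := forall f k, phi f k = f (x k).

Definition hom_real phi (f : X -> R) (k : 'I_n) : R := Re (phi (cts_of f) k).

Lemma evaluates_real phi x f : evaluates phi x -> cts_real f ->
  hom_real phi f = fun k => f (x k).
Proof. by move=> ev cf; apply/funext => k; rewrite /hom_real ev cts_ofE. Qed.

Lemma evaluates_state phi x : evaluates phi x -> state_map (@cts_real R X) (hom_real phi).
Proof.
move=> ev; split.
- by move=> k; rewrite (evaluates_real ev)//; exact: (fa_cst ctA).
- move=> c f g k cf cg; rewrite !(evaluates_real ev)//; exact: (fa_lin ctA).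
- by move=> f g k cf cg fg; rewrite !(evaluates_real ev).
Qed.

Lemma evaluates_spread phi x f : evaluates phi x -> cts_real f ->
  spread (hom_real phi) f = 0.
Proof.
move=> ev cf; rewrite /spread /mean big1 ?mulr0// => k _.
rewrite (evaluates_real ev) /absf ?fctE; last exact: (fa_absB ctA).
by rewrite (evaluates_real ev)// subrr normr0.
Qed.

End Evaluation.

Section Equivariance.
Context {n : nat} (sg : G -> 'S_n) (phi : CX -> 'I_n -> C) (x : 'I_n -> X).
Hypothesis ev : evaluates phi x.

Lemma evaluates_defect s m :
  mean_normc (phi (alpha_cts a s (p m)) - perm_act (sg s) (phi (p m))) =
  mean (fun k => `|tr s (real_gen m) (x (sg s k)) - real_gen m (x k)|).
Proof.
rewrite /mean_normc -(mean_perm (sg s)); congr mean; apply/funext => k.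
rewrite !fctE /perm_act permK !ev [alpha_cts _ _ _ _](_ : _ = p m (a s^-1%g (x (sg s k))))//.
by rewrite !real_genE -rmorphB normc_complex.
Qed.

Let normc_le2 (u v : C) : normc u <= 1 -> normc v <= 1 -> normc (u - v) <= 2.
Proof.
by move=> u1 v1; rewrite (le_trans (le_normcD _ _))// normcN; lra.
Qed.

Lemma evaluates_defect_le2 s m k :
  normc ((phi (alpha_cts a s (p m)) - perm_act (sg s) (phi (p m))) k) <= 2.
Proof.
rewrite !fctE /perm_act !ev; apply: normc_le2; last by have [_] := ball m (x ((sg s)^-1%g k)).
by have [_] := ball m (a s^-1%g (x k)).
Qed.

Lemma HomS_defect F delta s m : HomS a p F delta sg phi -> F s ->
  mean (fun k => `|tr s (real_gen m) (x (sg s k)) - real_gen m (x k)|) <=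
  2 ^+ m.+1 * delta.
Proof.
move=> [_ _ _ /(_ s)] h /h {}h; rewrite -evaluates_defect.
apply: (le_trans (mean_normc_le_norm2 _)).
exact: (dyadic_sum_term m (fun m => norm2_ge0 _) (ltW h)).
Qed.

End Equivariance.

(** Finitely many approximate equivariance conditions on the points are enough,
    with bounds that depend neither on the dimension nor on the points. *)
Lemma evaluates_HomS delta : 0 < delta -> exists N e, 0 < e /\
  forall n (sg : G -> 'S_n) (F : set G) (x : 'I_n -> X),
  (forall s m, F s -> (m < N)%N ->
    mean (fun k => `|tr s (real_gen m) (x (sg s k)) - real_gen m (x k)|) <= e) ->
  HomS a p F delta sg (fun f k => f (x k)).
Proof.
move=> /dyadic_sum_small[N [e [e0 h]]]; exists N, e; split => // n sg F x xF.
have ev : evaluates (fun (f : CX) k => f (x k)) x by [].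
split => // s Fs; apply: h => [m k|m mN]; first exact: (evaluates_defect_le2 sg ev).
by rewrite (evaluates_defect sg ev); exact: xF.
Qed.

Section Distance.
Context {n : nat} (phi psi : CX -> 'I_n -> C) (x y : 'I_n -> X).
Hypotheses (evx : evaluates phi x) (evy : evaluates psi y).

Let mean_normcE m : mean_normc (phi (p m) - psi (p m)) =
  mean (fun k => `|hom_real phi (real_gen m) k - hom_real psi (real_gen m) k|).
Proof.
rewrite (evaluates_real evx (@real_gen_continuous m)).
rewrite (evaluates_real evy (@real_gen_continuous m)).
congr mean; apply/funext => k.
by rewrite !fctE evx evy !real_genE -rmorphB normc_complex.
Qed.

Lemma rho_seq_cts_term m e : (rho_seq p phi psi <= e%:E)%E ->
  mean (fun k => `|hom_real phi (real_gen m) k - hom_real psi (real_gen m) k|) <=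
  2 ^+ m.+1 * e.
Proof.
move=> h; rewrite -mean_normcE; apply: (le_trans (mean_normc_le_norm2 _)).
exact: (dyadic_sum_term m (fun m => norm2_ge0 _) h).
Qed.

(** The hypothesis on [N] and [e] is what [dyadic_sum_small] provides. *)
Lemma rho_seq_cts_small N e eps :
  (forall d (v : nat -> 'I_d -> C), (forall n k, normc (v n k) <= 2) ->
  (forall n, (n < N)%N -> mean_normc (v n) <= e) ->
  (dyadic_sum (fun n => norm2 (v n)) < eps%:E)%E) ->
  (forall m, (m < N)%N -> mean (fun k =>
    `|hom_real phi (real_gen m) k - hom_real psi (real_gen m) k|) <= e) ->
  (rho_seq p phi psi <= eps%:E)%E.
Proof.
move=> small h; apply/ltW/small => [m k|m mN]; last by rewrite mean_normcE; exact: h.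
rewrite !fctE evx evy (le_trans (le_normcD _ _))// normcN.
by have [_ h1] := ball m (x k); have [_ h2] := ball m (y k); lra.
Qed.

End Distance.

Definition hom_index : set (set G * R) :=
  [set F : set G | finite_set F /\ F !=set0] `*` [set r : R | 0 < r].

Definition hom_filter : set_system {i & (CX -> 'I_(d i) -> C)} :=
  base_filter hom_index (fun k i => HomS a p k.1 k.2 (@sigma i)).

Let index0 : hom_index !=set0.
Proof. by exists ([set 1%g], 1); split => //=; split => //; exists 1%g. Qed.

Lemma HomS_sub F F' r r' n (sg : G -> 'S_n) : F' `<=` F -> r <= r' ->
  HomS a p F r sg `<=` HomS a p F' r' sg.
Proof.
move=> F'F rr' phi [h1 h2 h3 h4]; split => // s /F'F /h4 h.
by apply: (lt_le_trans h); rewrite lee_fin.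
Qed.

#[global] Instance hom_filter_filter : Filter hom_filter.
Proof.
apply: base_filter_filter; first exact: index0.
move=> [F r] [F' r'] [/= [fF F0] r0] [/= [fF' F'0] r'0].
exists (F `|` F', Num.min r r').
  split => /=; last by rewrite lt_min r0.
  by split; [rewrite finite_setU|case: F0 => s Fs; exists s; left].
move=> i phi Hphi; split; apply: HomS_sub Hphi => /=.
- by move=> s Fs; left.
- by rewrite ge_min lexx.
- by move=> s Fs; right.
- by rewrite ge_min lexx orbT.
Qed.

Lemma hom_filter_big : projT1 z @[z --> hom_filter] --> \oo.
Proof. exact: base_filter_big index0. Qed.

Lemma hom_filter_evaluates : \forall z \near hom_filter,
  exists x, evaluates (projT2 z) x.
Proof.
have [k kD] := index0; apply: filterS (base_filter_near _ kD) => z.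
move=> [lin one mul _].
have /choice[x xP] : forall k, exists x, forall f, projT2 z f k = f x.
  move=> j; apply: (character_evaluation cX) => [c f g||f g].
  - by rewrite lin.
  - by rewrite one.
  - by rewrite mul.
by exists x => f j.
Qed.

Lemma hom_filter_state : \forall z \near hom_filter,
  state_map (@cts_real R X) (hom_real (projT2 z)).
Proof.
by apply: filterS hom_filter_evaluates => z [x ev]; exact: (evaluates_state ev).
Qed.

Lemma hom_filter_concentrated f : cts_real f ->
  concentrated (V := @cts_real R X) a hom_filter (fun i phi => hom_real phi) f.
Proof.
move=> cf; split => // s e e0; apply: filterS hom_filter_evaluates => z [x ev].
by rewrite (evaluates_spread ev) ?ltW//; exact: cts_real_translate.
Qed.

Lemma hom_filter_equivariant m :
  equivariant a sigma hom_filter (fun i phi => hom_real phi) (real_gen m).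
Proof.
move=> s e e0; have r0 : 0 < e / 2 ^+ m.+1 by rewrite divr_gt0// exprn_gt0.
have kD : hom_index ([set s], e / 2 ^+ m.+1) by split => /=; [split; [exact: finite_set1|by exists s]|].
apply: filterS2 hom_filter_evaluates (base_filter_near _ kD) => z [x ev] Hz.
have := HomS_defect ev m Hz erefl; rewrite mulrCA mulfV ?mulr1 ?expf_neq0//.
rewrite /defect !(evaluates_real ev)//; first exact: real_gen_continuous.
exact/cts_real_translate/real_gen_continuous.
Qed.

Lemma top_entropy_growth : top_entropy_seq a sigma p = ereal_sup [set
  growth d (fun i => rho_seq p) eps hom_filter | eps in [set x : R | 0 < x]].
Proof.
congr ereal_sup; apply: eq_imagel => eps _.
by rewrite growth_base_filter ereal_inf_pair.
Qed.

End HomMicrostates.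

(** * Microstates of an invariant measure *)

Section UnitBall.
Context {R : realType} {disp : measure_display} {T : measurableType disp}.
Context (mu : probability T R).
Local Notation bm := (@bounded_measurable R disp T).

(** State maps only act on functions bounded everywhere. *)
Definition represents (q : nat -> Linf mu) (qr : nat -> T -> R) := forall n,
  [/\ bm (qr n), forall x, `|qr n x| <= 1 & \forall x \ae mu, q n x = (qr n x)%:C%C].

Lemma unit_ball_represents (q : nat -> Linf mu) : unit_ball_Linf q ->
  exists qr, represents q qr.
Proof.
move=> ball; pose r n x := complex.Re (q n x).
exists (fun n x => if `|r n x| <= 1 then r n x else 0) => n.
have [qreal qn] := ball n; have /Linf_predP[mR _ _] := valP (q n).
have mr : measurable_fun setT (r n) by [].
have b1 x : `|if `|r n x| <= 1 then r n x else 0| <= 1.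
  by case: ifP => // _; rewrite normr0.
split => //.
- split; last by exists 1.
  apply: measurable_fun_ifT => //.
  by apply: measurable_fun_ler => //; exact: measurableT_comp.
- have mu0 : (0 < mu [set: T])%E by rewrite probability_setT lte01.
  move: qn; rewrite unlock /Lnorm mu0 => /ess_supP; apply: filterS2 qreal => x qx.
  rewrite /= lee_fin ger0_norm ?normc_ge0// => h.
  rewrite /r (le_trans (abs_Re _))//.
  by have := RRe_real qx; rewrite complexRe => ->.
Qed.

End UnitBall.

Section UpMicrostates.
Context {R : realType} {G : groupType} {X : topologicalType}.
Variables (a : cts_action G X) (d : nat -> nat) (sigma : forall i, G -> 'S_(d i)).
Variable mu : invariant_measure R a.
Hypothesis dy : d i @[i --> \oo] --> \oo.
Local Notation C := R[i].
Local Notation Re := complex.Re.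
Local Notation LX := (Linf mu).
Local Notation T := (borel (im_nonempty mu)).
Local Notation bm := (@bounded_measurable R _ T).
Local Notation mm := (mean_mu mu).
Local Notation tr := (translate a).
Let bmA : function_algebra bm := bounded_measurable_algebra.
Variables (q : nat -> LX) (qr : nat -> T -> R).
Hypothesis rep : represents q qr.

Let bqr n : bm (qr n). Proof. by case: (rep n). Qed.
Let qr1 n x : `|qr n x| <= 1. Proof. by case: (rep n). Qed.
Let qE n : \forall x \ae mu, q n x = (qr n x)%:C%C. Proof. by case: (rep n). Qed.

(** Lists of factors, rather than families over ['I_j], allow induction on the
    number of factors. *)
Definition monomial (L : seq (G * nat)) : T -> R :=
  foldr (fun sn g => tr sn.1 (qr sn.2) * g) (cst 1) L.

Lemma monomial_bm L : bm (monomial L).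
Proof.
elim: L => [|sn L IH] /=; first exact: (fa_cst bmA).
by apply: (fa_mul bmA) => //; exact: bounded_measurable_translate.
Qed.

Lemma monomial_bnd L x : `|monomial L x| <= 1.
Proof.
elim: L => [|sn L IH] /=; first by rewrite normr1.
by rewrite fctE normrM mulr_ile1//; exact: qr1.
Qed.

Lemma monomialE j (s : 'I_j -> G) (n : 'I_j -> nat) :
  \forall x \ae mu, Linf_fun (\prod_(k < j) alpha_Linf (s k) (q (n k))) x =
    (monomial [seq (s k, n k) | k <- enum 'I_j] x)%:C%C.
Proof.
have -> : Linf_fun (\prod_(k < j) alpha_Linf (s k) (q (n k))) =
    fun x => \prod_(k <- enum 'I_j) alpha_Linf (s k) (q (n k)) x.
  apply/funext => x; rewrite big_enum.
  exact: (big_morph (fun f : LX => Linf_fun f x)).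
elim: (enum 'I_j) => [|k L IH]; first by apply: nearW => x; rewrite big_nil.
apply: filterS2 IH (ae_act (s k)^-1%g (qE (n k))) => x IHx qx.
by rewrite big_cons IHx /= [alpha_Linf _ _ _]qx fctE rmorphM.
Qed.

Section OneMap.
Context {n : nat} {phi : LX -> 'I_n -> C} (up : unital_positive phi).
Let W := real_part phi.
Let sW : state_map bm W. Proof. exact: real_part_state. Qed.

Lemma phi_ae (f : LX) (r : T -> R) : (\forall x \ae mu, f x = (r x)%:C%C) -> bm r ->
  phi f = fun k => (W r k)%:C%C.
Proof.
move=> fr br; apply/funext => k; rewrite -(real_partE up)//.
congr (_ k); apply: (unital_positive_ae up).
by apply: filterS fr => x ->; rewrite Linf_ofE.
Qed.

Lemma zeta_error (f : LX) (r : T -> R) : (\forall x \ae mu, f x = (r x)%:C%C) -> bm r ->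
  normc (zeta (phi f) - cintegral mu f) = `|mean (W r) - mm r|.
Proof.
move=> fr br; rewrite (phi_ae fr br) -normc_complex rmorphB; congr (normc (_ - _)).
  by rewrite /zeta /mean rmorphM fmorphV rmorph_nat rmorph_sum.
have /Linf_predP[mR mI _] := valP f.
have mr : measurable_fun setT r by case: br.
apply: complex_eq => /=; last first.
  rewrite -(mean_mu_cst mu 0); congr fine; apply: ae_eq_integral => //.
  - exact/measurable_EFinP.
  - exact/measurable_EFinP.
  - by apply: filterS fr => x ->.
congr fine; apply: ae_eq_integral => //; try exact/measurable_EFinP.
by apply: filterS fr => x ->.
Qed.

Lemma generator_translate s m :
  \forall x \ae mu, alpha_Linf s (q m) x = (tr s (qr m) x)%:C%C.
Proof. exact: (ae_act s^-1%g (qE m)). Qed.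

Lemma equivariance_error (sg : G -> 'S_n) s m :
  mean_normc (phi (alpha_Linf s (q m)) - perm_act (sg s) (phi (q m))) =
  mean (fun k => `|W (tr s (qr m)) (sg s k) - W (qr m) k|).
Proof.
rewrite (phi_ae (generator_translate s m)); last exact: bounded_measurable_translate.
rewrite (phi_ae (qE m))// /mean_normc -(mean_perm (sg s)); congr mean.
by apply/funext => k; rewrite !fctE /perm_act permK -rmorphB normc_complex.
Qed.

Lemma product_error j (s : 'I_j -> G) (m : 'I_j -> nat) :
  mean_normc (phi (\prod_(k < j) alpha_Linf (s k) (q (m k))) -
    \prod_(k < j) phi (alpha_Linf (s k) (q (m k)))) =
  mean (fun k => `|W (monomial [seq (s k, m k) | k <- enum 'I_j]) k -
    \prod_(sn <- [seq (s k, m k) | k <- enum 'I_j]) W (tr sn.1 (qr sn.2)) k|).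
Proof.
rewrite (phi_ae (monomialE s m) (monomial_bm _)); congr mean; apply/funext => k.
rewrite !fctE -normc_complex rmorphB; congr (normc (_ - _)).
have -> : (\prod_(k0 < j) phi (alpha_Linf (s k0) (q (m k0)))) k =
    \prod_(k0 < j) phi (alpha_Linf (s k0) (q (m k0))) k.
  exact: (big_morph (fun f : 'I_n -> C => f k)).
rewrite rmorph_prod big_map big_enum/=; apply: eq_bigr => i _.
rewrite (phi_ae (generator_translate (s i) (m i)))//; exact: bounded_measurable_translate.
Qed.

Lemma state_generator_bnd s m k : `|W (tr s (qr m)) k| <= 1.
Proof.
apply: (sm_bnd bmA sW); first exact: bounded_measurable_translate.
by move=> x; exact: qr1.
Qed.

(** Factors are split off one at a time, each at the cost of its spread. *)
Lemma product_spread (L : seq (G * nat)) e : (forall sn, List.In sn L ->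
    spread W (tr sn.1 (qr sn.2)) <= e) ->
  mean (fun k => `|W (monomial L) k - \prod_(sn <- L) W (tr sn.1 (qr sn.2)) k|)
  <= (size L)%:R * e.
Proof.
elim: L => [|[s m] L IH] h /=.
  rewrite mul0r; apply: le_trans (mean_cst_le (lexx 0)); apply: mean_le => k.
  by rewrite big_nil (sm_one sW) subrr normr0.
have bs := bounded_measurable_translate s (bqr m).
have h1 : mean (fun k => `|W (monomial L * tr s (qr m)) k -
    W (monomial L) k * W (tr s (qr m)) k|) <= 1 * spread W (tr s (qr m)).
  by apply: (sm_mul bmA sW) => //; [exact: monomial_bm|exact: monomial_bnd].
rewrite -natr1 mulrDl mul1r; apply: (le_trans _ (lerD (IH _) (h (s, m) _))); last 2 first.
- by move=> sn snL; apply: h; right.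
- by left.
rewrite -[spread _ _]mul1r; apply: le_trans (lerD (lexx _) h1).
rewrite -meanD; apply: mean_le => k; rewrite big_cons /=.
rewrite [tr s _ * _]mulrC; set u := W (tr s (qr m)) k; set v := W (monomial L) k.
set P := \prod_(_ <- L) _; set w := W _ k.
rewrite (_ : w - u * P = u * (v - P) + (w - v * u)); last by ring.
rewrite (le_trans (ler_normD _ _))// lerD2r normrM ler_piMl//.
exact: state_generator_bnd.
Qed.

(** The variance [W(y^2) - W(y)^2] controls the mean deviation through
    [|t| <= e / 2 + t^2 / (2e)]. *)
Lemma spread_square s m e : 0 < e -> spread W (tr s (qr m)) <= e / 2 + (2 * e)^-1 *
  mean (fun k => `|W (monomial [:: (s, m); (s, m)]) k -
    \prod_(sn <- [:: (s, m); (s, m)]) W (tr sn.1 (qr sn.2)) k|).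
Proof.
move=> e0; set y := tr s (qr m); have by_ : bm y by exact: bounded_measurable_translate.
have -> : monomial [:: (s, m); (s, m)] = y * y.
  by rewrite /= -/y; apply/funext => x; rewrite !fctE mulr1.
apply: le_trans (_ : mean (fun k => e / 2 + (2 * e)^-1 * `|W (y * y) k - W y k * W y k|) <= _); last first.
  rewrite meanD [X in _ + X <= _]meanZ; apply: lerD; first by apply: mean_cst_le; rewrite divr_ge0// ltW.
  rewrite ler_wpM2l//; first by rewrite invr_ge0 mulr_ge0// ltW.
  by apply: mean_le => k; rewrite !big_cons big_nil mulr1.
apply: mean_le => k; set c := W y k.
have byy : bm (y * y) by exact: (fa_mul bmA).
have E : (e / 2 + (2 * e)^-1 * (W (y * y) k - c * c)) =
    W ((2 * e)^-1 *: (y * y) + ((- (e^-1 * c)) *: y + cst (e / 2 + (2 * e)^-1 * c ^+ 2))) k.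
  have b1 : bm ((- (e^-1 * c)) *: y + cst (e / 2 + (2 * e)^-1 * c ^+ 2)).
    by apply: (fa_lin bmA) => //; exact: (fa_cst bmA).
  rewrite (sm_lin sW)// (sm_lin sW)//; last exact: (fa_cst bmA).
  rewrite (sm_cst bmA sW) -/c; field; exact: lt0r_neq0.
apply: (@le_trans _ _ (e / 2 + (2 * e)^-1 * (W (y * y) k - c * c))); last first.
  by rewrite lerD2l ler_wpM2l ?ler_norm// invr_ge0 mulr_ge0// ltW.
rewrite E; apply: (sm_mono sW).
- exact: (fa_absB bmA).
- apply: (fa_lin bmA) => //; apply: (fa_lin bmA) => //; exact: (fa_cst bmA).
- move=> x; rewrite /absf !fctE /GRing.scale/=.
  have : 0 <= (2 * e)^-1 * (`|y x - c| - e) ^+ 2.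
    by rewrite mulr_ge0 ?sqr_ge0// invr_ge0 mulr_ge0// ltW.
  rewrite sqrrB real_normK ?num_real//.
  set t := `|_|; rewrite -subr_ge0 => h; rewrite -subr_ge0.
  suff -> : (2 * e)^-1 * (y x * y x) + (- (e^-1 * c) * y x + (e / 2 + (2 * e)^-1 * c ^+ 2)) - t =
    (2 * e)^-1 * ((y x - c) ^+ 2 - t * e *+ 2 + e ^+ 2) - 0 by [].
  by field; exact: lt0r_neq0.
Qed.

End OneMap.

Definition up_index : set (set G * (nat * R)) :=
  [set F : set G | finite_set F /\ F !=set0] `*`
  ([set m : nat | (0 < m)%N] `*` [set r : R | 0 < r]).

Definition up_filter : set_system {i & (LX -> 'I_(d i) -> C)} :=
  base_filter up_index (fun k i => UP q k.1 k.2.1 k.2.2 (@sigma i)).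

Let index0 : up_index !=set0.
Proof. by exists ([set 1%g], (1%N, 1)); split => //=; split => //; exists 1%g. Qed.

Lemma UP_sub F F' m m' r r' n (sg : G -> 'S_n) : F' `<=` F -> (m' <= m)%N -> r <= r' ->
  UP q F m r sg `<=` UP q F' m' r' sg.
Proof.
move=> F'F mm' rr' phi [h1 h2 h3 h4]; split => //.
- move=> j s t /andP[j0 jm'] Fs.
  apply: lt_le_trans rr'; apply: (h2 j s (fun k => widen_ord mm' (t k))).
    by rewrite j0 (leq_trans jm').
  by move=> k; exact/F'F.
- move=> f [j [s [t [/andP[j0 jm'] Fs ->]]]]; apply: lt_le_trans rr'; apply: h3.
  exists j, s, (fun k => widen_ord mm' (t k)); split => //.
    by rewrite j0 (leq_trans jm').
  by move=> k; exact/F'F.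
- move=> s /F'F Fs t; apply: lt_le_trans rr'.
  exact: (h4 s Fs (widen_ord mm' t)).
Qed.

#[global] Instance up_filter_filter : Filter up_filter.
Proof.
apply: base_filter_filter; first exact: index0.
move=> [F [m r]] [F' [m' r']] [/= [fF F0] [m0 r0]] [[fF' F'0] [m'0 r'0]].
exists (F `|` F', (maxn m m', Num.min r r')).
  split => /=; last by split; rewrite /= ?lt_min ?r0// leq_max m0.
  by split; [rewrite finite_setU|case: F0 => s Fs; exists s; left].
move=> i phi Hphi; split; apply: UP_sub Hphi => /=.
- by move=> s Fs; left.
- exact: leq_maxl.
- by rewrite ge_min lexx.
- by move=> s Fs; right.
- exact: leq_maxr.
- by rewrite ge_min lexx orbT.
Qed.

Lemma up_filter_big : projT1 z @[z --> up_filter] --> \oo.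
Proof. exact: base_filter_big index0. Qed.

Lemma measure_entropy_growth : measure_entropy_seq sigma q = ereal_sup [set
  growth d (fun i => rho_seq q) eps up_filter | eps in [set x : R | 0 < x]].
Proof.
congr ereal_sup; apply: eq_imagel => eps _.
pose g F m r := limn_esup (fun i => ((d i)%:R^-1)%:E *
  lne (separation_number eps (UP q F m r (sigma i)) (rho_seq q)))%E.
rewrite growth_base_filter.
rewrite -[RHS](ereal_inf_pair _ _ (fun F mr => g F mr.1 mr.2)); congr ereal_inf.
by apply: eq_imagel => F _; exact: (ereal_inf_pair _ _ (g F)).
Qed.

End UpMicrostates.

Section UpAsymptotics.
Context {R : realType} {G : groupType} {X : topologicalType}.
Variables (a : cts_action G X) (d : nat -> nat) (sigma : forall i, G -> 'S_(d i)).
Variable mu : invariant_measure R a.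
Hypothesis dy : d i @[i --> \oo] --> \oo.
Local Notation C := R[i].
Local Notation LX := (Linf mu).
Local Notation T := (borel (im_nonempty mu)).
Local Notation bm := (@bounded_measurable R _ T).
Local Notation mm := (mean_mu mu).
Local Notation tr := (translate a).
Let bmA : function_algebra bm := bounded_measurable_algebra.
Let trV : translate_closed a bm := @bounded_measurable_translate _ _ _ _ mu.
Variables (q : nat -> LX) (qr : nat -> T -> R).
Hypothesis rep : represents q qr.
Let bqr n : bm (qr n). Proof. by case: (rep n). Qed.
Let qr1 n x : `|qr n x| <= 1. Proof. by case: (rep n). Qed.
Local Notation monomial := (monomial qr).
Local Notation up_filter := (up_filter sigma q).
Local Notation up_real := (fun i (phi : LX -> 'I_(d i) -> C) => real_part phi).

Lemma mem_In (K : eqType) (s : seq K) k : k \in s -> List.In k s.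
Proof.
elim: s => // x s IH; rewrite inE => /predU1P[->|/IH h]; first by left.
by right.
Qed.

Lemma up_filter_positive : \forall z \near up_filter, unital_positive (projT2 z).
Proof.
have kD : up_index ([set 1%g : G], (1%N, 1 : R)).
  by split => /=; [split; [exact: finite_set1|by exists 1%g]|].
by apply: filterS (base_filter_near _ kD) => z [].
Qed.

Lemma up_filter_state : \forall z \near up_filter, state_map bm (real_part (projT2 z)).
Proof. by apply: filterS up_filter_positive => z; exact: real_part_state. Qed.

(** A list of factors is one of the products in [product_set] once the
    parameters [F] and [m] are large enough for it. *)
Lemma up_filter_mean (L : seq (G * nat)) : vanishes up_filter
  (fun z => `|mean (real_part (projT2 z) (monomial L)) - mm (monomial L)|).
Proof.
move=> e e0; have [->|L0] := eqVneq L [::].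
  have dz : \forall z \near up_filter, (0 < d (projT1 z))%N.
    exact: (up_filter_big sigma q (d_gt0 dy)).
  apply: filterS2 up_filter_state dz => z sz dz.
  rewrite (_ : real_part _ _ = fun=> 1); last by apply/funext => k; rewrite (sm_one sz).
  by rewrite mean_cst// (mean_mu_cst mu 1) subrr normr0 ltW.
pose m := maxn (size L) (\max_(sn <- L) sn.2).+1.
have kD : up_index ([set s | s \in map fst L], (m, e)).
  split => /=; last by split => //=; rewrite /m leq_max ltnS leq0n orbT.
  split; first by apply/finite_seqP; exists (map fst L).
  by move: L0; case: (L) => // sn L' _; exists sn.1; rewrite /= inE eqxx.
have sn0 : G * nat := (1%g, 0%N).
have Lm (k : 'I_(size L)) : ((nth sn0 L k).2 < m)%N.
  rewrite /m leq_max ltnS; apply/orP; right; rewrite (big_nth sn0) big_mkord.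
  exact: (leq_bigmax k).
apply: filterS2 up_filter_positive (base_filter_near _ kD) => z up [_ _ h3 _].
pose s (k : 'I_(size L)) := (nth sn0 L k).1.
pose n (k : 'I_(size L)) : 'I_m := Ordinal (Lm k).
have LE : [seq (s k, nat_of_ord (n k)) | k <- enum 'I_(size L)] = L.
  rewrite (eq_map (g := nth sn0 L \o val)); last first.
    by move=> k /=; rewrite /s; case: (nth _ _ _).
  by rewrite map_comp val_enum_ord; exact: mkseq_nth.
have := h3 (\prod_(k < size L) alpha_Linf (s k) (q (n k))).
rewrite (zeta_error up (monomialE rep s (fun k => n k))); last exact: (monomial_bm rep).
rewrite LE => h; apply/ltW/h; exists (size L), s, n; split => //.
  by rewrite leq_maxl andbT; case: (L) L0.
by move=> k /=; apply: map_f; exact: mem_nth.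
Qed.

(** Almost multiplicativity on the square of a generator. *)
Lemma up_filter_spread s n : vanishes up_filter
  (fun z => spread (real_part (projT2 z)) (tr s (qr n))).
Proof.
move=> e e0; have e2 : 0 < e ^+ 2 by rewrite exprn_gt0.
have kD : up_index ([set s], ((maxn 2 n.+1), e ^+ 2)).
  split => /=; last by split => //=; rewrite leq_max.
  by split; [exact: finite_set1|by exists s].
apply: filterS2 up_filter_positive (base_filter_near _ kD) => z up [_ h2 _ _].
apply: (le_trans (spread_square rep up s n e0)).
have nm : (n < maxn 2 n.+1)%N by rewrite leq_max ltnSn orbT.
have := h2 2%N (fun=> s) (fun=> Ordinal nm) (leq_maxl _ _) (fun=> erefl).
move=> /ltW; move/(le_trans (mean_normc_le_norm2 _)).
rewrite (product_error rep up (fun=> s) (fun=> n)).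
have -> : [seq (s, n) | _ <- enum 'I_2] = [:: (s, n); (s, n)].
  by rewrite !enum_ordSl /= (_ : enum 'I_0 = [::])//; apply: size0nil; rewrite size_enum_ord.
move=> /= h; apply: (le_trans (lerD (lexx _) (ler_wpM2l _ h))).
  by rewrite invr_ge0 mulr_ge0// ltW.
rewrite le_eqVlt; apply/orP; left; apply/eqP; field; exact: lt0r_neq0.
Qed.

Lemma up_filter_equivariant n : equivariant a sigma up_filter up_real (qr n).
Proof.
move=> s e e0; have kD : up_index ([set s], (n.+1, e)).
  by split => //=; split; [exact: finite_set1|by exists s].
apply: filterS2 up_filter_positive (base_filter_near _ kD) => z up [_ _ _ h4].
have /ltW := h4 s erefl (Ordinal (ltnSn n)).
move/(le_trans (mean_normc_le_norm2 _)); rewrite (equivariance_error rep up).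
by [].
Qed.

(** Conversely, a family of unital positive maps with these asymptotic
    properties eventually enters every neighbourhood. *)
Lemma up_filter_limit (Y : nat -> Type) (F : set_system {i & Y i})
    (phi : forall i, Y i -> LX -> 'I_(d i) -> C) : Filter F ->
  projT1 z @[z --> F] --> \oo ->
  (\forall z \near F, unital_positive (phi _ (projT2 z))) ->
  mean_converges F mu (fun i y => real_part (phi i y)) ->
  (forall f, bm f -> concentrated (V := bm) a F (fun i y => real_part (phi i y)) f) ->
  (forall n, equivariant a sigma F (fun i y => real_part (phi i y)) (qr n)) ->
  forall A, up_filter A -> F [set z | A (existT _ (projT1 z) (phi _ (projT2 z)))].
Proof.
move=> FF big pos mc conc eq A [[[F0 [m r]] N] /= [[fF0 _] [/= m0 r0]] kA].
have [Fs FsE] : exists Fs : seq G, F0 = [set` Fs] by apply/finite_seqP.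
pose Ks := [seq (s, n) | s <- Fs, n <- iota 0 m].
have inKs s n : F0 s -> (n < m)%N -> List.In (s, n) Ks.
  rewrite FsE /= => Fs_s nm; apply: mem_In; apply/allpairsP; exists (s, n).
  by rewrite mem_iota add0n nm.
(* A vector bounded by 2 with mean at most [e] has 2-norm at most [r / 2]. *)
pose e := r ^+ 2 / 8; have e0 : 0 < e by rewrite divr_gt0// exprn_gt0.
have small n (v : 'I_n -> C) : (forall k, normc (v k) <= 2) -> mean_normc v <= e -> norm2 v < r.
  move=> v2 ve; apply: (@le_lt_trans _ _ (r / 2)); last by rewrite ltr_pdivrMr// mulr_natr mulr2n ltrDl.
  apply: (norm2_le (M := 2)) => //; first by rewrite divr_ge0// ltW.
  apply: (@le_trans _ _ (2 * e)); first by rewrite ler_pM2l.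
  by rewrite /e; lra.
have hs : \forall z \near F, forall sn, List.In sn Ks ->
    spread (real_part (phi _ (projT2 z))) (tr sn.1 (qr sn.2)) <= e / m%:R.
  apply: near_list => sn _; have [_ h] := conc _ (bqr sn.2).
  by apply: (h sn.1); rewrite divr_gt0// ltr0n.
have he : \forall z \near F, forall sn, List.In sn Ks ->
    defect a sigma (fun i y => real_part (phi i y)) (projT2 z) sn.1 (qr sn.2) <= e.
  by apply: near_list => sn _; exact: eq.
have r2 : 0 < r / 2 by rewrite divr_gt0.
(* There are infinitely many monomials in general, but finitely many of given
   length in the generators listed by [Ks]. *)
have hm j : forall f, bm f -> \forall z \near F, forall L, size L = j ->
    (forall sn, List.In sn L -> List.In sn Ks) ->
    `|mean (real_part (phi _ (projT2 z)) (f * monomial L)) - mm (f * monomial L)| <= r / 2.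
  elim: j => [|j IH] f bf.
    apply: filterS (mc f bf _ r2) => z hz [] // _ _ /=.
    by have -> : f * cst 1 = f by apply/funext => x; rewrite fctE mulr1.
  have : \forall z \near F, forall sn, List.In sn Ks -> forall L, size L = j ->
      (forall sn, List.In sn L -> List.In sn Ks) ->
      `|mean (real_part (phi _ (projT2 z)) ((f * tr sn.1 (qr sn.2)) * monomial L)) -
        mm ((f * tr sn.1 (qr sn.2)) * monomial L)| <= r / 2.
    by apply: near_list => sn _; apply: IH; apply: (fa_mul bmA) => //; exact: trV.
  apply: filterS => z hz [//|sn L] /= [Lj] LK.
  rewrite mulrA; apply: hz => //; first by apply: LK; left.
  by move=> sn' h; apply: LK; right.
have hm' : \forall z \near F, forall L, (size L <= m)%N ->
    (forall sn, List.In sn L -> List.In sn Ks) ->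
    `|mean (real_part (phi _ (projT2 z)) (monomial L)) - mm (monomial L)| <= r / 2.
  have : \forall z \near F, forall j, List.In j (iota 0 m.+1) -> forall L, size L = j ->
      (forall sn, List.In sn L -> List.In sn Ks) ->
      `|mean (real_part (phi _ (projT2 z)) (monomial L)) - mm (monomial L)| <= r / 2.
    apply: near_list => j _; apply: filterS (hm j _ (fa_cst bmA 1)) => z hz L Lj LK.
    by have := hz L Lj LK; rewrite (_ : cst 1 * monomial L = monomial L)//;
      apply/funext => x; rewrite fctE mul1r.
  apply: filterS => z hz L Lm; apply: (hz (size L)) => //.
  by apply: mem_In; rewrite mem_iota.
have bigN : \forall z \near F, (N <= projT1 z)%N.
  by apply: (big [set n | (N <= n)%N]); exists N.
apply: filterS2 (filterI pos bigN) (filterI hs (filterI he hm')) => z [up Nz] [spr [dfc mns]].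
apply: kA; split => //=.
have listK j (s : 'I_j -> G) (n : 'I_j -> 'I_m) : (forall k, F0 (s k)) ->
    forall sn, List.In sn [seq (s k, nat_of_ord (n k)) | k <- enum 'I_j] -> List.In sn Ks.
  move=> Fs_s; elim: (enum 'I_j) => [|k l IH] sn //= [<-|]; last exact: IH.
  exact: inKs.
set u := phi _ _ in up spr dfc mns *.
split => //.
- move=> j s n /andP[j0 jm] Fs_s; apply: small => [k|].
    rewrite !fctE (phi_ae up (monomialE rep s (fun k => n k)) (monomial_bm rep _)).
    rewrite (le_trans (le_normcD _ _))// normcN normc_complex.
    have -> : (\prod_(k0 < j) u (alpha_Linf (s k0) (q (n k0)))) k =
        \prod_(k0 < j) u (alpha_Linf (s k0) (q (n k0))) k.
      exact: (big_morph (fun f : 'I_(d (projT1 z)) -> C => f k)).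
    apply: (@le_trans _ _ (1 + 1)); last by [].
    apply: lerD.
      apply: (sm_bnd bmA (real_part_state up)) => [|x]; first exact: (monomial_bm rep).
      exact: (monomial_bnd rep).
    apply: (@big_ind _ (fun c : C => normc c <= 1)) => [|c c' h h'|i _].
    + by rewrite -(rmorph1 (real_complex R)) normc_complex normr1.
    + by rewrite normcM mulr_ile1 ?normc_ge0.
    + rewrite (phi_ae up (generator_translate rep (s i) (n i))) ?normc_complex; last exact: trV.
      exact: (state_generator_bnd rep up).
  rewrite (product_error rep up s (fun k => n k)).
  apply: (le_trans (product_spread rep up (e := e / m%:R) _)).
    by move=> sn h; apply: spr; exact: listK h.
  rewrite size_map size_enum_ord mulrCA ler_piMr ?(ltW e0)//.
  by rewrite ler_pdivrMr ?ltr0n// mul1r ler_nat.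
- move=> f [j [s [n [/andP[j0 jm] Fs_s ->]]]].
  rewrite (zeta_error up (monomialE rep s (fun k => n k)) (monomial_bm rep _)).
  apply: (@le_lt_trans _ _ (r / 2)); last by rewrite ltr_pdivrMr// mulr_natr mulr2n ltrDl.
  by apply: mns; [rewrite size_map size_enum_ord|exact: listK].
- move=> s Fs_s n; apply: small => [k|].
    rewrite !fctE /perm_act (phi_ae up (generator_translate rep s n)); last exact: trV.
    have [_ _ qn] := rep n; rewrite (phi_ae up qn (bqr n)).
    rewrite (le_trans (le_normcD _ _))// normcN !normc_complex.
    apply: (@le_trans _ _ (1 + 1)); last by [].
    apply: lerD; first exact: (state_generator_bnd rep up).
    by apply: (sm_bnd bmA (real_part_state up)).
  rewrite (equivariance_error rep up); exact: (dfc (s, nat_of_ord n) (inKs _ _ Fs_s (ltn_ord n))).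
Qed.

Section Distance.
Context {n : nat} (phi psi : LX -> 'I_n -> C).
Hypotheses (up : unital_positive phi) (up' : unital_positive psi).

Let mean_normcE m : mean_normc (phi (q m) - psi (q m)) =
  mean (fun k => `|real_part phi (qr m) k - real_part psi (qr m) k|).
Proof.
have [_ _ qm] := rep m.
rewrite (phi_ae up qm (bqr m)) (phi_ae up' qm (bqr m)).
by congr mean; apply/funext => k; rewrite !fctE -rmorphB normc_complex.
Qed.

Lemma rho_seq_Linf_term m e : (rho_seq q phi psi <= e%:E)%E ->
  mean (fun k => `|real_part phi (qr m) k - real_part psi (qr m) k|) <= 2 ^+ m.+1 * e.
Proof.
move=> h; rewrite -mean_normcE; apply: (le_trans (mean_normc_le_norm2 _)).
exact: (dyadic_sum_term m (fun m => norm2_ge0 _) h).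
Qed.

(** The hypothesis on [N] and [e] is what [dyadic_sum_small] provides. *)
Lemma rho_seq_Linf_small N e eps :
  (forall d (v : nat -> 'I_d -> C), (forall n k, normc (v n k) <= 2) ->
  (forall n, (n < N)%N -> mean_normc (v n) <= e) ->
  (dyadic_sum (fun n => norm2 (v n)) < eps%:E)%E) ->
  (forall m, (m < N)%N -> mean (fun k =>
    `|real_part phi (qr m) k - real_part psi (qr m) k|) <= e) ->
  (rho_seq q phi psi <= eps%:E)%E.
Proof.
move=> small h; apply/ltW/small => [m k|m mN]; last by rewrite mean_normcE; exact: h.
have [_ _ qm] := rep m.
rewrite !fctE (phi_ae up qm (bqr m)) (phi_ae up' qm (bqr m)).
rewrite (le_trans (le_normcD _ _))// normcN !normc_complex.
apply: (@le_trans _ _ (1 + 1)); last by [].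
by apply: lerD; [apply: (sm_bnd bmA (real_part_state up))|apply: (sm_bnd bmA (real_part_state up'))].
Qed.

End Distance.

End UpAsymptotics.

(** * Smearing a whole family *)

Section SmearCoupling.
Context {R : realType} {disp : measure_display} {T : measurableType disp}.
Context (mu : probability T R) (d : nat -> nat).
Local Notation C := R[i].
Local Notation bm := (@bounded_measurable R disp T).
Local Notation mm := (mean_mu mu).
Local Notation LX := (Linf mu).
Let bmA : function_algebra bm := bounded_measurable_algebra.
Context {Y : nat -> Type} (F : set_system {i & Y i}) {FF : Filter F}.
Context {V : set (T -> R)} (algV : function_algebra V) (Vbm : V `<=` bm).
Variable W : forall i, Y i -> (T -> R) -> 'I_(d i) -> R.
Hypothesis sW : \forall z \near F, state_map V (W (projT2 z)).

Lemma vanishes_sum (Z : Type) (H : set_system Z) (J : finType) (h : J -> Z -> R) :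
  Filter H -> (forall j, vanishes H (h j)) -> vanishes H (fun z => \sum_j h j z).
Proof.
move=> FH hj; have -> : (fun z => \sum_j h j z) = \sum_j h j.
  by apply/funext => z; rewrite fct_sumE.
apply: (@big_ind _ (vanishes H)) => //; last by move=> *; exact: vanishesD.
by move=> e e0; apply: nearW => z; exact: ltW.
Qed.

Lemma real_part_complexify n (U : (T -> R) -> 'I_n -> R) f : state_map bm U ->
  (forall f g, bm f -> bm g -> (\forall x \ae mu, f x = g x) -> U f = U g) ->
  bm f -> real_part (complexify (mu := mu) U) f = U f.
Proof. by move=> sU aeU bf; apply/funext => k; rewrite /real_part complexifyE. Qed.

Lemma eq_spread n (U U' : (T -> R) -> 'I_n -> R) f : (forall f, bm f -> U' f = U f) ->
  bm f -> spread U' f = spread U f.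
Proof.
move=> UU' bf; congr mean; apply/funext => k; rewrite (UU' f bf) UU'//.
exact: (fa_absB bmA).
Qed.

(** Functions that [W] sees as almost constant, and for which partitions of
    unity with prescribed means exist. *)
Variable tame : set (T -> R).
Hypothesis tameV : tame `<=` V.
Hypothesis tame_spread : forall f, tame f -> vanishes F (fun z => spread (W (projT2 z)) f).
Hypothesis tame_partition : forall (fs : seq (T -> R)) (eta : R), 0 < eta ->
  (forall f, List.In f fs -> tame f) ->
  exists (J : finType) (h : J -> T -> R),
    [/\ forall j, V (h j) /\ vanishes F (fun z => `|mean (W (projT2 z) (h j)) - mm (h j)|),
        forall j x, 0 <= h j x, forall x, \sum_j h j x = 1 &
        forall f, List.In f fs -> exists (c : J -> R) (M : R),
          [/\ forall x, `|f x| <= M, forall j, `|c j| <= M &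
            forall x, \sum_j h j x * `|f x - c j| <= eta]].

(** Smearing realizes any finite number of the asymptotic requirements up to any
    error, which is all that a coupling needs. *)
Lemma smear_coupling : exists GG : set_system {i & (Y i * (LX -> 'I_(d i) -> C))%type},
  let W1 := fun i (w : Y i * (LX -> 'I_(d i) -> C)) => W w.1 in
  let W2 := fun i (w : Y i * (LX -> 'I_(d i) -> C)) => real_part w.2 in
  [/\ Filter GG, \forall w \near GG, unital_positive (projT2 w).2,
    (forall A, F A -> GG [set w | A (existT Y (projT1 w) (projT2 w).1)]) /\
    (forall B, GG B -> exists2 A, F A & forall i y, A (existT _ i y) ->
      exists y', B (existT _ i (y, y'))),
    forall g, bm g -> vanishes GG (fun w => `|mean (W2 _ (projT2 w) g) - mm g|) &
    forall f, tame f ->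
      vanishes GG (fun w => mean (fun k => `|W2 _ (projT2 w) f k - W1 _ (projT2 w) f k|)) /\
      vanishes GG (fun w => spread (W2 _ (projT2 w)) f)].
Proof.
pose K := ({g : T -> R | bm g} + {f : T -> R | tame f})%type.
pose q (k : K) (w : {i & (Y i * (LX -> 'I_(d i) -> C))%type}) : R :=
  match k with
  | inl g => `|mean (real_part (projT2 w).2 (sval g)) - mm (sval g)|
  | inr f => mean (fun k => `|real_part (projT2 w).2 (sval f) k - W (projT2 w).1 (sval f) k|) +
     spread (real_part (projT2 w).2) (sval f)
  end.
pose S := [set w : {i & (Y i * (LX -> 'I_(d i) -> C))%type} | unital_positive (projT2 w).2].
have solve (ks : seq K) e : 0 < e -> \forall z \near F, exists y' : LX -> 'I_(d (projT1 z)) -> C,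
    let w := existT (fun i => (Y i * (LX -> 'I_(d i) -> C))%type) (projT1 z) (projT2 z, y') in
    S w /\ forall k, List.In k ks -> q k w <= e.
  move=> e0; pose fs := List.flat_map (fun k : K => if k is inr f then [:: sval f] else [::]) ks.
  have fsP f : List.In (inr f) ks -> List.In (sval f) fs.
    by move=> fk; apply/List.in_flat_map; exists (inr f); split => //; left.
  have fs_tame f : List.In f fs -> tame f.
    by move=> /List.in_flat_map[[g|[g tg]] [_ /=]] // [<-|//].
  (* The errors add up to [6 eta], [6 M] times the weight error and twice the
     spread of [W]. *)
  pose eta := e / 12; have eta0 : 0 < eta by rewrite divr_gt0.
  have [J [h [Vh h0 h1 hf]]] := tame_partition eta0 fs_tame.
  have bh j : bm (h j) by apply: Vbm; case: (Vh j).
  have VJ j : V (h j) by case: (Vh j).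
  have we : vanishes F (fun z => weight_error mu (W := W (projT2 z)) h).
    by apply: vanishes_sum => j; case: (Vh j).
  have good (k : K) : List.In k ks -> \forall z \near F, q k
      (existT (fun i => (Y i * (LX -> 'I_(d i) -> C))%type) (projT1 z)
        (projT2 z, complexify (mu := mu) (smear mu (W := W (projT2 z)) h))) <= e.
    case: k => [[g bg]|[f tf]] kks /=.
      have [M0 gM0] := bg.2; pose M := `|M0|.
      have gM x : `|g x| <= M by rewrite (le_trans (gM0 x))// ler_norm.
      apply: filterS2 sW (vanishesZ (normr_ge0 M0) we e0) => z sz; apply: le_trans.
      have sm := smear_state mu algV Vbm sz VJ h0 h1.
      rewrite real_part_complexify//; last by move=> *; exact: (smear_ae Vbm VJ).
      exact: (smear_mean mu Vbm VJ h0 h1 bg gM).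
    have [c [M [fM cM hc]]] := hf _ (fsP _ kks).
    have T0 : T := point.
    have M0 : 0 <= M by exact: le_trans (normr_ge0 _) (fM T0).
    have e8 : 0 < e / 8 by rewrite divr_gt0.
    apply: filterS3 sW (vanishesZ (mulr_ge0 (ler0n R 6) M0) we e8) (tame_spread tf e8) => z sz hwe hsp.
    have sm := smear_state mu algV Vbm sz VJ h0 h1.
    have Vf := tameV tf; have bf := Vbm Vf.
    have aeU g g' : bm g -> bm g' -> (\forall x \ae mu, g x = g' x) ->
      smear mu (W := W (projT2 z)) h g = smear mu (W := W (projT2 z)) h g'.
      by move=> *; exact: (smear_ae Vbm VJ).
    have hc1 := smear_close mu algV Vbm sz VJ h0 h1 Vf fM cM hc.
    have hc2 := smear_spread mu algV Vbm sz VJ h0 h1 Vf fM cM hc.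
    have hE f' := @real_part_complexify _ _ f' sm aeU.
    rewrite (hE _ bf) (eq_spread hE bf).
    apply: (le_trans (lerD hc1 hc2)).
    by rewrite /eta; move: hwe hsp; set v := weight_error _ _; nra.
  apply: filterS2 sW (near_list FF good) => z sz hz.
  exists (complexify (mu := mu) (smear mu (W := W (projT2 z)) h)); split => //.
  apply: complexify_unital_positive; first exact: (smear_state mu algV Vbm sz VJ h0 h1).
  by move=> *; exact: (smear_ae Vbm VJ).
have [GG [FGG SG pull vq proj]] := coupling (q := q) (S := S) FF solve.
exists GG; split => //.
- by move=> g bg; exact: (vq (inl (exist _ g bg))).
- move=> f tf; have v := vq (inr (exist _ f tf)).
  have sG : \forall w \near GG, state_map bm (real_part (projT2 w).2).
    by apply: filterS SG => w; exact: real_part_state.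
  split; apply: (vanishes_le v); apply: filterS sG => w sw /=.
    by rewrite lerDl (spread_ge0 bmA sw)//; exact/Vbm/tameV.
  by rewrite lerDr mean_ge0.
Qed.

End SmearCoupling.

(** * Transfer of growth *)

Section PairFilter.
Context {R : realType} (d : nat -> nat).

(** Along a filter of pairs on which a distance tends to 0, eventual statements
    give uniform ones: this trades epsilon-delta separation for asymptotics. *)
Lemma pair_filter (Z : nat -> Type) (GG : set_system {i & Z i})
    (rho : forall i, Z i -> Z i -> \bar R) : Filter GG ->
  exists PF : set_system {i & (Z i * Z i)%type}, [/\ Filter PF,
    (forall A, GG A -> PF [set z | A (existT Z (projT1 z) (projT2 z).1)]),
    (forall A, GG A -> PF [set z | A (existT Z (projT1 z) (projT2 z).2)]),
    (forall e, 0 < e -> \forall z \near PF, (rho _ (projT2 z).1 (projT2 z).2 <= e%:E)%E) &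
    forall P : forall i, Z i -> Z i -> Prop,
      (\forall z \near PF, P _ (projT2 z).1 (projT2 z).2) ->
      exists2 e, 0 < e & exists2 B, GG B & forall i z1 z2,
        B (existT _ i z1) -> B (existT _ i z2) -> (rho i z1 z2 <= e%:E)%E -> P i z1 z2].
Proof.
move=> FG.
pose base (Be : set {i & Z i} * R) : set {i & (Z i * Z i)%type} := [set z |
  [/\ Be.1 (existT Z (projT1 z) (projT2 z).1), Be.1 (existT Z (projT1 z) (projT2 z).2) &
    (rho _ (projT2 z).1 (projT2 z).2 <= Be.2%:E)%E]].
pose D := [set Be : set {i & Z i} * R | GG Be.1 /\ 0 < Be.2].
exists (filter_from D base); split.
- apply: filter_from_filter.
    by exists (setT, 1); split => //=; exact: filterT.
  move=> [B e] [B' e'] [/= GB e0] [/= GB' e'0]; exists (B `&` B', Num.min e e').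
    by split => /=; [exact: filterI|rewrite lt_min e0].
  move=> z [/= [Bz1 B'z1] [Bz2 B'z2] h]; split; split => //=;
    by apply: (le_trans h); rewrite lee_fin ge_min lexx ?orbT.
- by move=> A GA; exists (A, 1) => [|z []//]; split.
- by move=> A GA; exists (A, 1) => [|z []//]; split.
- move=> e e0; exists (setT, e) => [|z []//]; split => //=; exact: filterT.
- move=> P [[B e] [/= GB e0] h]; exists e => //; exists B => // i z1 z2 Bz1 Bz2 r.
  exact: (h (existT (fun i => (Z i * Z i)%type) i (z1, z2))).
Qed.

Hypothesis dy : d i @[i --> \oo] --> \oo.

(** A family [GG] of pairs of microstates of two kinds transfers growth from
    [F] to [H] when, for every large set of [H], large sets of [F] can be
    mapped into it along [GG] without bringing points together. *)
Lemma growth_transfer (Y Y' Z : nat -> Type)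
    (pr : forall i, Z i -> Y i) (pr' : forall i, Z i -> Y' i)
    (rho : forall i, Y i -> Y i -> \bar R)
    (rho' : forall i, Y' i -> Y' i -> \bar R) eps eps'
    (F : set_system {i & Y i}) (H : set_system {i & Y' i})
    (GG : set_system {i & Z i}) : Filter GG ->
  (forall B, GG B -> exists2 A, F A & forall i y, A (existT _ i y) ->
    exists2 z, B (existT _ i z) & pr i z = y) ->
  (forall C, H C -> GG [set z | C (existT Y' (projT1 z) (pr' _ (projT2 z)))]) ->
  (forall i y, (rho' i y y <= eps'%:E)%E) ->
  (exists2 B, GG B & forall i z1 z2, B (existT _ i z1) -> B (existT _ i z2) ->
    (rho' i (pr' i z1) (pr' i z2) <= eps'%:E)%E -> (rho i (pr i z1) (pr i z2) <= eps%:E)%E) ->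
  (growth d rho eps F <= growth d rho' eps' H)%E.
Proof.
move=> FGG proj HG r0 [B GB Bsep]; apply: le_ereal_inf_tmp => _ [C HC <-].
have [A FA AB] := proj _ (filterI GB (HG _ HC)).
apply: le_trans (_ : rate d rho eps A <= _)%E.
  by apply: ereal_inf_lbound; exists A.
apply: le_rate; near=> i.
have [z0|] := pselect (exists z : Z i, True); last first.
  move=> nz; rewrite (_ : @fiber _ A i = set0); last first.
    by apply/seteqP; split => // y /AB[z _ _]; apply: nz; exists z.
  exact: le_trans (separation_number_set0 _ _) (separation_number_ge0 _ _ _).
pose good := B `&` [set z | C (existT Y' (projT1 z) (pr' _ (projT2 z)))].
have /choice[f fP] : forall y, exists z, @fiber _ A i y ->
    good (existT Z i z) /\ pr i z = y.
  move=> y; have [/AB[z Bz zy]|nAy] := pselect (@fiber _ A i y); first by exists z.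
  by have [z _] := z0; exists z.
apply: (@le_separation_number _ _ _ _ _ _ _ _ _ (fun y => pr' i (f y))).
- by move=> y /fP[[]].
- by move=> y _; exact: r0.
- move=> y z /fP[[By _] fy] /fP[[Bz _] fz] h.
  by rewrite -fy -fz; exact: Bsep By Bz h.
Unshelve. all: by end_near. Qed.

Lemma rho_seq_refl (V : Type) (p : nat -> V) n (phi : V -> 'I_n -> R[i]) e :
  0 <= e -> (rho_seq p phi phi <= e%:E)%E.
Proof.
move=> e0; rewrite /rho_seq eseries0 ?lee_fin// => m _ _.
have -> : norm2 (phi (p m) - phi (p m)) = 0; last by rewrite mulr0.
apply/eqP; rewrite eq_le norm2_ge0 andbT; apply: (norm2_le (M := 0)) => //.
  by move=> k; rewrite !fctE subrr -(rmorph0 (real_complex R)) normc_complex normr0.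
by rewrite mul0r sqr_ge0.
Qed.

End PairFilter.

Section Limits.
Context {R : realType} {G : groupType} {X : topologicalType}.
Variables (a : cts_action G X) (d : nat -> nat) (sigma : forall i, G -> 'S_(d i)).
Local Notation tr := (translate a).
Local Notation C := R[i].
Local Notation CX := (continuousType X C).

Lemma equivariant_close (Y : nat -> Type) (F : set_system {i & Y i})
    (U U' : forall i, Y i -> (X -> R) -> 'I_(d i) -> R) f : Filter F ->
  equivariant a sigma F U f ->
  (forall s, vanishes F (fun z =>
    mean (fun k => `|U' _ (projT2 z) (tr s f) k - U _ (projT2 z) (tr s f) k|))) ->
  equivariant a sigma F U' f.
Proof.
move=> FF ef close s; have c1 := close 1%g; rewrite translate1 in c1.
apply: (vanishes_le (vanishesD (ef s) (vanishesD (close s) c1))).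
apply: nearW => z; set u := U _ _; set u' := U' _ _.
rewrite -(mean_perm (sigma (projT1 z) s) (fun k => `|u' (tr s f) k - _|)) -!meanD.
apply: mean_le => k; set k' := sigma _ s k.
rewrite (_ : u' (tr s f) k' - u' f k = (u (tr s f) k' - u f k) +
  ((u' (tr s f) k' - u (tr s f) k') - (u' f k - u f k))); last by ring.
rewrite (le_trans (ler_normD _ _))// lerD2l.
by rewrite (le_trans (ler_normD _ _))// normrN.
Qed.

Hypothesis cX : compact [set: X].
Variable p : nat -> CX.
Hypothesis ball : unit_ball_cts p.

(** Evaluations at points that are asymptotically equivariant at the generators
    eventually enter every neighbourhood. *)
Lemma hom_filter_limit (Y : nat -> Type) (F : set_system {i & Y i})
    (phi : forall i, Y i -> CX -> 'I_(d i) -> C) : Filter F ->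
  projT1 z @[z --> F] --> \oo ->
  (\forall z \near F, exists x, evaluates (phi _ (projT2 z)) x) ->
  (forall n, equivariant a sigma F (fun i y => hom_real (phi i y)) (real_gen p n)) ->
  forall A, hom_filter a sigma p A ->
    F [set z | A (existT _ (projT1 z) (phi _ (projT2 z)))].
Proof.
move=> FF big ev eq A [[[F0 r] N] /= [[fF0 _] /= r0] kA].
have [Fs FsE] : exists Fs : seq G, F0 = [set` Fs] by apply/finite_seqP.
have [M [e [e0 h]]] := evaluates_HomS a ball r0.
pose Ks := [seq (s, n) | s <- Fs, n <- iota 0 M].
have he : \forall z \near F, forall sn, List.In sn Ks ->
    defect a sigma (fun i y => hom_real (phi i y)) (projT2 z) sn.1 (real_gen p sn.2) <= e.
  by apply: near_list => sn _; exact: eq.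
have bigN : \forall z \near F, (N <= projT1 z)%N.
  by apply: (big [set n | (N <= n)%N]); exists N.
apply: filterS3 ev bigN he => z [x ex] Nz hz; apply: kA; split => //=.
have -> : phi _ (projT2 z) = fun f k => f (x k).
  by apply/funext => f; apply/funext => k; exact: ex.
apply: h => s m Fs_s mM.
have sK : List.In (s, m) Ks.
  apply: mem_In; apply/allpairsP; exists (s, m); rewrite mem_iota add0n mM.
  by rewrite FsE /= in Fs_s.
have := hz _ sK; rewrite /defect !(evaluates_real ex)//.
- exact: real_gen_continuous.
- exact/cts_real_translate/real_gen_continuous.
Qed.

End Limits.

(** * From topological microstates to an invariant measure *)

Section Density.
Context {R : realType} {G : groupType} {X : metricType R}.
Variables (a : cts_action G X) (d : nat -> nat) (sigma : forall i, G -> 'S_(d i)).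
Hypothesis cX : compact [set: X].
Variable mu : invariant_measure R a.
Local Notation T := (borel (im_nonempty mu)).
Local Notation bm := (@bounded_measurable R _ T).
Let bmA : function_algebra bm := bounded_measurable_algebra.
Let trV : translate_closed a bm := @bounded_measurable_translate _ _ _ _ mu.
Context {Y : nat -> Type} (F : set_system {i & Y i}) {FF : Filter F}.
Variable U : forall i, Y i -> (X -> R) -> 'I_(d i) -> R.
Hypothesis sU : \forall z \near F, state_map bm (U (projT2 z)).
Hypothesis mU : mean_converges F mu U.

(** For families whose means tend to [mu], continuous functions are dense in the
    relevant sense. *)
Lemma dense_concentrated : (forall f, cts_real f -> concentrated (V := bm) a F U f) ->
  forall f, bm f -> concentrated (V := bm) a F U f.
Proof.
move=> h f bf; apply: (concentrated_lim bmA trV sU) => // e e0.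
have [g cg fg] := continuous_dense cX mu bf (divr_gt0 e0 (ltr0n R 2)).
exists g; first exact: h.
by move=> s; apply: (mean_close mU) => //; exact: continuous_bounded_measurable.
Qed.

Lemma dense_equivariant : (forall f, cts_real f -> equivariant a sigma F U f) ->
  forall f, bm f -> equivariant a sigma F U f.
Proof.
move=> h f bf; apply: (equivariant_lim bmA trV sU) => // e e0.
have [g cg fg] := continuous_dense cX mu bf (divr_gt0 e0 (ltr0n R 2)).
have bg : bm g by exact: continuous_bounded_measurable.
exists g; first by split => //; exact: h.
by move=> s; exact: (mean_close mU).
Qed.

End Density.

Section TopLeMeasure.
Context {R : realType} {G : groupType} {X : metricType R}.
Variables (a : cts_action G X) (d : nat -> nat) (sigma : forall i, G -> 'S_(d i)).
Hypothesis cX : compact [set: X].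
Hypothesis dy : d i @[i --> \oo] --> \oo.
Hypothesis sigmaM : asymptotically_multiplicative R sigma.
Local Notation C := R[i].
Local Notation CX := (continuousType X C).
Local Notation tr := (translate a).
Let ctA := @cts_real_algebra R X cX.
Variable p : nat -> CX.
Hypotheses (ball : unit_ball_cts p) (gen : dyn_generating_cts a p).
Local Notation homs := (fun i => CX -> 'I_(d i) -> C).
Local Notation UH := (fun i (phi : CX -> 'I_(d i) -> C) => hom_real phi).

Lemma hom_filter_equivariant_cts f : cts_real f ->
  equivariant a sigma (hom_filter a sigma p) UH f.
Proof.
move=> cf; apply: (generated_continuous dy sigmaM _ cX _ gen ball _ _ cf).2.
- exact: hom_filter_big.
- exact: hom_filter_state.
- by move=> n; apply: hom_filter_concentrated => //; exact: real_gen_continuous.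
- by move=> n; exact: hom_filter_equivariant.
Qed.

Section OneUltrafilter.
Variable UF : set_system {i & homs i}.
Context {UU : UltraFilter UF}.
Hypothesis subU : hom_filter a sigma p `<=` UF.
Variable mu : invariant_measure R a.
Hypothesis limU : forall f, cts_real f ->
  mean (hom_real (projT2 z) f) @[z --> UF] --> mean_mu mu f.
Local Notation T := (borel (im_nonempty mu)).
Local Notation bm := (@bounded_measurable R _ T).
Let bmA : function_algebra bm := bounded_measurable_algebra.
Let ctbm : (@cts_real R X) `<=` bm.
Proof. by move=> f; exact: continuous_bounded_measurable. Qed.
Local Notation LX := (Linf mu).
Let FF : Filter UF := @filter_filter _ _ (@ultra_proper _ _ UU).

Variables (q : nat -> LX) (qr : nat -> T -> R).
Hypotheses (rep : represents q qr) (genq : dyn_generating_Linf q).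

(** Closeness of two microstates of [mu] at the generators [q] implies, for
    pairs along the coupling, closeness at all functions, in particular at the
    generators [p], where the states agree with the evaluations. *)
Lemma growth_hom_up (eps : R) : 0 < eps -> exists2 eps', 0 < eps' &
  (growth d (fun i => rho_seq p) eps UF <=
   growth d (fun i => rho_seq q) eps' (up_filter sigma q))%E.
Proof.
move=> eps0.
have sH : \forall z \near UF, state_map (@cts_real R X) (hom_real (projT2 z)).
  by apply: subU; exact: hom_filter_state.
have eH : \forall z \near UF, exists x, evaluates (projT2 z) x.
  by apply: subU; exact: hom_filter_evaluates.
have bqr n : bm (qr n) by case: (rep n).
have [|||GG [FGG pos [pull proj] mc close]] :=
  @smear_coupling R _ T mu d homs UF FF _ ctA ctbm UH sH (@cts_real R X).
- by [].
- move=> f cf e e0; apply: filterS eH => z [x ex].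
  by rewrite (evaluates_spread cX ex) ?ltW.
- move=> fs eta eta0 cfs.
  have [J [c [h [ch h0 h1 hf]]]] := adapted_partition cX eta0 cfs.
  exists J, h; split => //.
    move=> j; split; first exact: ch.
    move=> e e0; have /cvgrPdist_le /(_ _ e0) := limU (ch j).
    by apply: filterS => z; rewrite distrC.
  move=> f ffs; have [M fM] := fa_bnd ctA (cfs _ ffs).
  by exists (fun j => f (c j)), M; split => //; exact: hf.
pose U1 := fun i (w : homs i * (LX -> 'I_(d i) -> C)) => hom_real w.1.
pose U2 := fun i (w : homs i * (LX -> 'I_(d i) -> C)) => @real_part R _ T mu _ w.2.
have big1 : projT1 z @[z --> UF] --> \oo.
  by move=> A /(@hom_filter_big R G X a d sigma p); exact: subU.
have big : projT1 z @[z --> GG] --> \oo .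
  by move=> A /big1 h; exact: (pull _ h).
have s2 : \forall z \near GG, state_map bm (U2 _ (projT2 z)).
  by apply: filterS pos => z; exact: real_part_state.
have mc2 : mean_converges GG mu U2 by [].
have eq1 f : cts_real f -> equivariant a sigma GG U1 f.
  by move=> cf s e e0; exact: (pull _ (subU (hom_filter_equivariant_cts cf s e0))).
have ctr s (f : X -> R) : @cts_real R X f -> cts_real (tr s f) by exact: cts_real_translate.
have conc2 : forall f, bm f -> concentrated (V := bm) a GG U2 f.
  apply: (dense_concentrated cX s2 mc2) => f cf; split => [|s]; first exact: ctbm.
  by have [_] := close _ (ctr s _ cf).
have eq2 : forall f, bm f -> equivariant a sigma GG U2 f.
  apply: (dense_equivariant cX s2 mc2) => f cf.
  apply: (equivariant_close FGG (eq1 f cf)) => s.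
  by have [] := close _ (ctr s _ cf).
have upl := up_filter_limit rep FGG big pos mc2 conc2 (fun n => eq2 _ (bqr n)).
have [PF [FPF pull1 pull2 small sep]] := pair_filter
  (fun i (w w' : homs i * (LX -> 'I_(d i) -> C)) => rho_seq q w.2 w'.2) FGG.
have /(sep (fun i (w w' : homs i * (LX -> 'I_(d i) -> C)) => (rho_seq p w.1 w'.1 <= eps%:E)%E))[eps' eps'0 [B GB Bsep]] : \forall z \near PF,
    (rho_seq p (projT2 z).1.1 (projT2 z).2.1 <= eps%:E)%E; last first.
  exists eps' => //; apply: (@growth_transfer R d homs _ _
    (fun i (w : homs i * (LX -> 'I_(d i) -> C)) => w.1) (fun i w => w.2) _ _ _ _ _ _ GG).
  - move=> A GA; have [A' FA' h] := proj _ GA; exists A' => // i y /h[y' Ay'].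
    by exists (y, y').
  - exact: upl.
  - by move=> i y; apply: rho_seq_refl; exact: ltW.
  - by exists B.
have pos1 : \forall z \near PF, unital_positive (projT2 z).1.2 by exact: (pull1 _ pos).
have pos2 : \forall z \near PF, unital_positive (projT2 z).2.2 by exact: (pull2 _ pos).
have qclose n : vanishes PF (fun z => mean (fun k =>
    `|real_part (projT2 z).1.2 (qr n) k - real_part (projT2 z).2.2 (qr n) k|)).
  move=> e e0; have r0 : 0 < e / 2 ^+ n.+1 by rewrite divr_gt0// exprn_gt0.
  apply: filterS3 pos1 pos2 (small _ r0) => z p1 p2 /(rho_seq_Linf_term rep p1 p2 n).
  by rewrite mulrCA mulfV ?mulr1// expf_neq0.
pose V1 := fun i (w : (homs i * (LX -> 'I_(d i) -> C)) * (homs i * (LX -> 'I_(d i) -> C))) => U2 i w.1.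
pose V2 := fun i (w : (homs i * (LX -> 'I_(d i) -> C)) * (homs i * (LX -> 'I_(d i) -> C))) => U2 i w.2.
have qE n : \forall x \ae mu, q n x = (qr n x)%:C%C by case: (rep n).
have asy : forall f, bm f -> asymptotic a PF V1 V2 f.
  apply: (@asymptotic_measurable R G X a d sigma _ PF FPF V1 V2 mu
    (pull1 _ s2) (pull2 _ s2) q qr genq bqr qE) => //.
  - by move=> g bg e e0; exact: (pull1 _ (mc2 g bg e e0)).
  - by move=> g bg e e0; exact: (pull2 _ (mc2 g bg e e0)).
  - by move=> f bf; split=> // s e e0; exact: (pull1 _ ((conc2 f bf).2 s e e0)).
  - by move=> f bf; split=> // s e e0; exact: (pull2 _ ((conc2 f bf).2 s e e0)).
  - by move=> n s e e0; exact: (pull1 _ (eq2 _ (bqr n) s e e0)).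
  - by move=> n s e e0; exact: (pull2 _ (eq2 _ (bqr n) s e e0)).
have pclose n : vanishes PF (fun z => mean (fun k =>
    `|hom_real (projT2 z).1.1 (real_gen p n) k - hom_real (projT2 z).2.1 (real_gen p n) k|)).
  have cp : cts_real (real_gen p n) by exact: real_gen_continuous.
  pose gap i (w : homs i * (LX -> 'I_(d i) -> C)) := mean (fun k =>
    `|U2 i w (real_gen p n) k - U1 i w (real_gen p n) k|).
  have v1 : vanishes PF (fun z => gap _ (projT2 z).1).
    by move=> e e0; exact: (pull1 _ ((close _ cp).1 e e0)).
  have v2 : vanishes PF (fun z => gap _ (projT2 z).2).
    by move=> e e0; exact: (pull2 _ ((close _ cp).1 e e0)).
  have := asy _ (ctbm cp) 1%g; rewrite translate1 => v3.
  apply: (vanishes_le (vanishesD v1 (vanishesD v2 v3))); apply: nearW => z.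
  rewrite -!meanD; apply: mean_le => k; rewrite /V1 /V2 /U2 /U1 /=.
  set u1 := hom_real _ _ _; set u2 := hom_real _ _ _; set w1 := real_part _ _ _.
  set w2 := real_part _ _ _.
  rewrite (_ : u1 - u2 = - (w1 - u1) + ((w2 - u2) + (w1 - w2))); last by ring.
  rewrite (le_trans (ler_normD _ _))// normrN lerD2l.
  exact: ler_normD.
have eH1 : \forall z \near GG, exists x, evaluates (projT2 z).1 x by exact: (pull _ eH).
have [N [e [e0 hs]]] := dyadic_sum_small eps0.
have pN : \forall z \near PF, forall n, List.In n (iota 0 N) -> mean (fun k =>
    `|hom_real (projT2 z).1.1 (real_gen p n) k - hom_real (projT2 z).2.1 (real_gen p n) k|) <= e.
  by apply: near_list => n _; exact: pclose.
apply: filterS3 (pull1 _ eH1) (pull2 _ eH1) pN => z [x ex] [y ey] hz.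
apply: (rho_seq_cts_small ball ex ey hs) => m mN; apply: hz; apply: mem_In.
by rewrite mem_iota.
Qed.

End OneUltrafilter.

(** Topological microstates that grow fast are equidistributed with respect to
    an invariant measure, along an ultrafilter; smeared, they become microstates
    of that measure. *)
Lemma top_le_measure (h : R) : (h%:E < top_entropy_seq a sigma p)%E ->
  exists mu : invariant_measure R a, forall q : nat -> Linf mu,
    unit_ball_Linf q -> dyn_generating_Linf q -> (h%:E <= measure_entropy_seq sigma q)%E.
Proof.
rewrite top_entropy_growth => /ereal_sup_gt[_ [eps eps0 <-]] hgrow.
have [UF [UU subU hU]] := growth_ultrafilter dy (hom_filter_filter a sigma p) hgrow.
have FF : Filter UF := @filter_filter _ _ (@ultra_proper _ _ UU).
have PF : ProperFilter UF := @ultra_proper _ _ UU.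
(* A microstate in positive dimension evaluates at some point. *)
have X0 : [set: X] !=set0.
  have dz : \forall z \near hom_filter a sigma p, (0 < d (projT1 z))%N.
    exact: (hom_filter_big a sigma p (d_gt0 dy)).
  have [z [dz' [x _]]] := filter_ex (filterI (subU _ dz) (subU _ (hom_filter_evaluates a sigma cX p))).
  by exists (x (Ordinal dz')).
have [mu limU] : exists mu : invariant_measure R a,
    forall f, cts_real f -> mean (hom_real (projT2 z) f) @[z --> UF] --> mean_mu mu f.
  have sH : \forall z \near UF, state_map (@cts_real R X) (hom_real (projT2 z)).
    by apply: subU; exact: hom_filter_state.
  have eH f : cts_real f -> equivariant a sigma UF UH f.
    by move=> cf s e e0; exact: (subU _ (hom_filter_equivariant_cts cf s e0)).
  have big : projT1 z @[z --> UF] --> \oo.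
    by move=> A /(@hom_filter_big R G X a d sigma p); exact: subU.
  exact: (@limit_invariant_measure R G X a d sigma cX X0 dy homs UF UU UH sH eH big).
exists mu => q ballq genq; have [qr rep] := unit_ball_represents ballq.
have [eps' eps'0 hle] := growth_hom_up subU limU rep genq eps0.
apply: (le_trans hU); apply: (le_trans hle).
by rewrite measure_entropy_growth; apply: ereal_sup_ubound; exists eps'.
Qed.

End TopLeMeasure.

(** * From an invariant measure to topological microstates *)

Section MeasureLeTop.
Context {R : realType} {G : groupType} {X : metricType R}.
Variables (a : cts_action G X) (d : nat -> nat) (sigma : forall i, G -> 'S_(d i)).
Hypothesis cX : compact [set: X].
Hypothesis dy : d i @[i --> \oo] --> \oo.
Hypothesis sigmaM : asymptotically_multiplicative R sigma.
Local Notation C := R[i].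
Local Notation CX := (continuousType X C).
Local Notation tr := (translate a).
Let ctA := @cts_real_algebra R X cX.
Variable mu : invariant_measure R a.
Local Notation T := (borel (im_nonempty mu)).
Local Notation bm := (@bounded_measurable R _ T).
Local Notation mm := (mean_mu mu).
Let bmA : function_algebra bm := bounded_measurable_algebra.
Let trV : translate_closed a bm := @bounded_measurable_translate _ _ _ _ mu.
Let ctbm : (@cts_real R X) `<=` bm.
Proof. by move=> f; exact: continuous_bounded_measurable. Qed.
Local Notation LX := (Linf mu).
Local Notation ups := (fun i => LX -> 'I_(d i) -> C).
Local Notation homs := (fun i => CX -> 'I_(d i) -> C).

(** A state cannot be smaller than the infimum of the function it is applied to:
    apply this to the sum of the deviations of the given functions. *)
Lemma state_point n (U : (T -> R) -> 'I_n -> R) (fs : seq (T -> R)) (t : R) k :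
  state_map bm U -> (forall f, List.In f fs -> bm f) -> 0 < t ->
  exists x : T, forall f, List.In f fs -> `|f x - U f k| <=
    \sum_(g <- fs) U (absf (g - cst (U g k))) k + t.
Proof.
move=> sU bfs t0.
(* One function whose smallness at a point bounds all deviations. *)
pose dev x := \sum_(g <- fs) `|g x - U g k|.
have [bdev Udev] : bm dev /\ U dev k = \sum_(g <- fs) U (absf (g - cst (U g k))) k.
  rewrite /dev; elim: fs bfs {dev} => [_|f fs IH bfs].
    rewrite (_ : (fun _ => _) = cst 0); last by apply/funext => x; rewrite big_nil.
    by rewrite big_nil (sm_zero bmA sU); split => //; exact: (fa_cst bmA).
  have [|b e] := IH; first by move=> g gfs; apply: bfs; right.
  have bf : bm (absf (f - cst (U f k))) by apply: (fa_absB bmA); apply: bfs; left.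
  rewrite (_ : (fun x => _) = absf (f - cst (U f k)) + (fun x => \sum_(g <- fs) `|g x - U g k|)).
    rewrite (sm_add sU)// big_cons e; split => //; exact: (fa_add bmA).
  by apply/funext => x; rewrite big_cons.
have [x hx] : exists x, dev x <= U dev k + t.
  apply: contrapT => h.
  have := sm_mono sU k (fa_cst bmA (U dev k + t)) bdev.
  rewrite (sm_cst bmA sU) => hm.
  have : U dev k + t <= U dev k.
    by apply: hm => x /=; rewrite leNgt; apply/negP => hx; apply: h; exists x; exact: ltW.
  by rewrite leNgt ltrDl t0.
exists x => f ffs; rewrite -Udev; apply: le_trans hx; rewrite /dev.
elim: fs ffs {bfs dev bdev Udev} => // g fs IH [<-|/IH h]; rewrite big_cons.
  by rewrite lerDl; apply: sumr_ge0 => *; exact: normr_ge0.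
by rewrite (le_trans h)// lerDr.
Qed.

(** Points are chosen coordinate by coordinate, for finitely many functions at a
    time; the mean over the coordinates of the errors is a sum of spreads. *)
Lemma point_coupling (Y : nat -> Type) (F : set_system {i & Y i})
    (U : forall i, Y i -> (T -> R) -> 'I_(d i) -> R) : Filter F ->
  (\forall z \near F, state_map bm (U _ (projT2 z))) ->
  (forall f, cts_real f -> vanishes F (fun z => spread (U _ (projT2 z)) f)) ->
  exists GG : set_system {i & (Y i * homs i)%type},
    [/\ Filter GG, \forall w \near GG, exists x, evaluates (projT2 w).2 x,
    (forall A, F A -> GG [set w | A (existT Y (projT1 w) (projT2 w).1)]),
    (forall B, GG B -> exists2 A, F A & forall i y, A (existT _ i y) ->
      exists y', B (existT _ i (y, y'))) &
    forall f, cts_real f -> vanishes GG (fun w => mean (fun k =>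
      `|hom_real (projT2 w).2 f k - U _ (projT2 w).1 f k|))].
Proof.
move=> FF sU conc.
pose q (f : {f : X -> R | cts_real f}) (w : {i & (Y i * homs i)%type}) : R :=
  mean (fun k => `|hom_real (projT2 w).2 (sval f) k - U _ (projT2 w).1 (sval f) k|).
pose S := [set w : {i & (Y i * homs i)%type} | exists x, evaluates (projT2 w).2 x].
have solve (ks : seq {f : X -> R | cts_real f}) e : 0 < e ->
    \forall z \near F, exists y' : homs (projT1 z),
    let w := existT (fun i => (Y i * homs i)%type) (projT1 z) (projT2 z, y') in
    S w /\ forall k, List.In k ks -> q k w <= e.
  move=> e0; pose fs : seq (T -> R) := map sval ks.
  have cfs f : List.In f fs -> cts_real f.
    by move=> /List.in_map_iff[g [<- _]]; exact: (svalP g).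
  pose e1 := e / 2 / (size fs).+1%:R.
  have e10 : 0 < e1 by rewrite !divr_gt0.
  have hs : \forall z \near F, forall f, List.In f fs -> spread (U _ (projT2 z)) f <= e1.
    by apply: near_list => f /cfs cf; exact: conc.
  apply: filterS2 sU hs => z sz hz.
  have e20 : 0 < e / 2 by rewrite divr_gt0.
  have /choice[x xP] k := @state_point _ _ fs (e / 2) k sz (fun f ff => ctbm (cfs f ff)) e20.
  exists (fun (f : CX) k => f (x k)); split; first by exists x.
  move=> [f cf] fk; rewrite /q /=.
  have ev : evaluates (fun (f : CX) k => f (x k)) x by [].
  rewrite (evaluates_real ev cf).
  have ffs : List.In f fs by apply/List.in_map_iff; exists (exist _ f cf).
  apply: (@le_trans _ _ (mean (fun k => \sum_(g <- fs) U _ (projT2 z)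
      (absf (g - cst (U _ (projT2 z) g k))) k + e / 2))).
    by apply: mean_le => k; exact: xP.
  rewrite meanD [leRHS]splitr; apply: lerD; last exact/mean_cst_le/ltW.
  have -> : mean (fun k => \sum_(g <- fs) U _ (projT2 z) (absf (g - cst (U _ (projT2 z) g k))) k)
      = \sum_(g <- fs) spread (U _ (projT2 z)) g.
    by rewrite /mean exchange_big /= mulr_sumr.
  apply: (@le_trans _ _ ((size fs)%:R * e1)).
    elim: (fs) hz => [|g gs IH] hz; first by rewrite big_nil mul0r.
    rewrite big_cons -natr1 mulrDl mul1r addrC; apply: lerD.
      by apply: IH => f' h; apply: hz; right.
    by apply: hz; left.
  rewrite /e1 mulrCA ler_piMr ?(ltW e20)// ler_pdivrMr// mul1r ler_nat.
  exact: leqnSn.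
have [GG [FGG SG pull vq proj]] := coupling (q := q) (S := S) FF solve.
exists GG; split => // f cf; exact: (vq (exist _ f cf)).
Qed.

Variables (q : nat -> LX) (qr : nat -> T -> R).
Hypotheses (rep : represents q qr) (genq : dyn_generating_Linf q).
Local Notation upF := (up_filter sigma q).
Local Notation UR := (fun i (phi : LX -> 'I_(d i) -> C) => @real_part R _ T mu _ phi).

Let bqr n : bm (qr n). Proof. by case: (rep n). Qed.
Let qr1 n x : `|qr n x| <= 1. Proof. by case: (rep n). Qed.
Let qE n : \forall x \ae mu, q n x = (qr n x)%:C%C. Proof. by case: (rep n). Qed.

Let generators : set (T -> R) := [set f | exists s n, f = tr s (qr n)].

(** Functions whose mean under microstates is asymptotically [mu]; the factor
    [monomial qr L] is there so that the class is closed under multiplication by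
    generators. *)
Let polynomial : set (T -> R) := [set f | bm f /\ forall L, vanishes upF
  (fun z => `|mean (real_part (projT2 z) (f * monomial qr L)) - mm (f * monomial qr L)|)].

Let polynomial_lin (c : R) f g : polynomial f -> polynomial g -> polynomial (c *: f + g).
Proof.
move=> [bf hf] [bg hg]; split=> [|L]; first exact: (fa_lin bmA).
have bL := monomial_bm rep L.
have bfL := fa_mul bmA bf bL; have bgL := fa_mul bmA bg bL.
apply: (vanishes_le (vanishesD (vanishesZ (normr_ge0 c) (hf L)) (hg L))).
apply: filterS (up_filter_state sigma q) => z sz.
have -> : (c *: f + g) * monomial qr L = c *: (f * monomial qr L) + g * monomial qr L.
  by apply/funext => x; rewrite !fctE /GRing.scale/=; ring.
rewrite mean_mu_lin// (_ : real_part _ _ = fun k => c * real_part (projT2 z) (f * monomial qr L) k +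
  real_part (projT2 z) (g * monomial qr L) k); last by apply/funext => k; rewrite (sm_lin sz).
rewrite meanD meanZ -normrM; set u := mean _; set v := mean _.
rewrite (_ : _ - _ = c * (u - mm (f * monomial qr L)) + (v - mm (g * monomial qr L))).
  exact: ler_normD.
by ring.
Qed.

Let polynomial_mul y f : generators y -> polynomial f -> polynomial (f * y).
Proof.
move=> [s [n ->]] [bf hf]; split=> [|L]; first by apply: (fa_mul bmA) => //; exact: trV.
have := hf ((s, n) :: L).
by rewrite (_ : f * monomial qr ((s, n) :: L) = f * tr s (qr n) * monomial qr L)//= mulrA.
Qed.

Let polynomial_one : polynomial (cst 1).
Proof.
split=> [|L]; first exact: (fa_cst bmA).
have -> : cst 1 * monomial qr L = monomial qr L by apply/funext => x; rewrite fctE mul1r.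
exact: up_filter_mean.
Qed.

Lemma up_partition (fs : seq (T -> R)) (eta : R) : 0 < eta ->
  (forall f, List.In f fs -> generators f) ->
  exists (J : finType) (h : J -> T -> R),
    [/\ forall j, bm (h j) /\ vanishes upF (fun z => `|mean (real_part (projT2 z) (h j)) - mm (h j)|),
        forall j x, 0 <= h j x, forall x, \sum_j h j x = 1 &
        forall f, List.In f fs -> exists (c : J -> R) (M : R),
          [/\ forall x, `|f x| <= M, forall j, `|c j| <= M &
            forall x, \sum_j h j x * `|f x - c j| <= eta]].
Proof.
move=> eta0 gfs.
have g1 y : generators y -> forall x, `|y x| <= 1 by move=> [s [n ->]] x; exact: qr1.
have [||J [h [Ph h0 h1 hf]]] := bernstein_partition eta0 polynomial_one polynomial_lin (fs := fs).
- by move=> y f /gfs; exact: polynomial_mul.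
- by move=> y /gfs /g1.
exists J, h; split => // [j|f ffs].
  have [bh vh] := Ph j; split => //; have := vh [::].
  by rewrite (_ : h j * monomial qr [::] = h j)//; apply/funext => x; rewrite fctE mulr1.
have [c c1 hc] := hf f ffs; exists c, 1; split => //; exact/g1/gfs.
Qed.

Variable p : nat -> CX.
Hypotheses (ball : unit_ball_cts p) (gen : dyn_generating_cts a p).

(** Closeness of the points at the generators [p] implies closeness at all
    continuous functions; these approximate the generators [q] in the L1 norm,
    and the means of the smeared states are asymptotically [mu]. *)
Lemma growth_up_hom (eps : R) : 0 < eps -> exists2 eps', 0 < eps' &
  (growth d (fun i => rho_seq q) eps upF <=
   growth d (fun i => rho_seq p) eps' (hom_filter a sigma p))%E.
Proof.
move=> eps0; have FF : Filter upF by exact: up_filter_filter.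
have sU := up_filter_state sigma q.
have [|||GG1 [FGG1 pos1 [pull1 proj1] mc1 close1]] :=
  @smear_coupling R _ T mu d ups upF FF bm bmA (fun f bf => bf) UR sU generators.
- by move=> _ [s [n ->]]; exact: trV.
- by move=> _ [s [n ->]]; exact: up_filter_spread.
- exact: up_partition.
pose W1 := fun i (w : ups i * ups i) => @real_part R _ T mu _ w.1.
pose W2 := fun i (w : ups i * ups i) => @real_part R _ T mu _ w.2.
have big1 : projT1 z @[z --> GG1] --> \oo.
  by move=> A /(@up_filter_big R G X a d sigma mu q) h; exact: (pull1 _ h).
have s2 : \forall z \near GG1, state_map bm (W2 _ (projT2 z)).
  by apply: filterS pos1 => z; exact: real_part_state.
have mc2 : mean_converges GG1 mu W2 by [].
have tame s n : generators (tr s (qr n)) by exists s, n.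
have [conc2 eq2] : (forall f, bm f -> concentrated (V := bm) a GG1 W2 f) /\
    (forall f, bm f -> equivariant a sigma GG1 W2 f).
  have h := @generated_measurable R G X a d sigma dy sigmaM _ GG1 FGG1 big1
    W2 mu s2 q qr genq qE mc2.
  have c2 n : concentrated (V := bm) a GG1 W2 (qr n).
    by split => // s; exact: (close1 _ (tame s n)).2.
  have e2 n : equivariant a sigma GG1 W2 (qr n).
    have e1 : equivariant a sigma GG1 W1 (qr n).
      move=> s e e0; exact: (pull1 _ (@up_filter_equivariant R G X a d sigma mu q qr rep n s e e0)).
    by apply: (equivariant_close FGG1 e1) => s; exact: (close1 _ (tame s n)).1.
  by split=> f bf; have [] := h c2 e2 f bf.
have [GG [FGG ev pull proj close]] := point_coupling FGG1 s2
  (fun f cf => concentrated_spread (conc2 f (ctbm cf))).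
pose Z := fun i => ((ups i * ups i) * homs i)%type.
pose H := fun i (w : Z i) => hom_real w.2.
have big : projT1 z @[z --> GG] --> \oo.
  by move=> A /big1 h; exact: (pull _ h).
have ctr s (f : X -> R) : @cts_real R X f -> cts_real (tr s f) by exact: cts_real_translate.
have sH : \forall z \near GG, state_map (@cts_real R X) (H _ (projT2 z)).
  by apply: filterS ev => z [x ex]; exact: (evaluates_state cX ex).
have cH f : cts_real f -> concentrated (V := @cts_real R X) a GG H f.
  move=> cf; split => // s e e0; apply: filterS ev => z [x ex].
  by rewrite (evaluates_spread cX ex) ?ltW//; exact: ctr.
have eH f : cts_real f -> equivariant a sigma GG H f.
  move=> cf; have e2 : equivariant a sigma GG (fun i (w : Z i) => W2 i w.1) f.
    by move=> s e e0; exact: (pull _ (eq2 f (ctbm cf) s e e0)).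
  by apply: (equivariant_close FGG e2) => s; exact: (close _ (ctr s f cf)).
have upl := hom_filter_limit ball FGG big ev (fun n => eH _ (@real_gen_continuous R X p n)).
have [PF [FPF pullP1 pullP2 small sep]] := pair_filter
  (fun i (w w' : Z i) => rho_seq p w.2 w'.2) FGG.
have /(sep (fun i (w w' : Z i) => (rho_seq q w.1.1 w'.1.1 <= eps%:E)%E))
  [eps' eps'0 [B GB Bsep]] : \forall z \near PF,
    (rho_seq q (projT2 z).1.1.1 (projT2 z).2.1.1 <= eps%:E)%E; last first.
  exists eps' => //; apply: (@growth_transfer R d ups _ Z
    (fun i (w : Z i) => w.1.1) (fun i w => w.2) _ _ _ _ _ _ GG).
  - move=> A GA; have [A' GA' h] := proj _ GA; have [A'' UA'' h'] := proj1 _ GA'.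
    exists A'' => // i y /h'[y' A'y]; have [y'' Ay] := h _ _ A'y.
    by exists ((y, y'), y'').
  - exact: upl.
  - by move=> i y; apply: rho_seq_refl; exact: ltW.
  - by exists B.
have ev1 := pullP1 _ ev; have ev2 := pullP2 _ ev.
have pclose n : vanishes PF (fun z => mean (fun k => `|H _ (projT2 z).1 (real_gen p n) k -
    H _ (projT2 z).2 (real_gen p n) k|)).
  move=> e e0; have r0 : 0 < e / 2 ^+ n.+1 by rewrite divr_gt0// exprn_gt0.
  apply: filterS3 ev1 ev2 (small _ r0) => z [x ex] [y ey].
  move=> /(rho_seq_cts_term ball ex ey n).
  by rewrite mulrCA mulfV ?mulr1// expf_neq0.
pose H1 := fun i (w : Z i * Z i) => H i w.1.
pose H2 := fun i (w : Z i * Z i) => H i w.2.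
have asy : forall f, cts_real f -> asymptotic a PF H1 H2 f.
  apply: (@asymptotic_continuous R G X a d sigma _ PF FPF H1 H2 cX
    (pullP1 _ sH) (pullP2 _ sH) p gen ball) => //.
  - by move=> f cf; split=> // s e e0; exact: (pullP1 _ ((cH f cf).2 s e e0)).
  - by move=> f cf; split=> // s e e0; exact: (pullP2 _ ((cH f cf).2 s e e0)).
  - by move=> n s e e0; exact: (pullP1 _ (eH _ (@real_gen_continuous R X p n) s e e0)).
  - by move=> n s e e0; exact: (pullP2 _ (eH _ (@real_gen_continuous R X p n) s e e0)).
have cclose f : cts_real f -> vanishes PF (fun z => mean (fun k =>
    `|W2 _ (projT2 z).1.1 f k - W2 _ (projT2 z).2.1 f k|)).
  move=> cf; pose gap i (w : Z i) := mean (fun k => `|H i w f k - W2 i w.1 f k|).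
  have v1 : vanishes PF (fun z => gap _ (projT2 z).1).
    by move=> e e0; exact: (pullP1 _ (close _ cf e e0)).
  have v2 : vanishes PF (fun z => gap _ (projT2 z).2).
    by move=> e e0; exact: (pullP2 _ (close _ cf e e0)).
  have := asy _ cf 1%g; rewrite translate1 => v3.
  apply: (vanishes_le (vanishesD v1 (vanishesD v2 v3))); apply: nearW => z.
  rewrite -!meanD; apply: mean_le => k; rewrite /H1 /H2 /W2 /=.
  set u1 := real_part _ _ _; set u2 := real_part _ _ _.
  set w1 := H _ _ _ _; set w2 := H _ _ _ _.
  rewrite (_ : u1 - u2 = - (w1 - u1) + ((w2 - u2) + (w1 - w2))); last by ring.
  rewrite (le_trans (ler_normD _ _))// normrN lerD2l.
  exact: ler_normD.
have s2' := pull _ s2.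
have qclose n : vanishes PF (fun z => mean (fun k =>
    `|W1 _ (projT2 z).1.1 (qr n) k - W1 _ (projT2 z).2.1 (qr n) k|)).
  apply: vanishes_approx => e e0; have e4 : 0 < e / 4 by rewrite divr_gt0.
  have [g cg qg] := continuous_dense cX mu (bqr n) e4.
  have bg := ctbm cg.
  pose gap i (w : Z i) := mean (fun k => `|W2 i w.1 (qr n) k - W1 i w.1 (qr n) k|).
  have vgap : vanishes GG (fun z => gap _ (projT2 z)).
    have := (close1 _ (tame 1%g n)).1; rewrite translate1 => v e' e'0.
    exact: (pull _ (v e' e'0)).
  have v1 : vanishes PF (fun z => gap _ (projT2 z).1).
    by move=> e' e'0; exact: (pullP1 _ (vgap _ e'0)).
  have v2 : vanishes PF (fun z => gap _ (projT2 z).2).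
    by move=> e' e'0; exact: (pullP2 _ (vgap _ e'0)).
  (* [g] is continuous and close to [qr n] under [mu], hence under the means. *)
  have near_g : \forall z \near GG, mean (fun k =>
      `|W2 _ (projT2 z).1 (qr n) k - W2 _ (projT2 z).1 g k|) <= e / 2.
    have bqg : bm (absf (qr n - g)) by apply: (fa_abs bmA); exact: (fa_sub bmA).
    have := pull _ (mc2 _ bqg _ e4); apply: filterS2 s2' => z sz h.
    apply: (le_trans (mean_sm_sub bmA sz (bqr n) bg)).
    have h' := le_trans (ler_norm _) h; rewrite lerBlDr in h'.
    apply: (le_trans h'); have -> : e / 2 = e / 4 + e / 4 by field.
    by rewrite lerD2l.
  exists (fun z => gap _ (projT2 z).1 + (gap _ (projT2 z).2 + mean (fun k =>
      `|W2 _ (projT2 z).1.1 g k - W2 _ (projT2 z).2.1 g k|))).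
    by apply: vanishesD => //; apply: vanishesD => //; exact: cclose.
  apply: filterS2 (pullP1 _ near_g) (pullP2 _ near_g) => z g1 g2.
  rewrite [e]splitr; apply: (le_trans _ (lerD (lexx _) (lerD g1 g2))).
  rewrite /gap -!meanD; apply: mean_le => k /=.
  set A1 := W1 _ _ _ _; set A2 := W1 _ _ _ _; set B1 := W2 _ _ (qr n) k.
  set C1 := W2 _ _ g k; set B2 := W2 _ _ (qr n) k; set C2 := W2 _ _ g k.
  rewrite (_ : A1 - A2 = - (B1 - A1) + ((B2 - A2) + (C1 - C2)) + ((B1 - C1) - (B2 - C2))); last by ring.
  rewrite (le_trans (ler_normD _ _))// lerD//.
    rewrite (le_trans (ler_normD _ _))// normrN lerD2l; exact: ler_normD.
  by rewrite (le_trans (ler_normD _ _))// normrN.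
have up1 : \forall z \near GG, unital_positive (projT2 z).1.1.
  exact: (pull _ (pull1 _ (up_filter_positive sigma q))).
have [N [e [e0 hs]]] := dyadic_sum_small eps0.
have qN : \forall z \near PF, forall n, List.In n (iota 0 N) -> mean (fun k =>
    `|W1 _ (projT2 z).1.1 (qr n) k - W1 _ (projT2 z).2.1 (qr n) k|) <= e.
  by apply: near_list => n _; exact: qclose.
apply: filterS3 (pullP1 _ up1) (pullP2 _ up1) qN => z u1 u2 hz.
apply: (rho_seq_Linf_small rep u1 u2 hs) => m mN; apply: hz; apply: mem_In.
by rewrite mem_iota.
Qed.

(** Microstates of an invariant measure, smeared and then contracted to points,
    are microstates of the action. *)
Lemma measure_le_top : (measure_entropy_seq sigma q <= top_entropy_seq a sigma p)%E.
Proof.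
rewrite measure_entropy_growth; apply: ge_ereal_sup => _ [eps eps0 <-].
have [eps' eps'0 hle] := growth_up_hom eps0; apply: (le_trans hle).
by rewrite top_entropy_growth; apply: ereal_sup_ubound; exists eps'.
Qed.

End MeasureLeTop.

(** * Existence of generating sequences *)

Section GeneratingContinuous.
Context {R : realType} {G : groupType} {X : metricType R}.
Hypothesis cX : compact [set: X].
Local Notation C := R[i].
Local Notation CX := (continuousType X C).

(** A partition into functions with supports of small diameter.  It is indexed
    by all natural numbers, with zero functions beyond [N], so that the
    partitions for all [m] form one sequence. *)
Lemma fine_partition (m : nat) : exists (h : nat -> X -> R) (N : nat),
  [/\ forall j, cts_real (h j), forall j x, 0 <= h j x,
      forall x, \sum_(j < N) h j x = 1 &
      forall j x y, h j x != 0 -> h j y != 0 -> mdist x y <= 2 / m.+1%:R].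
Proof.
pose r : R := m.+1%:R^-1; have r0 : 0 < r by rewrite invr_gt0.
pose g (c x : X) := Num.max 0 (r - mdist x c).
have cg c : continuous (g c).
  have cm : continuous (fun x : X => mdist x c).
    by apply: continuous_lipschitz => x y; rewrite addrC; exact: metric_triangle.
  have -> : g c = fun x => (0 + (r - mdist x c) + `|0 - (r - mdist x c)|) / 2.
    by apply/funext => x; rewrite /g maxr_absE.
  have h : continuous (fun x => r - mdist x c).
    by move=> x; apply: cvgB; [exact: cvg_cst|exact: cm].
  move=> x; apply: cvgMl; apply: cvgD; first by apply: cvgD; [exact: cvg_cst|exact: h].
  by apply: cvg_norm; apply: cvgB; [exact: cvg_cst|exact: h].
have g0 c x : 0 <= g c x by rewrite le_max lexx.
have gp c : 0 < g c c by rewrite /g mdistxx subr0 lt_max r0 orbT.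
have [J [c [w [cw w0 h1]]]] := partition_of_unity cX cg g0 gp.
pose h (j : nat) x := if insub j is Some i then
  g (c (enum_val (i : 'I_#|J|))) x * w x else 0.
exists h, #|J|; split.
- move=> j; rewrite /h; case: insub => [i|] x; last exact: cvg_cst.
  by apply: cvgM; [exact: cg|exact: cw].
- by move=> j x; rewrite /h; case: insub => [i|]; rewrite ?mulr_ge0.
- move=> x; rewrite -(h1 x) [RHS](reindex (@enum_val _ (mem J))) /=; last first.
    by exists (fun j => enum_rank j) => j _; rewrite ?enum_valK ?enum_rankK.
  by apply: eq_bigr => i _; rewrite /h valK.
- move=> j x y; rewrite /h; case: insub => [i|]; last by rewrite eqxx.
  have near_c z : g (c (enum_val i)) z * w z != 0 -> mdist z (c (enum_val i)) <= r.
    move=> nz; rewrite leNgt; apply/negP => far; move/eqP: nz; apply.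
    by rewrite /g max_l ?mul0r// subr_le0 ltW.
  move=> /near_c hx /near_c hy; apply: (le_trans (metric_triangle _ (c (enum_val i)) _)).
  rewrite [mdist (c _) y]metric_sym.
  by apply: (le_trans (lerD hx hy)); rewrite -/r; lra.
Qed.

Lemma uniformly_continuous_real (u : X -> R) (e : R) : continuous u -> 0 < e ->
  \forall m \near \oo, forall x y, mdist x y <= 2 / m.+1%:R -> `|u x - u y| <= e.
Proof.
move=> cu e0; have /compact_near_coveringP := cX.
move=> /(_ nat \oo (fun m x => forall y, mdist x y <= 2 / m.+1%:R -> `|u x - u y| <= e) _)[].
  move=> x _; have e2 : 0 < e / 2 by rewrite divr_gt0.
  have /cvgrPdist_le /(_ _ e2) /nbhs_ballP[r /= r0 ru] := cu x.
  have r2 : 0 < r / 2 by rewrite divr_gt0.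
  exists (ball x (r / 2), [set m | 2 / m.+1%:R < r / 2]) => /=.
    split; first exact: nbhsx_ballx.
    have : \forall m \near \oo, 4 / r < m%:R by exact: nbhs_infty_gtr.
    apply: filterS => m h /=; rewrite ltr_pdivrMr// -ltr_pdivrMl//.
    have -> : (r / 2)^-1 * 2 = 4 / r by field; exact: lt0r_neq0.
    by apply: (lt_trans h); rewrite ltr_nat.
  move=> [y m] /= [xy mr] z yz.
  have b1 : ball x r y by apply: le_ball xy; lra.
  have b2 : ball x r z.
    rewrite [r]splitr; apply: ball_triangle xy _; rewrite ballEmdist /=.
    exact: le_lt_trans yz mr.
  rewrite (_ : u y - u z = - (u x - u y) + (u x - u z)); last by ring.
  by rewrite (le_trans (ler_normD _ _))// normrN [e]splitr; apply: lerD; exact: ru.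
by move=> M _ hM; exists M => // m /hM h x y; exact: h.
Qed.

(** The members of partitions of unity of arbitrarily small mesh span a
    uniformly dense subspace, by uniform continuity. *)
Lemma exists_generating_cts (a : cts_action G X) : exists p : nat -> CX,
  unit_ball_cts p /\ dyn_generating_cts a p.
Proof.
have /choice[h hP] := fine_partition; have {hP}/choice[N hP] := hP.
have h1 m j x : (j < N m)%N -> 0 <= h m j x <= 1.
  have [_ h0 s1 _] := hP m; move=> jN; rewrite h0 /= -(s1 x) (bigD1 (Ordinal jN))//=.
  by rewrite lerDl sumr_ge0.
pose f n : X -> R := if (choice.unpickle n : option (nat * nat)) is Some mj
  then if (mj.2 < N mj.1)%N then h mj.1 mj.2 else cst 0 else cst 0.
have cf n : continuous (f n).
  rewrite /f; case: (choice.unpickle n) => [[m j] /=|]; last by move=> x; exact: cvg_cst.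
  case: ifP => _; last by move=> x; exact: cvg_cst.
  by have [ch _ _ _] := hP m; exact: ch.
have f1 n x : `|f n x| <= 1.
  rewrite /f; case: (choice.unpickle n) => [[m j] /=|]; last by rewrite normr0.
  case: ifP => jN; last by rewrite normr0.
  by have /andP[a0 a1] := h1 m j x jN; rewrite ger0_norm.
pose p n : CX := cts_of (f n).
have pE n x : p n x = (f n x)%:C%C by exact: (cts_ofE (cf n)).
exists p; split.
  by move=> n x; rewrite pE normc_complex; split => //; rewrite realE !lecE /= eqxx /=; exact: le_total.
move=> A [A1 Alin _ _ Acl] _ Ap; apply/seteqP; split => // u _; apply: Acl => e e0.
have e4 : 0 < e / 4 by rewrite divr_gt0.
have [m [mR mI]] := filter_ex (filterI (uniformly_continuous_real (@Re_cts R X u) e4)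
  (uniformly_continuous_real (@Im_cts R X u) e4)).
have [ch h0 s1 small] := hP m.
have close x y : mdist x y <= 2 / m.+1%:R -> normc (u x - u y) <= e / 2.
  move=> xy; apply: (le_trans (normc_le _)); rewrite ReB ImB.
  have -> : e / 2 = e / 4 + e / 4 by field.
  by apply: lerD; [exact: mR|exact: mI].
have /choice[b bP] : forall j, exists b : C, forall x, h m j x != 0 -> normc (u x - b) <= e / 2.
  move=> j; have [[y hy]|ny] := pselect (exists y, h m j y != 0).
    by exists (u y) => x hx; apply: close; exact: small hx hy.
  by exists 0 => x hx; exfalso; apply: ny; exists x.
pose v : CX := \sum_(j < N m) (b j *: p (choice.pickle (m, j : nat)) : CX).
have pj (j : 'I_(N m)) x : p (choice.pickle (m, j : nat)) x = (h m j x)%:C%C.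
  by rewrite pE /f choice.pickleK /= ltn_ord.
have A0 : A 0.
  by have := Alin (-1) 1 1 A1 A1; rewrite scaleN1r addNr.
exists v.
  apply: (@big_ind _ A) => // [x y Ax Ay|j _]; first by rewrite -[x]scale1r; exact: Alin.
  by rewrite -[_ *: _]addr0; exact: Alin.
move=> x; have -> : v x = \sum_(j < N m) b j * (h m j x)%:C%C.
  rewrite (big_morph (fun g : CX => g x) (id1 := 0) (op1 := +%R))//.
  by apply: eq_bigr => j _; rewrite -pj.
apply: (@le_lt_trans _ _ (e / 2)); last by rewrite ltr_pdivrMr// mulr_natr mulr2n ltrDl.
have -> : u x - \sum_(j < N m) b j * (h m j x)%:C%C =
    \sum_(j < N m) (h m j x)%:C%C * (u x - b j).
  rewrite -[u x in LHS]mul1r -[1](rmorph1 (real_complex R)) -(s1 x) rmorph_sum mulr_suml -sumrB.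
  by apply: eq_bigr => j _; rewrite mulrBr [_ * b j]mulrC.
apply: (@le_trans _ _ (\sum_(j < N m) h m j x * (e / 2))); last by rewrite -mulr_suml s1 mul1r.
apply: (big_ind2 (fun (z : C) (r : R) => normc z <= r)) => [|z r z' r' hz hz'|j _].
- by rewrite -(rmorph0 (real_complex R)) normc_complex normr0.
- by rewrite (le_trans (le_normcD _ _))// lerD.
- rewrite normcM normc_complex ger0_norm//; have [->|hj] := eqVneq (h m j x) 0.
    by rewrite !mul0r.
  by rewrite ler_wpM2l//; exact: bP.
Qed.

End GeneratingContinuous.

Section GeneratingMeasurable.
Context {R : realType} {G : groupType} {X : metricType R}.
Hypothesis cX : compact [set: X].
Context (a : cts_action G X) (mu : invariant_measure R a).
Local Notation C := R[i].
Local Notation CX := (continuousType X C).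
Local Notation LX := (Linf mu).
Local Notation T := (borel (im_nonempty mu)).
Local Notation bm := (@bounded_measurable R _ T).
Local Notation mm := (mean_mu mu).
Local Notation Re := complex.Re.
Local Notation Im := complex.Im.
Let bmA : function_algebra bm := bounded_measurable_algebra.

(** On uniformly bounded sets, convergence in the L1 norm implies convergence
    against every integrable function: truncate the latter. *)
Lemma integral_small (r : T -> R) (M e : R) : mu.-integrable setT (EFin \o r) ->
  0 <= M -> 0 < e -> exists2 delta, 0 < delta & forall w, bm w -> (forall x, `|w x| <= M) ->
    mm (absf w) <= delta -> `|\int[mu]_x (w x * r x)| <= e.
Proof.
move=> ir M0 e0.
have mr : measurable_fun setT r by apply/measurable_EFinP; exact: measurable_int ir.
(* By dominated convergence the integral of [tail n] tends to 0; where [r] is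
   at most [n], the integrand is at most [n * |w|]. *)
pose tail (n : nat) x : R := if n%:R < `|r x| then `|r x| else 0.
have mtail n : measurable_fun setT (tail n).
  apply: measurable_fun_ifT => //.
    by apply: measurable_fun_ltr => //; exact: measurableT_comp.
  exact: measurableT_comp.
have iar : mu.-integrable setT (EFin \o (fun x => `|r x|)) by exact: integrable_norm.
have tail_le n x : `|tail n x| <= `|r x|.
  by rewrite /tail; case: ifP => _; rewrite ?normr_id// normr0.
have itail n : mu.-integrable setT (EFin \o tail n).
  apply: (le_integrable _ _ _ iar) => //; first exact/measurable_EFinP.
  by move=> x _ /=; rewrite lee_fin normr_id.
have [_ cv] : mu.-integrable setT (EFin \o (cst 0 : T -> R)) /\
    (\int[mu]_x tail n x) @[n --> \oo] --> \int[mu]_x (cst 0 : T -> R) x.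
  apply: (dominated_Rintegral (B := EFin \o (fun x => `|r x|))) => //.
  - apply: nearW => x; apply: cvg_near_cst.
    have : \forall n \near \oo, `|r x| <= n%:R by exact: nbhs_infty_ger.
    by apply: filterS => n; rewrite /tail ltNge => ->.
  - by apply: nearW => x n; rewrite lee_fin.
have z0 : \int[mu]_x (cst 0 : T -> R) x = 0 by exact: (mean_mu_cst mu 0).
rewrite z0 in cv.
have e2 : 0 < e / 2 / (M + 1) by rewrite !divr_gt0// ltr_wpDl.
have [n hn] : exists n, \int[mu]_x tail n x <= e / 2 / (M + 1).
  have /cvgrPdist_le /(_ _ e2) := cv => /filter_ex[n hn]; exists n.
  by move: hn; rewrite sub0r normrN; apply: le_trans; exact: ler_norm.
exists (e / 2 / n.+1%:R); first by rewrite !divr_gt0.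
move=> w bw wM hw; have baw := fa_abs bmA bw.
have iw := bounded_measurable_integrable mu bw.
have iaw := bounded_measurable_integrable mu baw.
have wr x : `|w x * r x| <= n%:R * `|w x| + M * tail n x.
  rewrite normrM /tail; case: ltP => h.
    rewrite -[leLHS]add0r; apply: lerD; first by rewrite mulr_ge0.
    by rewrite ler_wpM2r.
  by rewrite mulr0 addr0 mulrC ler_wpM2r.
have i1 : mu.-integrable setT (EFin \o (fun x => n%:R * `|w x|)).
  exact: (bounded_measurable_integrable mu (fa_scale bmA n%:R baw)).
have i2 : mu.-integrable setT (EFin \o (fun x => M * tail n x)).
  exact: (integrableZl measurableT M (itail n)).
have i12 : mu.-integrable setT (EFin \o (fun x => n%:R * `|w x| + M * tail n x)).
  exact: (integrableD measurableT i1 i2).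
have iwr : mu.-integrable setT (EFin \o (fun x => w x * r x)).
  apply: (le_integrable _ _ _ i12) => //.
    apply/measurable_EFinP; apply: measurable_funM => //; by case: bw.
  move=> x _ /=; rewrite lee_fin (le_trans (wr x))//; exact: ler_norm.
apply: (le_trans (le_normr_Rintegral _ iwr)) => //.
apply: (@le_trans _ _ (\int[mu]_x (n%:R * `|w x| + M * tail n x))).
  apply: le_Rintegral => //; first exact: integrable_norm.
rewrite RintegralD// RintegralZl// RintegralZl//.
have -> : e = e / 2 + e / 2 by rewrite -splitr.
apply: lerD.
  apply: (@le_trans _ _ (n%:R * (e / 2 / n.+1%:R))); first exact: ler_wpM2l.
  rewrite mulrCA ler_piMr//; first by rewrite divr_ge0// ltW.
  by rewrite ler_pdivrMr// mul1r ler_nat.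
apply: (@le_trans _ _ (M * (e / 2 / (M + 1)))); first exact: ler_wpM2l.
rewrite mulrCA ler_piMr//; first by rewrite divr_ge0// ltW.
by rewrite ler_pdivrMr ?ltr_wpDl// mul1r lerDl.
Qed.

Section Closed.
Variable A : set LX.
Hypothesis vN : von_Neumann_subalgebra A.

Lemma von_Neumann_real_closed (u : T -> R) (M : R) : bm u -> 0 <= M ->
  (forall e, 0 < e -> exists v, [/\ bm v, A (Linf_of mu v),
    forall x, `|u x - v x| <= M & mm (absf (u - v)) <= e]) -> A (Linf_of mu u).
Proof.
have [_ _ _ _ Acl] := vN => bu M0 happ; apply: Acl => n g ig e e0.
have e4 : 0 < e / 4 by rewrite divr_gt0.
pose good delta k := forall w, bm w -> (forall x, `|w x| <= M) -> mm (absf w) <= delta ->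
  `|\int[mu]_x (w x * Re (g k x))| <= e / 4 /\ `|\int[mu]_x (w x * Im (g k x))| <= e / 4.
have : \forall delta \near (0 : R)^'+, forall k, List.In k (enum 'I_n) -> good delta k.
  apply: near_list => k _; have [ir ii] := ig k.
  have [d1 d10 h1] := integral_small ir M0 e4; have [d2 d20 h2] := integral_small ii M0 e4.
  have dm : 0 < Num.min d1 d2 by rewrite lt_min d10.
  near=> delta => w bw wM hw.
  have : delta <= Num.min d1 d2 by near: delta; exact: nbhs_right_le.
  by rewrite le_min => /andP[l1 l2]; split; [apply: h1|apply: h2] => //; exact: le_trans hw _.
move=> /(filterI (nbhs_right_gt (0 : R))) /filter_ex[delta [delta0 hd]].
have [v [bv Av uvM uvd]] := happ _ delta0; exists (Linf_of mu v) => // k.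
have [] := hd k (mem_In (mem_enum _ k)) (u - v) (fa_sub bmA bu bv) uvM uvd.
move=> hr hi; apply: (le_lt_trans (normc_le _)) => /=.
have -> : \int[mu]_x Re ((Linf_of mu u x - Linf_of mu v x) * g k x) =
    \int[mu]_x ((u - v) x * Re (g k x)).
  by apply: eq_Rintegral => x _; rewrite !Linf_ofE// -rmorphB ReM /= mul0r subr0.
have -> : \int[mu]_x Im ((Linf_of mu u x - Linf_of mu v x) * g k x) =
    \int[mu]_x ((u - v) x * Im (g k x)).
  by apply: eq_Rintegral => x _; rewrite !Linf_ofE// -rmorphB ImM /= mul0r addr0.
by apply: (le_lt_trans (lerD hr hi)); lra.
Unshelve. all: by end_near. Qed.

(** Almost everywhere equal functions have the same integrals. *)
Lemma von_Neumann_ae_closed (f h : LX) : A h -> (\forall x \ae mu, f x = h x) -> A f.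
Proof.
have [_ _ _ _ Acl] := vN => Ah fh; apply: Acl => n g ig e e0; exists h => // k.
have /Linf_predP[mfR mfI _] := valP f; have /Linf_predP[mhR mhI _] := valP h.
have [ir ii] := ig k.
have mgR : measurable_fun setT (fun x => Re (g k x)).
  by apply/measurable_EFinP; exact: measurable_int ir.
have mgI : measurable_fun setT (fun x => Im (g k x)).
  by apply/measurable_EFinP; exact: measurable_int ii.
have zero (v : T -> R) : measurable_fun setT v -> (\forall x \ae mu, v x = 0) ->
    \int[mu]_x v x = 0.
  move=> mv v0; rewrite -(mean_mu_cst mu 0); congr fine; apply: ae_eq_integral => //.
  - exact/measurable_EFinP.
  - exact/measurable_EFinP.
  - by apply: filterS v0 => x ->.
have -> : cintegral mu (fun x => (f x - h x) * g k x) = 0.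
  apply: complex_eq => /=; apply: zero.
  - rewrite (_ : (fun x => _) = fun x => (Re (f x) - Re (h x)) * Re (g k x) -
      (Im (f x) - Im (h x)) * Im (g k x)); last by apply/funext => x; rewrite ReM ReB ImB.
    by apply: measurable_funB; apply: measurable_funM => //; exact: measurable_funB.
  - by apply: filterS fh => x ->; rewrite subrr mul0r.
  - rewrite (_ : (fun x => _) = fun x => (Re (f x) - Re (h x)) * Im (g k x) +
      (Im (f x) - Im (h x)) * Re (g k x)); last by apply/funext => x; rewrite ImM ReB ImB.
    by apply: measurable_funD; apply: measurable_funM => //; exact: measurable_funB.
  - by apply: filterS fh => x ->; rewrite subrr mul0r.
by rewrite -(rmorph0 (real_complex R)) normc_complex normr0.
Qed.

End Closed.

(** A generating sequence of continuous functions also generates the bounded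
    measurable ones: a von Neumann subalgebra containing it contains all
    continuous functions, which are dense in the L1 norm; clipping keeps the
    approximations uniformly bounded. *)
Lemma exists_generating_Linf : exists q : nat -> LX,
  unit_ball_Linf q /\ dyn_generating_Linf q.
Proof.
have [p [ball gen]] := exists_generating_cts cX a.
have ctbm (f : X -> R) : cts_real f -> bm f by exact: continuous_bounded_measurable.
have bp n : bm (real_gen p n) by apply: ctbm; exact: real_gen_continuous.
pose q n := Linf_of mu (real_gen p n); exists q; split.
  move=> n; split.
    by apply: nearW => x; rewrite Linf_ofE// realE !lecE /= eqxx /=; exact: le_total.
  have mu0 : (0 < mu [set: T])%E by rewrite probability_setT lte01.
  rewrite unlock /Lnorm mu0; apply/ess_supP; apply: nearW => x.
  by rewrite /= lee_fin ger0_norm ?normc_ge0// Linf_ofE// normc_complex real_gen_bnd.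
move=> A vN Atr Aq; have [A1 Alin Amul _ _] := vN.
have ctA := @cts_real_algebra R X cX.
have PT : @cts_real R X `<=` [set u | cts_real u /\ A (Linf_of mu u)].
  apply: (generating_cts_ind gen ball).
  - by move=> u [].
  - move=> c; split; first exact: (fa_cst ctA).
    have b1 : bm (cst 1) by exact: (fa_cst bmA).
    have A0 : A 0 by have := Alin (-1) 1 1 A1 A1; rewrite scaleN1r addNr.
    have -> : cst c = c *: cst 1 + cst 0 :> (T -> R).
      by apply/funext => x; rewrite !fctE /GRing.scale/= mulr1 addr0.
    have b0 : bm (cst 0) by exact: (fa_cst bmA).
    rewrite Linf_of_lin// Linf_of1; apply: Alin => //.
    suff -> : Linf_of mu (cst 0) = 0 by [].
    by apply: Linf_eq => x; rewrite Linf_ofE.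
  - move=> c f g [cf Af] [cg Ag]; split; first exact: (fa_lin ctA).
    by rewrite Linf_of_lin; [exact: Alin|exact: ctbm|exact: ctbm].
  - move=> f g [cf Af] [cg Ag]; split; first exact: (fa_mul ctA).
    by rewrite Linf_of_mul; [exact: Amul|exact: ctbm|exact: ctbm].
  - move=> s f [cf Af]; split; first exact: cts_real_translate.
    by rewrite Linf_of_translate; [exact: Atr|exact: ctbm].
  - move=> f cf fapp; split => //.
    apply: (von_Neumann_real_closed vN (M := 1)) => //; first exact: ctbm.
    move=> e e0; have m0 : 0 < Num.min e 1 by rewrite lt_min e0 /=.
    have [g [cg Ag] fg] := fapp _ m0; have bg := ctbm g cg; exists g; split => //.
      by move=> x; rewrite (le_trans (fg x))// ge_min lexx orbT.
    apply: (@le_trans _ _ (mm (cst e))); last by rewrite mean_mu_cst.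
    apply: mean_mu_le.
    + by apply: (fa_abs bmA); apply: (fa_sub bmA) => //; exact: ctbm.
    + exact: (fa_cst bmA).
    + by move=> x; rewrite (le_trans (fg x))// ge_min lexx.
  - by move=> n; split; [exact: real_gen_continuous|exact: Aq].
have BT u : bm u -> A (Linf_of mu u).
  move=> bu; have [M0 uM0] := bu.2; pose M := `|M0|.
  have uM x : `|u x| <= M by rewrite (le_trans (uM0 x))// ler_norm.
  have Mge : 0 <= M by exact: normr_ge0.
  (* The projection of the line onto [-M, M]. *)
  pose clip (y : R) := (`|y + M| - `|y - M|) / 2.
  have clipM y : `|clip y| <= M.
    rewrite /clip ler_norml; apply/andP.
    by case: (ger0P (y + M)) => h1; case: (ger0P (y - M)) => h2; split; lra.
  have clip_close y z : `|y| <= M -> `|y - clip z| <= `|y - z|.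
    rewrite ler_norml => /andP[y1 y2]; rewrite /clip.
    case: (ger0P (z + M)) => h1; case: (ger0P (z - M)) => h2; try lra;
      by rewrite ler_norml; case: (ger0P (y - z)) => h3; apply/andP; split; lra.
  apply: (von_Neumann_real_closed vN (M := 2 * M)) => //; first by rewrite mulr_ge0.
  move=> e e0; have [g cg ug] := continuous_dense cX mu bu e0.
  pose v x := clip (g x); have cv : @cts_real R X v.
    move=> x; apply: cvgMl; apply: cvgB; apply: cvg_norm.
      by apply: cvgD; [exact: cg|exact: cvg_cst].
    by apply: cvgB; [exact: cg|exact: cvg_cst].
  have bv := ctbm _ cv; have bg := ctbm _ cg; exists v; split => //.
  - by have [] := PT _ cv.
  - by move=> x; rewrite (le_trans (ler_normB _ _))// mulr_natl mulr2n; apply: lerD; [exact: uM|exact: clipM].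
  - apply: le_trans ug; apply: mean_mu_le.
    + by apply: (fa_abs bmA); exact: (fa_sub bmA).
    + by apply: (fa_abs bmA); exact: (fa_sub bmA).
    + by move=> x; apply: clip_close.
apply/seteqP; split => // f _.
have [br fr] := bounded_rep_Re f; have [bi fi] := bounded_rep_Im f.
pose h : LX := 'i%C *: Linf_of mu (bounded_rep mu (fun x => Im (f x))) +
  Linf_of mu (bounded_rep mu (fun x => Re (f x))).
apply: (von_Neumann_ae_closed vN (h := h)); first by apply: Alin; exact: BT.
apply: filterS2 fr fi => x fr fi; rewrite Linf_linE !Linf_ofE// -fr -fi.
by apply: complex_eq; rewrite ?ReD ?ImD ?ReM ?ImM /=; ring.
Qed.

End GeneratingMeasurable.

(** * The variational principle *)

Lemma le_from_below {R : realType} (x y : \bar R) :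
  (forall h : R, (h%:E < x)%E -> (h%:E <= y)%E) -> (x <= y)%E.
Proof.
move=> hxy; case: x hxy => [r||] hxy; last by rewrite leNye.
  apply/lee_subgt0Pr => e e0; rewrite -EFinB; apply: hxy.
  by rewrite lte_fin ltrBlDr ltrDl.
suff -> : y = +oo%E by [].
by apply/eqyP => A _; apply: hxy; rewrite ltry.
Qed.

Theorem theorem6p1 (R : realType) (G : groupType) (X : metricType R)
    (a : cts_action G X) (d : nat -> nat) (sigma : forall i, G -> 'S_(d i)) :
  countable [set: G] -> sofic R G -> compact [set: X] ->
  sofic_approximation R sigma ->
  top_entropy R a sigma =
    ereal_sup [set measure_entropy mu sigma | mu in [set: invariant_measure R a]]
  /\ (top_entropy R a sigma <> -oo%E -> [set: invariant_measure R a] !=set0).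

Proof.
move=> _ _ cX [dy sigmaM _].
have [p [ball gen ->]] : exists p, [/\ unit_ball_cts p, dyn_generating_cts a p &
    top_entropy R a sigma = top_entropy_seq a sigma p].
  rewrite /top_entropy; case: xgetP => [_ -> [p [ball gen ->]]|none]; first by exists p.
  have [p [ball gen]] := exists_generating_cts cX a.
  by exfalso; apply: (none (top_entropy_seq a sigma p)); exists p.
have muE (mu : invariant_measure R a) : exists q : nat -> Linf mu, [/\ unit_ball_Linf q,
    dyn_generating_Linf q & measure_entropy mu sigma = measure_entropy_seq sigma q].
  rewrite /measure_entropy; case: xgetP => [_ -> [q [ballq genq ->]]|none]; first by exists q.
  have [q [ballq genq]] := exists_generating_Linf cX mu.
  by exfalso; apply: (none (measure_entropy_seq sigma q)); exists q.
have below h : (h%:E < top_entropy_seq a sigma p)%E -> exists mu : invariant_measure R a,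
    (h%:E <= measure_entropy mu sigma)%E.
  move=> /(top_le_measure cX dy sigmaM ball gen)[mu hmu]; exists mu.
  by have [q [ballq genq ->]] := muE mu; exact: hmu.
split.
  apply/eqP; rewrite eq_le; apply/andP; split.
    apply: le_from_below => h /below[mu hmu]; apply: (le_trans hmu).
    by apply: ereal_sup_ubound; exists mu.
  apply: ge_ereal_sup => _ [mu _ <-]; have [q [ballq genq ->]] := muE mu.
  have [qr rep] := unit_ball_represents ballq.
  exact: (measure_le_top cX dy sigmaM rep genq ball gen).
move=> ent; apply: contrapT => none; apply: ent; apply/eqP.
rewrite -leeNy_eq; apply: le_from_below => h /below[mu _].
by case: none; exists mu.
Qed.
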